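(* If $1\le p\le\infty$ then $W^1_p(\mathbb R)\hookrightarrow B^{1,\mathrm{dyad}}_{p,\infty}(\mathbb R)$, i.e. $W^1_p(\mathbb R)\subset B^{1,\mathrm{dyad}}_{p,\infty}(\mathbb R)$ with continuous inclusion.
   Context: $W^1_p(\mathbb R)$ is the Sobolev space with norm $\|f\|_{W^1_p}=\|f\|_p+\|f'\|_p$. Let $\eta_0\in C_c^\infty(\mathbb R)$ be supported in $\{|\xi|<3/4\}$ with $\eta_0(\xi)=1$ for $|\xi|\le 1/2$. For $f\in\mathcal S'(\mathbb R)$ let $\widehat{\Delta_0f}=\eta_0\widehat f$ and $\widehat{\Delta_kf}(\xi)=(\eta_0(2^{-k}\xi)-\eta_0(2^{-k+1}\xi))\widehat f(\xi)$, $k\ge1$. $\mathscr B:=B^{-1}_{\infty,1}(\mathbb R)$ is the Besov space with norm $\sum_{k\ge0}2^{-k}\|\Delta_kf\|_\infty$. For a bounded interval $I$ and $f\in\mathscr B$ set $\langle f,\mathbf 1_I\rangle:=\sum_{k\ge0}\int_I\Delta_kf(x)\,dx$ (this series converges absolutely and defines a bounded linear functional on $\mathscr B$, extending $f\mapsto\int_If$); extend by linearity to finite linear combinations of indicator functions of bounded intervals. Haar system: $h=\mathbf 1_{[0,1/2)}-\mathbf 1_{[1/2,1)}$, $h_{j,\mu}(x)=h(2^jx-\mu)$ for $j\ge0$, $\mu\in\mathbb Z$, and $h_{-1,\mu}=\mathbf 1_{[\mu,\mu+1)}$. $B^{1,\mathrm{dyad}}_{p,\infty}(\mathbb R)$ is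 the set of $f\in\mathscr B$ with finite norm $\|f\|_{B^{1,\mathrm{dyad}}_{p,\infty}}=\sup_{j\ge-1}2^{j(1-1/p)}\big(\sum_{\mu\in\mathbb Z}|2^j\langle f,h_{j,\mu}\rangle|^p\big)^{1/p}$ (supremum over $\mu$ if $p=\infty$). *)

(* Defs.v *)
From HB Require Import structures.
From mathcomp Require Import all_boot all_order all_algebra.
From mathcomp Require Import complex.
From mathcomp Require Import all_classical all_reals all_analysis.

Set Implicit Arguments.
Unset Strict Implicit.
Unset Printing Implicit Defensive.

Import Order.TTheory GRing.Theory Num.Theory.
Import numFieldNormedType.Exports.
Import ComplexField.Normc.

Local Open Scope classical_set_scope.
Local Open Scope ring_scope.
Local Open Scope complex_scope.

Section ComplexFunctions.
Context {R : realType}.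
Implicit Types (f g : R -> R[i]) (D : set R) (p : \bar R).
Notation mu := (@lebesgue_measure R).

Definition re_fun f : R -> R := fun x => complex.Re (f x).
Definition im_fun f : R -> R := fun x => complex.Im (f x).

Definition cmeasurable f :=
  measurable_fun [set: R] (re_fun f) /\ measurable_fun [set: R] (im_fun f).

Definition ccontinuous f := continuous (re_fun f) /\ continuous (im_fun f).

Definition clocally_integrable f :=
  locally_integrable [set: R] (re_fun f) /\
  locally_integrable [set: R] (im_fun f).

Definition cintegral D f : R[i] :=
  (\int[mu]_(x in D) re_fun f x) +i* (\int[mu]_(x in D) im_fun f x).

Definition cderiv n f : R -> R[i] :=
  fun x => ((re_fun f)^`(n))%classic x +i* ((im_fun f)^`(n))%classic x.

Definition csmooth f := forall n x,
  derivable ((re_fun f)^`(n))%classic x 1 /\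
  derivable ((im_fun f)^`(n))%classic x 1.

Definition cLnorm p f : \bar R := Lnorm mu p (fun x => (normc (f x))%:E).

Definition csupport f : set R := closure [set x | f x != 0].

Definition test_function f := csmooth f /\ compact (csupport f).

Definition schwartz f := csmooth f /\
  forall m n : nat, exists M : R, forall x,
    `|x| ^+ m * normc (cderiv n f x) <= M.

Definition fourier f : R -> R[i] := fun xi =>
  cintegral [set: R] (fun x =>
    f x * (cos (2 * pi * x * xi) -i* sin (2 * pi * x * xi))).

End ComplexFunctions.

Section TemperedDistributions.
Context {R : realType}.

(* A distribution is a functional on all functions of which only the values on
   Schwartz functions matter: every notion below ignores the other values. *)
Definition schwartz_functional := (R -> R[i]) -> R[i].

Implicit Types (T : schwartz_functional) (f g m phi psi : R -> R[i]).

(* The second condition is continuity for the Schwartz seminorms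
   sup_x |x|^m |phi^(n)(x)|: |T phi| is at most C times the largest of those
   with m, n <= N. *)
Definition tempered T :=
  (forall (a : R[i]) phi psi, schwartz phi -> schwartz psi ->
     T (fun x => a * phi x + psi x) = a * T phi + T psi) /\
  exists (C : R) (N : nat), forall phi (M : R), schwartz phi ->
    (forall (m n : nat), (m <= N)%N -> (n <= N)%N ->
       forall x, `|x| ^+ m * normc (cderiv n phi x) <= M) ->
    normc (T phi) <= C * M.

Definition distr_of f : schwartz_functional :=
  fun phi => cintegral [set: R] (fun x => f x * phi x).

Definition fourierD T : schwartz_functional := fun phi => T (fourier phi).

Definition mulD m T : schwartz_functional := fun phi => T (fun x => m x * phi x).

Definition eqD (S T : schwartz_functional) := forall phi, schwartz phi -> S phi = T phi.

Definition poly_growth f :=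
  exists (C : R) (N : nat), forall x, normc (f x) <= C * (1 + `|x|) ^+ N.

End TemperedDistributions.
Arguments schwartz_functional : clear implicits.

Section Besov.
Context {R : realType}.
Implicit Types (T : schwartz_functional R).

Definition cutoff (eta0 : R -> R[i]) :=
  [/\ test_function eta0,
      csupport eta0 `<=` [set xi | `|xi| < 3 / 4] &
      forall xi, `|xi| <= 1 / 2 -> eta0 xi = 1].

Definition etak (eta0 : R -> R[i]) (k : nat) : R -> R[i] :=
  if k is k'.+1 then
    fun xi => eta0 (xi / 2 ^+ k'.+1) - eta0 (xi / 2 ^+ k')
  else eta0.

(* By the Paley-Wiener-Schwartz theorem, for tempered T the distribution
   Delta_k T is given by a unique continuous function of polynomial growth,
   so that the choice in Delta is neither arbitrary nor a default value. *)
Definition is_Delta eta0 k T (g : R -> R[i]) :=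
  [/\ ccontinuous g, poly_growth g &
      eqD (fourierD (distr_of g)) (mulD (etak eta0 k) (fourierD T))].

Definition Delta eta0 k T : R -> R[i] := xget (cst 0) (is_Delta eta0 k T).

Definition besov_norm eta0 T : \bar R :=
  (\sum_(0 <= k <oo) (2 ^- k)%:E * cLnorm +oo (Delta eta0 k T))%E.

Definition besov eta0 : set (schwartz_functional R) :=
  [set T | tempered T /\ (besov_norm eta0 T < +oo)%E].

Definition pair_indic eta0 T (I : interval R) : R[i] :=
  let u := fun k => cintegral [set` I] (Delta eta0 k T) in
  limn (series (fun k => complex.Re (u k))) +i*
  limn (series (fun k => complex.Im (u k))).

(* [:: (c_1, I_1); ...; (c_n, I_n)] stands for the linear combination of
   indicator functions c_1 1_{I_1} + ... + c_n 1_{I_n}. *)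
Definition step_fun (s : seq (R * interval R)) : R -> R :=
  fun x => \sum_(cI <- s) cI.1 * \1_[set` cI.2] x.

Definition pair_step eta0 T (s : seq (R * interval R)) : R[i] :=
  \sum_(cI <- s) cI.1%:C * pair_indic eta0 T cI.2.

Definition haar_mother : R -> R :=
  fun x => \1_`[0, 1 / 2[ x - \1_`[1 / 2, 1[ x.

Definition haar (j mu : int) : R -> R :=
  if j == -1 then \1_`[mu%:~R, mu%:~R + 1[
  else fun x => haar_mother (2 ^ j * x - mu%:~R).

Definition haar_step (j mu : int) : seq (R * interval R) :=
  if j == -1 then [:: (1, `[mu%:~R, mu%:~R + 1[)]
  else [:: (1, `[mu%:~R / 2 ^ j, (mu%:~R + 1 / 2) / 2 ^ j[);
           (-1, `[(mu%:~R + 1 / 2) / 2 ^ j, (mu%:~R + 1) / 2 ^ j[)].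

Lemma haar_stepE j mu : step_fun (haar_step j mu) = haar j mu.
Proof.
apply/funext => x; rewrite /step_fun /haar_step /haar.
case: ifP => _; first by rewrite big_seq1 mul1r.
rewrite big_cons /haar_mother big_seq1 /= !mul1r mulN1r !indicE.
have j0 : (0 : R) < 2 ^ j by rewrite exprz_gt0.
have in_itvE (a b : R) :
    (x \in `[(mu%:~R + a) / 2 ^ j, (mu%:~R + b) / 2 ^ j[%classic) =
    (2 ^ j * x - mu%:~R \in `[a, b[%classic).
  by apply/idP/idP; rewrite !inE /= !in_itv /= ler_pdivrMr// ltr_pdivlMr//;
    rewrite lerBrDl ltrBlDl [x * _]mulrC.
by have := in_itvE 0 2^-1; rewrite addr0 => ->; rewrite in_itvE.
Qed.

Definition haar_coef (eta0 : R -> R[i]) T (j mu : int) : R[i] :=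
  pair_step eta0 T (haar_step j mu).

Definition lp_norm (p : \bar R) (a : int -> R) : \bar R :=
  match p with
  | r%:E => ((\esum_(mu in [set: int]) (`|a mu| `^ r)%:E) `^ r^-1)%E
  | _ => ereal_sup [set `|a mu|%:E | mu in [set: int]]
  end.

(* fine p^-1 is 1/p, with 1/oo = 0. *)
Definition dyad_level_norm (eta0 : R -> R[i]) (p : \bar R) T (j : int) : \bar R :=
  ((2 `^ (j%:~R * (1 - fine (p^-1)%E)))%:E *
   lp_norm p (fun mu => normc ((2 ^ j)%:C * haar_coef eta0 T j mu)%R))%E.

Definition dyad_norm (eta0 : R -> R[i]) (p : \bar R) T : \bar R :=
  ereal_sup [set dyad_level_norm eta0 p T j | j in [set j : int | -1 <= j]].

Definition besov_dyad eta0 p : set (schwartz_functional R) :=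
  [set T | besov eta0 T /\ (dyad_norm eta0 p T < +oo)%E].

End Besov.

Section Sobolev.
Context {R : realType}.
Implicit Types (f g : R -> R[i]) (p : \bar R).

Definition weak_derivative f g := clocally_integrable g /\
  forall phi, test_function phi ->
    cintegral [set: R] (fun x => f x * cderiv 1 phi x) =
    - cintegral [set: R] (fun x => g x * phi x).

Definition inLp p f := cmeasurable f /\ (cLnorm p f < +oo)%E.

Definition sobolev p : set (R -> R[i]) :=
  [set f | inLp p f /\ exists g, inLp p g /\ weak_derivative f g].

(* The weak derivative is unique up to a null set. *)
Definition wderiv f : R -> R[i] := xget (cst 0) (weak_derivative f).

Definition sobolev_norm p f : \bar R := (cLnorm p f + cLnorm p (wderiv f))%E.

End Sobolev.

(* Main.v *)
Require Import Defs.
From HB Require Import structures.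
From mathcomp Require Import all_boot all_order all_algebra.
From mathcomp Require Import complex.
From mathcomp Require Import all_classical all_reals all_analysis.
From mathcomp Require Import measurable_realfun ess_sup_inf.
From mathcomp Require Import ring lra.

(** Let f be in W^1_p with weak derivative g.  Almost everywhere f equals a
    continuous primitive F of g ([weak_derivative_primitive]).  The value F x
    differs from the mean of F over [x, x + 1] by at most the integral of |g|
    there, and both are controlled by L^p norms, so F is bounded.

    The pairing of the distribution f with the indicator function of an
    interval I is the integral of F over I ([pair_indicE]).  Indeed, put
    K = fourier eta0.  Fourier inversion for eta0 shows that the sum of
    Delta_0 f, ..., Delta_k f is y |-> int F (y + 2^-k z) K z dz.  Since K is
    integrable with integral eta0 0 = 1, these functions are bounded uniformly
    in k and tend pointwise to F, and dominated convergence on I gives the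
    claim.  The same formula bounds Delta_k f uniformly in k, so the Besov norm
    is finite.  Here Delta_k f is defined only through its Fourier transform;
    that no other continuous function will do ([eq_of_fourier_dual]) follows by
    testing with modulated Gaussians, whose transforms are translates of
    arbitrarily narrow Gaussians.

    The two halves of the support I_{j,m} of h_{j,m}, j >= 0, are translates of
    each other by 2^-(j+1).  Hence <f, h_{j,m}> is the integral over one half
    of increments of F, each at most the integral of |g| over I_{j,m}, and
    |2^j <f, h_{j,m}>| <= int_{I_{j,m}} |g| ([haar_coef_le]).  By Hoelder's
    inequality (int_I |g|)^p <= |I|^(p-1) int_I |g|^p, and summing over the
    disjoint intervals I_{j,m} of length 2^-j gives
    2^(j(1-1/p)) ||(2^j <f, h_{j,m}>)_m||_p <= ||g||_p
    ([lp_norm_local_averages]).  On the level j = -1 the same argument with F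
    in place of g bounds the norm by ||f||_p ([haar_coef_scaling_le]).  So the
    embedding has norm at most 1. *)

Set Implicit Arguments.
Unset Strict Implicit.
Unset Printing Implicit Defensive.

Import Order.TTheory GRing.Theory Num.Theory.
Import numFieldNormedType.Exports.
Import ComplexField.Normc.

Local Open Scope classical_set_scope.
Local Open Scope ring_scope.
Local Open Scope complex_scope.

(** * Complex numbers and the unit character *)

Section ComplexNumbers.
Context {R : realType}.
Implicit Types z w : R[i].

Lemma complex_ext z w :
  complex.Re z = complex.Re w -> complex.Im z = complex.Im w -> z = w.
Proof. by case: z w => [a b] [c d] /= -> ->. Qed.

Lemma Re_mul z w : complex.Re (z * w) =
  complex.Re z * complex.Re w - complex.Im z * complex.Im w.
Proof. by case: z w => [a b] [c d]. Qed.

Lemma Im_mul z w : complex.Im (z * w) =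
  complex.Re z * complex.Im w + complex.Im z * complex.Re w.
Proof. by case: z w => [a b] [c d]. Qed.

Lemma Re_add z w : complex.Re (z + w) = complex.Re z + complex.Re w.
Proof. by case: z w => [a b] [c d]. Qed.

Lemma Im_add z w : complex.Im (z + w) = complex.Im z + complex.Im w.
Proof. by case: z w => [a b] [c d]. Qed.

Lemma Re_opp z : complex.Re (- z) = - complex.Re z.
Proof. by case: z. Qed.

Lemma Im_opp z : complex.Im (- z) = - complex.Im z.
Proof. by case: z. Qed.

Lemma normc_ge0 z : 0 <= normc z.
Proof. by case: z => a b; exact: sqrtr_ge0. Qed.

Lemma normr_Re_le z : `|complex.Re z| <= normc z.
Proof.
by case: z => a b /=; rewrite -sqrtr_sqr ler_wsqrtr// lerDl sqr_ge0.
Qed.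

Lemma normr_Im_le z : `|complex.Im z| <= normc z.
Proof.
by case: z => a b /=; rewrite -sqrtr_sqr ler_wsqrtr// lerDr sqr_ge0.
Qed.

Lemma normc_le z : normc z <= `|complex.Re z| + `|complex.Im z|.
Proof.
case: z => a b /=.
rewrite -(ger0_norm (addr_ge0 (normr_ge0 a) (normr_ge0 b))) -sqrtr_sqr.
rewrite ler_wsqrtr// sqrrD !real_normK ?num_real// lerD2r lerDl.
by rewrite mulrn_wge0// mulr_ge0.
Qed.

Lemma normc_real (a : R) : normc (a%:C) = `|a|.
Proof. by rewrite /= expr0n/= addr0 sqrtr_sqr. Qed.

Lemma normc_sub z w : normc (z - w) <= normc z + normc w.
Proof. by rewrite -[normc w]normcN; exact: le_normcD. Qed.

Definition expi (t : R) : R[i] := cos t +i* sin t.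

Lemma expiD (s t : R) : expi (s + t) = expi s * expi t.
Proof.
by apply: complex_ext; rewrite ?Re_mul ?Im_mul /= ?cosD ?sinD//; ring.
Qed.

Lemma expi0 : expi 0 = 1.
Proof. by rewrite /expi cos0 sin0. Qed.

Lemma expiN (t : R) : expi (- t) = cos t -i* sin t.
Proof. by rewrite /expi cosN sinN. Qed.

Lemma normc_expi (t : R) : normc (expi t) = 1.
Proof. by rewrite /= cos2Dsin2 sqrtr1. Qed.

End ComplexNumbers.

(** * Measurable and continuous complex functions *)

Section ComplexMeasurability.
Context {R : realType}.

(** The domain is arbitrary because Fubini's theorem needs measurability on the
    product of two lines. *)
Definition cmeas d (T : measurableType d) (f : T -> R[i]) :=
  measurable_fun [set: T] (fun x => complex.Re (f x)) /\
  measurable_fun [set: T] (fun x => complex.Im (f x)).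

Section generic.
Context d (T : measurableType d).
Implicit Types f g : T -> R[i].

Lemma cmeasM f g : cmeas f -> cmeas g -> cmeas (fun x => f x * g x).
Proof.
move=> [fr fi] [gr gi]; split.
  under eq_fun do rewrite Re_mul.
  by apply: measurable_funB; exact: measurable_funM.
under eq_fun do rewrite Im_mul.
by apply: measurable_funD; exact: measurable_funM.
Qed.

Lemma cmeas_real (f : T -> R) : measurable_fun setT f ->
  cmeas (fun x => (f x)%:C).
Proof. by move=> mf; split => //=; exact: measurable_cst. Qed.

End generic.

Lemma cmeas_comp d d' (T : measurableType d) (U : measurableType d')
    (g : U -> R[i]) (f : T -> U) :
  cmeas g -> measurable_fun setT f -> cmeas (g \o f).
Proof.
move=> [gr gi] mf; split.
  exact: (measurableT_comp gr mf).
exact: (measurableT_comp gi mf).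
Qed.

Lemma continuous_cmeas (f : R -> R[i]) : ccontinuous f -> cmeas f.
Proof. by move=> [fr fi]; split; exact: continuous_measurable_fun. Qed.

Lemma ccontinuous_expi : ccontinuous (@expi R).
Proof.
by split => x; [exact: continuous_cos|exact: continuous_sin].
Qed.

Lemma ccontinuousM (f g : R -> R[i]) : ccontinuous f -> ccontinuous g ->
  ccontinuous (fun x => f x * g x).
Proof.
move=> [fr fi] [gr gi]; rewrite /ccontinuous /re_fun /im_fun; split => x.
  under eq_fun do rewrite Re_mul.
  by apply: cvgB; apply: cvgM; [exact: fr|exact: gr|exact: fi|exact: gi].
under eq_fun do rewrite Im_mul.
by apply: cvgD; apply: cvgM; [exact: fr|exact: gi|exact: fi|exact: gr].
Qed.

Lemma ccontinuousB (f g : R -> R[i]) : ccontinuous f -> ccontinuous g ->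
  ccontinuous (fun x => f x - g x).
Proof.
move=> [fr fi] [gr gi]; rewrite /ccontinuous /re_fun /im_fun; split => x.
  under eq_fun do rewrite Re_add Re_opp.
  by apply: cvgB; [exact: fr|exact: gr].
under eq_fun do rewrite Im_add Im_opp.
by apply: cvgB; [exact: fi|exact: gi].
Qed.

Lemma ccontinuous_cst c : ccontinuous (fun _ : R => c : R[i]).
Proof. by split => x; exact: cvg_cst. Qed.

Lemma ccontinuous_comp (f : R -> R[i]) (u : R -> R) : ccontinuous f ->
  continuous u -> ccontinuous (f \o u).
Proof.
move=> [fr fi] cu; split => x.
  exact: (continuous_comp (cu x) (fr (u x))).
exact: (continuous_comp (cu x) (fi (u x))).
Qed.

End ComplexMeasurability.

(** * Integration on the line: domination and affine change of variables *)

Section RealIntegral.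
Context {R : realType}.
Notation mu := (@lebesgue_measure R).
Implicit Types f g h : R -> R.

Definition rintegrable f := mu.-integrable [set: R] (EFin \o f).

Lemma rintegrable_meas f : rintegrable f -> measurable_fun setT f.
Proof. by move=> /measurable_int /measurable_EFinP. Qed.

Lemma rintegrable_le f h : measurable_fun setT f -> rintegrable h ->
  (forall x, `|f x| <= h x) -> rintegrable f.
Proof.
move=> mf ih fh; apply: (le_integrable _ _ _ ih) => //.
  exact/measurable_EFinP.
by move=> x _ /=; rewrite lee_fin (le_trans (fh x))// ler_norm.
Qed.

Lemma rintegrableD f g : rintegrable f -> rintegrable g ->
  rintegrable (fun x => f x + g x).
Proof. by move=> fi gi; exact: (integrableD _ fi gi). Qed.

Lemma rintegrableZ a f : rintegrable f -> rintegrable (fun x => a * f x).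
Proof. by move=> fi; exact: (integrableZl _ a fi). Qed.

Lemma rintegrable_norm f : rintegrable f -> rintegrable (fun x => `|f x|).
Proof. exact: integrable_norm. Qed.

Lemma EFin_Rintegral f : rintegrable f ->
  (\int[mu]_x f x)%:E = (\int[mu]_x (f x)%:E)%E.
Proof. by move=> fi; rewrite fineK//; exact: integrable_fin_num. Qed.

Lemma Rintegral_le f h : rintegrable h -> measurable_fun setT f ->
  (forall x, `|f x| <= h x) -> `|\int[mu]_x f x| <= \int[mu]_x h x.
Proof.
move=> ih mf fh; have fi := rintegrable_le mf ih fh.
apply: (le_trans (le_normr_Rintegral _ fi)) => //.
by apply: le_Rintegral => //; exact: rintegrable_norm.
Qed.

(** Both sides are measures, determined by their values on intervals, where the
    identity is a computation of lengths. *)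
Lemma lebesgue_measure_affine (a b : R) (A : set R) : 0 < a -> measurable A ->
  mu A = (a%:E * pushforward mu (fun x : measurableTypeR R =>
    ((a * x + b)%R : measurableTypeR R)) A)%E.
Proof.
move=> a0 mA.
have mphi : measurable_fun [set: measurableTypeR R]
    (fun x : measurableTypeR R => (a * x + b : measurableTypeR R)).
  apply: (@measurable_funD _ _ _ setT (fun x => a * x) (cst b)) => //.
  by apply: measurable_funM.
pose phi : {mfun measurableTypeR R >-> measurableTypeR R} :=
  HB.pack (fun x : measurableTypeR R => (a * x + b : measurableTypeR R))
   (isMeasurableFun.Build _ _ _ _ _ mphi).
pose k := NngNum (ltW a0).
have := @lebesgue_measure_unique R (mscale k (pushforward mu phi)).
move=> -> //.
move=> _ [[u v]] _ <-.
change (mu [set` `]u, v]] = (a%:E * mu ((fun x : R => (a * x + b)%R) @^-1` [set` `]u, v]]))%E).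
rewrite (_ : (fun x : R => a * x + b) @^-1` _ =
    [set` `](u - b) / a, (v - b) / a]]); last first.
  apply/seteqP; split => x /=; rewrite !in_itv /= ltr_pdivrMr// ler_pdivlMr//;
    by rewrite (mulrC x) ltrBlDr lerBrDr.
rewrite !lebesgue_measure_itv /= !lte_fin ltr_pM2r ?invr_gt0// ltrD2r.
case: ifPn => uv; last by rewrite mule0.
rewrite -EFinD -EFinM; congr EFin.
by field; rewrite gt_eqF.
Qed.

End RealIntegral.

Section ChangeOfVariables.
Context {R : realType}.
Notation mu := (@lebesgue_measure R).
Implicit Types f g h : R -> R.

Section transport.
Variables (phi : measurableTypeR R -> measurableTypeR R) (c : R).
Hypotheses (mphi : measurable_fun setT phi) (c0 : 0 < c).
Hypothesis muphi : forall A : set (measurableTypeR R), measurable A ->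
  mu A = (c%:E * pushforward mu phi A)%E.

Let phi' : {mfun measurableTypeR R >-> measurableTypeR R} :=
  HB.pack phi (isMeasurableFun.Build _ _ _ _ _ mphi).

(** One argument serves the maps x |-> a x + b and x |-> - x: all that matters is
    that phi pushes Lebesgue measure to a multiple of itself. *)
Lemma ge0_integral_transport (f : R -> \bar R) :
  measurable_fun setT f -> (forall x, (0 <= f x)%E) ->
  (\int[mu]_x f x = c%:E * \int[mu]_x f (phi x))%E.
Proof.
move=> mf f0.
pose k := NngNum (ltW c0).
pose nu : {measure set (measurableTypeR R) -> \bar R} := mscale k (pushforward mu phi').
transitivity (\int[nu mphi]_x f x)%E.
  by apply: eq_measure_integral => A mA _; exact: muphi.
rewrite ge0_integral_mscale//; congr (_ * _)%E.
by rewrite ge0_integral_pushforward.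
Qed.

Lemma rintegrable_transport f : rintegrable f ->
  rintegrable (f \o phi) /\ \int[mu]_x f (phi x) = c^-1 * \int[mu]_x f x.
Proof.
move=> fi; have mf := rintegrable_meas fi.
have cinv : c^-1 \is a GRing.unit by rewrite unitfE invr_neq0// gt_eqF.
have mfphi : measurable_fun setT (f \o phi) by exact: measurableT_comp.
have ifphi : rintegrable (f \o phi).
  apply/integrableP; split; first exact/measurable_EFinP.
  have /integrableP[_] := fi.
  rewrite (ge0_integral_transport (f := fun x => `|(f x)%:E|%E))//; last first.
    by apply/measurable_EFinP; exact: measurableT_comp.
  move=> h; rewrite ltey; apply/eqP => e; move: h.
  by rewrite (_ : (\int[mu]_x _ = +oo)%E)// mulry gtr0_sg// mul1e ltxx.
split => //.
have fpos x : (0 <= (EFin \o f)^\+ x)%E by exact: funepos_ge0.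
have fneg x : (0 <= (EFin \o f)^\- x)%E by exact: funeneg_ge0.
have mEf : measurable_fun setT (EFin \o f) by exact/measurable_EFinP.
have := ge0_integral_transport (measurable_funepos mEf) fpos.
have := ge0_integral_transport (measurable_funeneg mEf) fneg.
move=> En Ep.
apply: (@mulfI _ c); first by rewrite gt_eqF.
rewrite mulrA divff ?gt_eqF// mul1r.
apply: EFin_inj; rewrite EFinM !EFin_Rintegral//.
rewrite [in RHS]integralE Ep En [in LHS]integralE muleBr//; last first.
  have /integrable_pos_fin_num h1 := ifphi.
  have /integrable_neg_fin_num h2 := ifphi.
  by rewrite fin_num_adde_defl// fin_numN; exact: h2.
by congr (_ * _ - _ * _)%E; apply: eq_integral => x _; rewrite ?funeposE ?funenegE.
Qed.

End transport.

Lemma rintegrable_affine a b f : 0 < a -> rintegrable f ->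
  rintegrable (fun x => f (a * x + b)) /\
  \int[mu]_x f (a * x + b) = a^-1 * \int[mu]_x f x.
Proof.
move=> a0; apply: (@rintegrable_transport (fun x => a * x + b)) => //.
  apply: (@measurable_funD _ _ _ setT (fun x => a * x) (cst b)) => //.
  by apply: measurable_funM.
by move=> A mA; rewrite (lebesgue_measure_affine b a0 mA).
Qed.

Lemma rintegrable_opp f : rintegrable f ->
  rintegrable (fun x => f (- x)) /\
  \int[mu]_x f (- x) = \int[mu]_x f x.
Proof.
move=> fi.
have := @rintegrable_transport (fun x => - x) 1 _ ltr01 _ f fi.
rewrite invr1 mul1r; apply.
  by apply: continuous_measurable_fun; exact: opp_continuous.
by move=> A mA; rewrite mul1e; exact/esym/lebesgue_measureN.
Qed.

(** Integrability on the plane is only needed through iterated integrals of a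
    majorant h in one order, the form in which it is available below. *)
Lemma Rintegral_fubini (f : R * R -> R) (h : R -> R -> R) (A : R -> R) :
  measurable_fun setT f -> (forall x, rintegrable (h x)) -> rintegrable A ->
  (forall x, \int[mu]_y h x y <= A x) -> (forall x y, `|f (x, y)| <= h x y) ->
  \int[mu]_x \int[mu]_y f (x, y) = \int[mu]_y \int[mu]_x f (x, y).
Proof.
move=> mf ih iA hA fh.
have mf1 x : measurable_fun setT (fun y => f (x, y)).
  exact: measurableT_comp.
have if1 x : rintegrable (fun y => f (x, y)).
  exact: (rintegrable_le (mf1 x) (ih x)).
have mEf : measurable_fun setT (EFin \o f) by exact/measurable_EFinP.
have if2 : (mu \x mu)%E.-integrable setT (EFin \o f).
  apply/integrable12ltyP => //.
  have /integrableP[_] := iA; apply: le_lt_trans.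
  apply: ge0_le_integral => //.
  - by move=> x _; apply: integral_ge0.
  - have mabs : measurable_fun setT (abse \o (EFin \o f)).
      exact: measurableT_comp.
    have p0 (z : measurableTypeR R * measurableTypeR R) :
      (0 <= (abse \o (EFin \o f)) z)%E by exact: abse_ge0.
    exact: (@measurable_fun_fubini_tonelli_F _ _ (measurableTypeR R)
      (measurableTypeR R) R mu (abse \o (EFin \o f)) mabs p0).
  - apply: measurableT_comp => //; exact: (measurable_int mu).
  move=> x _ /=; apply: (@le_trans _ _ (\int[mu]_y h x y)%:E).
    rewrite EFin_Rintegral//; apply: ge0_le_integral => //.
    + by apply/measurable_EFinP; apply: (measurableT_comp _ (mf1 x)).
    + exact: (measurable_int mu (ih x)).
    + by move=> y _; rewrite lee_fin.
  by rewrite lee_fin (le_trans (hA x))// ler_norm.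
congr fine.
transitivity (\int[mu]_x \int[mu]_y (f (x, y))%:E)%E.
  by apply: eq_integral => x _; rewrite EFin_Rintegral.
rewrite (Fubini if2); apply: ae_eq_integral => //.
- exact: (measurable_fubini_G if2).
- apply/measurable_EFinP; apply: measurableT_comp => //.
  exact: (measurable_fubini_G if2).
have := ae_integrable2 if2; apply: filterS => y ify _.
by rewrite EFin_Rintegral.
Qed.

End ChangeOfVariables.

(** * Complex-valued integrals *)

Section ComplexIntegral.
Context {R : realType}.
Notation mu := (@lebesgue_measure R).
Implicit Types f g : R -> R[i].

Definition cintegrable f := rintegrable (re_fun f) /\ rintegrable (im_fun f).
Definition cint f : R[i] := cintegral [set: R] f.

Lemma Re_cint f : complex.Re (cint f) = \int[mu]_x complex.Re (f x).
Proof. by []. Qed.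

Lemma Im_cint f : complex.Im (cint f) = \int[mu]_x complex.Im (f x).
Proof. by []. Qed.

Lemma eq_cint f g : f =1 g -> cint f = cint g.
Proof. by move=> /funext ->. Qed.

Lemma cintegrable_cmeas f : cintegrable f -> cmeas f.
Proof. by move=> [/rintegrable_meas ? /rintegrable_meas ?]. Qed.

Lemma cintegrable_le f (h : R -> R) : cmeas f -> rintegrable h ->
  (forall x, normc (f x) <= h x) -> cintegrable f.
Proof.
move=> [fr fi] ih fh; split; apply: (rintegrable_le _ ih) => // x.
  exact: le_trans (normr_Re_le _) (fh x).
exact: le_trans (normr_Im_le _) (fh x).
Qed.

Lemma measurable_normc f : cmeas f -> measurable_fun setT (fun x => normc (f x)).
Proof.
move=> [fr fi].
have -> : (fun x => normc (f x)) =
    (fun x => Num.sqrt (complex.Re (f x) ^+ 2 + complex.Im (f x) ^+ 2)).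
  by apply/funext => x; case: (f x).
apply: (@measurableT_comp _ _ _ _ _ _ (@Num.sqrt R)) => //.
  apply: continuous_measurable_fun; exact: sqrt_continuous.
by apply: measurable_funD; exact: measurable_funX.
Qed.

Lemma cintegrable_normc f : cintegrable f -> rintegrable (fun x => normc (f x)).
Proof.
move=> fi; have [ir ii] := fi.
apply: (rintegrable_le _ (rintegrableD (rintegrable_norm ir) (rintegrable_norm ii))).
  by apply: measurable_normc; exact: cintegrable_cmeas.
by move=> x; rewrite ger0_norm ?normc_ge0//; exact: normc_le.
Qed.

Lemma cintegrableD f g : cintegrable f -> cintegrable g ->
  cintegrable (fun x => f x + g x).
Proof.
move=> [fr fi] [gr gi]; split; rewrite /re_fun /im_fun.
  by under eq_fun do rewrite Re_add; exact: rintegrableD.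
by under eq_fun do rewrite Im_add; exact: rintegrableD.
Qed.

Lemma cintegrableZ c f : cintegrable f -> cintegrable (fun x => c * f x).
Proof.
move=> [fr fi]; split; rewrite /re_fun /im_fun.
  under eq_fun do rewrite Re_mul -mulNr.
  by apply: rintegrableD; exact: rintegrableZ.
under eq_fun do rewrite Im_mul.
by apply: rintegrableD; exact: rintegrableZ.
Qed.

Lemma cintD f g : cintegrable f -> cintegrable g ->
  cint (fun x => f x + g x) = cint f + cint g.
Proof.
move=> [fr fi] [gr gi]; apply: complex_ext; rewrite ?Re_add ?Im_add.
  rewrite !Re_cint; under eq_Rintegral do rewrite Re_add.
  exact: RintegralD.
rewrite !Im_cint; under eq_Rintegral do rewrite Im_add.
exact: RintegralD.
Qed.

Lemma cintZ c f : cintegrable f -> cint (fun x => c * f x) = c * cint f.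
Proof.
move=> [fr fi]; apply: complex_ext.
  rewrite Re_mul !Re_cint Im_cint; under eq_Rintegral do rewrite Re_mul.
  by rewrite RintegralB// ?RintegralZl//; exact: rintegrableZ.
rewrite Im_mul !Im_cint Re_cint; under eq_Rintegral do rewrite Im_mul.
by rewrite RintegralD// ?RintegralZl//; exact: rintegrableZ.
Qed.

Lemma cintB f g : cintegrable f -> cintegrable g ->
  cint (fun x => f x - g x) = cint f - cint g.
Proof.
move=> fi gi.
have -> : (fun x => f x - g x) = (fun x => f x + (-1) * g x).
  by apply/funext => x; rewrite mulN1r.
by rewrite cintD ?cintZ ?mulN1r//; exact: cintegrableZ.
Qed.

(** The constant 2 comes from bounding the real and the imaginary part
    separately. *)
Lemma normc_cint_le f (h : R -> R) : cmeas f -> rintegrable h ->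
  (forall x, normc (f x) <= h x) -> normc (cint f) <= 2 * \int[mu]_x h x.
Proof.
move=> [mr mi] ih fh; apply: (le_trans (normc_le _)).
rewrite mulr_natl mulr2n Re_cint Im_cint; apply: lerD;
  apply: Rintegral_le => // x; apply: le_trans (fh x).
  exact: normr_Re_le.
exact: normr_Im_le.
Qed.

Lemma cint_affine a b f : 0 < a -> cintegrable f ->
  cint (fun x => f (a * x + b)) = (a^-1)%:C * cint f.
Proof.
move=> a0 [fr fi]; apply: complex_ext.
  rewrite Re_mul/= mul0r subr0 /re_fun.
  by have [_ ->] := rintegrable_affine b a0 fr.
rewrite Im_mul/= mul0r addr0 /im_fun.
by have [_ ->] := rintegrable_affine b a0 fi.
Qed.

Lemma cint_shift b f : cintegrable f -> cint (fun x => f (x + b)) = cint f.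
Proof.
move=> fi; have := cint_affine b ltr01 fi; rewrite invr1 mul1r => <-.
by apply: eq_cint => x; rewrite mul1r.
Qed.

Lemma cintegrable_affine a b f : 0 < a -> cintegrable f ->
  cintegrable (fun x => f (a * x + b)).
Proof.
by move=> a0 [fr fi]; split;
  [have [] := rintegrable_affine b a0 fr|have [] := rintegrable_affine b a0 fi].
Qed.

Lemma cint_fubini (f : R * R -> R[i]) (h : R -> R -> R) (A : R -> R) :
  cmeas f -> (forall x, rintegrable (h x)) -> rintegrable A ->
  (forall x, \int[mu]_y h x y <= A x) ->
  (forall x y, normc (f (x, y)) <= h x y) ->
  cint (fun x => cint (fun y => f (x, y))) =
  cint (fun y => cint (fun x => f (x, y))).
Proof.
move=> [mr mi] ih iA hA fh; apply: complex_ext.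
  apply: (Rintegral_fubini mr ih iA hA) => x y.
  exact: le_trans (normr_Re_le _) (fh x y).
apply: (Rintegral_fubini mi ih iA hA) => x y.
exact: le_trans (normr_Im_le _) (fh x y).
Qed.

(** Dominated convergence; a majorant is required only for parameters close to a,
    because the averages below have a uniform majorant only for small widths. *)
Lemma cint_continuous_at (F : R -> R -> R[i]) (h : R -> R) (a : R) :
  (forall l, cmeas (F l)) -> (forall x, ccontinuous (F ^~ x)) ->
  rintegrable h -> (forall l x, `|l - a| < 1 -> normc (F l x) <= h x) ->
  {for a, continuous (re_fun (fun l => cint (F l)))} /\
  {for a, continuous (im_fun (fun l => cint (F l)))}.
Proof.
move=> mF cF ih Fh.
have Ia l : `]a - 1, a + 1[%classic l -> `|l - a| < 1.
  by rewrite /= in_itv/= => /andP[h1 h2]; rewrite ltr_norml; lra.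
have aI : a \in `]a - 1, a + 1[%classic.
  by rewrite inE/= in_itv/=; lra.
split.
  have := @continuity_under_integral R _ _ mu (fun l x => complex.Re (F l x))
    setT measurableT (a - 1) (a + 1).
  apply => //; last 2 first.
  - exact: ih.
  - move=> l /Ia la; apply: nearW => x _.
    exact: le_trans (normr_Re_le _) (Fh _ _ la).
  - move=> l /Ia la; have [] := @cintegrable_le (F l) h (mF l) ih _ => //.
    by move=> x; exact: Fh.
  by apply: nearW => x _ l _; exact: (cF x).1.
have := @continuity_under_integral R _ _ mu (fun l x => complex.Im (F l x))
  setT measurableT (a - 1) (a + 1).
apply => //; last 2 first.
- exact: ih.
- move=> l /Ia la; apply: nearW => x _.
  exact: le_trans (normr_Im_le _) (Fh _ _ la).
- move=> l /Ia la; have [] := @cintegrable_le (F l) h (mF l) ih _ => //.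
  by move=> x; exact: Fh.
by apply: nearW => x _ l _; exact: (cF x).2.
Qed.

Lemma cint_continuous (F : R -> R -> R[i]) (h : R -> R) :
  (forall l, cmeas (F l)) -> (forall x, ccontinuous (F ^~ x)) ->
  rintegrable h -> (forall l x, normc (F l x) <= h x) ->
  ccontinuous (fun l => cint (F l)).
Proof.
by move=> mF cF ih Fh; split => a;
  have [] := cint_continuous_at (a := a) mF cF ih (fun l x _ => Fh l x).
Qed.

End ComplexIntegral.

(** * Smooth and Schwartz functions on the line *)

Section Smooth.
Context {R : realType}.
Implicit Types (f g a : R -> R) (x : R).

Definition rsmooth f := forall n x, derivable (f^`(n))%classic x 1.

Lemma near_eq_derive1n f g x n : (\forall y \near x, f y = g y) ->
  \forall y \near x, (f^`(n))%classic y = (g^`(n))%classic y.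
Proof.
move=> fg; elim: n => [//|n IH]; rewrite !derive1nS.
have /near_join IH' := IH.
near=> y; rewrite !derive1E; apply: near_eq_derive; near: y; exact: IH'.
Unshelve. all: by end_near. Qed.

(** The trapezoidal test functions below are smooth for this reason: they are
    glued from smooth pieces that agree where they overlap. *)
Lemma rsmooth_local f :
  (forall x, exists2 g, rsmooth g & \forall y \near x, f y = g y) -> rsmooth f.
Proof.
move=> loc n x; have [g sg fg] := loc x.
apply: (near_eq_derivable _ (sg n x)).
by apply: filterS (near_eq_derive1n n fg) => y ->.
Qed.

Lemma rsmooth_is_derive f n x : rsmooth f ->
  is_derive x 1 (f^`(n))%classic ((f^`(n.+1))%classic x).
Proof.
by move=> sf; apply: DeriveDef; [exact: sf|rewrite derive1nS derive1E].
Qed.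

Lemma is_derive_continuous f x df : is_derive x 1 f df ->
  {for x, continuous f}.
Proof.
move=> fx; apply/differentiable_continuous/derivable1_diffP.
exact: ex_derive.
Qed.

Lemma rsmooth_continuous f n : rsmooth f -> continuous (f^`(n))%classic.
Proof. by move=> sf x; exact: is_derive_continuous (rsmooth_is_derive n x sf). Qed.

Lemma derive1n_cst (c : R) n : ((cst c)^`(n.+1))%classic = cst (0 : R).
Proof.
elim: n => [|n IH]; first by apply/funext => x; rewrite derive1nS /= derive1_cst.
by rewrite derive1nS IH; apply/funext => x; rewrite derive1_cst.
Qed.

Lemma rsmooth_cst (c : R) : rsmooth (cst c).
Proof. by move=> [|n] x; rewrite ?derive1n_cst; exact: derivable_cst. Qed.

Lemma is_derive_affine (u b x : R) : is_derive x 1 (fun y : R => u * y + b) u.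
Proof.
have h1 : is_derive x 1 (u *: (id : R -> R)) (u *: 1) by exact: is_deriveZ.
have h2 : is_derive x 1 ((u *: (id : R -> R)) + cst b) (u *: 1 + 0).
  exact: is_deriveD.
by apply: (is_derive_eq h2); rewrite addr0 /GRing.scale/= mulr1.
Qed.

Lemma is_derive_comp_affine f (u b x df : R) : is_derive (u * x + b) 1 f df ->
  is_derive x 1 (fun y : R => f (u * y + b)) (u * df).
Proof.
move=> hf.
have h := @is_derive1_comp R f (fun y => u * y + b) x _ _ hf (is_derive_affine u b x).
by apply: (is_derive_eq h); rewrite mulrC.
Qed.

Lemma is_derive_derive1n_affine f (u b x : R) n : rsmooth f ->
  is_derive x 1 (fun x => u ^+ n * (f^`(n))%classic (u * x + b))
   (u ^+ n.+1 * (f^`(n.+1))%classic (u * x + b)).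
Proof.
move=> sf.
have h2 := is_derive_comp_affine (rsmooth_is_derive n (u * x + b) sf).
have h3 := @is_deriveZ R R R _ (u ^+ n) x 1 _ h2.
by apply: (is_derive_eq h3); rewrite /GRing.scale/= exprSr mulrA.
Qed.

Lemma derive1n_affine f (u b : R) n : rsmooth f ->
  ((fun x => f (u * x + b))^`(n))%classic =
  (fun x => u ^+ n * (f^`(n))%classic (u * x + b)).
Proof.
move=> sf; elim: n => [|n IH]; first by apply/funext => x; rewrite expr0 mul1r.
apply/funext => x; rewrite derive1nS IH derive1E.
exact: (@derive_val _ _ _ _ _ _ _ (is_derive_derive1n_affine u b x n sf)).
Qed.

Lemma rsmooth_affine f (u b : R) : rsmooth f -> rsmooth (fun x => f (u * x + b)).
Proof.
move=> sf n x; rewrite derive1n_affine//.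
exact: (@ex_derive _ _ _ _ _ _ _ (is_derive_derive1n_affine u b x n sf)).
Qed.

Definition rschwartz a := rsmooth a /\
  forall m n : nat, exists M : R, forall x, `|x| ^+ m * `|(a^`(n))%classic x| <= M.

Lemma schwartz_re (phi : R -> R[i]) : schwartz phi -> rschwartz (re_fun phi).
Proof.
move=> [sphi dphi]; split; first by move=> n x; have [] := sphi n x.
move=> m n; have [M hM] := dphi m n; exists M => x; apply: le_trans (hM x).
by apply: ler_wpM2l => //; exact: (normr_Re_le (cderiv n phi x)).
Qed.

Lemma schwartz_im (phi : R -> R[i]) : schwartz phi -> rschwartz (im_fun phi).
Proof.
move=> [sphi dphi]; split; first by move=> n x; have [] := sphi n x.
move=> m n; have [M hM] := dphi m n; exists M => x; apply: le_trans (hM x).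
by apply: ler_wpM2l => //; exact: (normr_Im_le (cderiv n phi x)).
Qed.

Lemma schwartz_re_im (phi : R -> R[i]) : rschwartz (re_fun phi) ->
  rschwartz (im_fun phi) -> schwartz phi.
Proof.
move=> [sr dr] [si di]; split; first by move=> n x.
move=> m n; have [M hM] := dr m n; have [N hN] := di m n.
exists (M + N) => x; apply: le_trans (lerD (hM x) (hN x)).
by rewrite -mulrDr ler_wpM2l//; exact: (normc_le (cderiv n phi x)).
Qed.

(** An integrable weight, with which all integrability at infinity is obtained:
    a function bounded together with its product by x^2 is at most a multiple of
    it. *)
Definition decay (x : R) : R := (oneDsqr x)^-1.

Lemma decay_gt0 x : 0 < decay x.
Proof. by rewrite invr_gt0 (lt_le_trans ltr01)// oneDsqr_ge1. Qed.

Lemma decay_ge0 x : 0 <= decay x. Proof. exact/ltW/decay_gt0. Qed.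

Lemma rintegrable_decay : rintegrable decay.
Proof.
have cd : continuous decay by exact: continuous_oneDsqrV.
apply/integrableP; split; first by apply/measurable_EFinP; exact: continuous_measurable_fun.
under eq_integral do rewrite /= ger0_norm ?decay_ge0//.
rewrite ge0_symfun_integralT//.
- rewrite -set_itvcy integral0y_oneDsqr -EFinM; exact: ltry.
- exact: decay_ge0.
- by move=> x /=; rewrite /decay /oneDsqr sqrrN.
Qed.

Lemma le_decay (x y M0 M2 : R) : y <= M0 -> `|x| ^+ 2 * y <= M2 ->
  y <= (M0 + M2) * decay x.
Proof.
rewrite real_normK ?num_real// => h0 h2.
rewrite ler_pdivlMr; last by rewrite (lt_le_trans ltr01)// oneDsqr_ge1.
by rewrite /oneDsqr mulrDr mulr1 lerD// mulrC.
Qed.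

Lemma rschwartz_decay a n : rschwartz a ->
  exists2 M, 0 <= M & forall x, `|(a^`(n))%classic x| <= M * decay x.
Proof.
move=> [sa da]; have [M0 h0] := da 0%N n; have [M2 h2] := da 2%N n.
exists (M0 + M2).
  rewrite addr_ge0//; first by apply: le_trans (h0 0); rewrite mulr_ge0.
  by apply: le_trans (h2 0); rewrite mulr_ge0.
by move=> x; apply: le_decay => //; have := h0 x; rewrite expr0 mul1r.
Qed.

Lemma rschwartz_integrable a n : rschwartz a -> rintegrable (a^`(n))%classic.
Proof.
move=> sa; have [M M0 hM] := rschwartz_decay n sa.
apply: (rintegrable_le _ (rintegrableZ M rintegrable_decay)) => //.
apply: continuous_measurable_fun; exact: (rsmooth_continuous (sa.1)).
Qed.

End Smooth.

(** * Integration by parts and decay of Fourier integrals *)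

Section IntegralOfDerivative.
Context {R : realType}.
Notation mu := (@lebesgue_measure R).

Lemma cvg_decay_nat : (@decay R n%:R) @[n --> \oo] --> (0 : R).
Proof.
apply/cvgrPdist_le => e e0; near=> n.
rewrite sub0r normrN ger0_norm ?decay_ge0//.
have n0 : 0 < n%:R :> R by rewrite ltr0n; near: n; exact: nbhs_infty_gt.
apply: (@le_trans _ _ n%:R^-1).
  rewrite lef_pV2 ?posrE// ?(lt_le_trans ltr01 (oneDsqr_ge1 _))//.
  rewrite /oneDsqr; have : 0 <= (n%:R - 1 / 2 : R) ^+ 2 by exact: sqr_ge0.
  rewrite sqrrB; nra.
rewrite invf_ple ?posrE//.
near: n; exact: nbhs_infty_ger.
Unshelve. all: by end_near. Qed.

(** By the fundamental theorem of calculus on [-n, n] and dominated convergence.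
    Applied to products, this is integration by parts on the whole line. *)
Lemma Rintegral_derive_eq0 (h h' : R -> R) (M : R) :
  (forall x : R, is_derive x 1 h (h' x)) -> continuous h' -> rintegrable h' ->
  (forall x, `|h x| <= M * decay x) -> \int[mu]_x h' x = 0.
Proof.
move=> dh ch' ih' hM.
have ch : continuous h by move=> x; exact: is_derive_continuous (dh x).
pose f_ n x := ((h' \_ `[- n%:R, n%:R]) x)%:E.
have mh' : measurable_fun setT h' by exact: rintegrable_meas.
have fE n : (0 < n)%N -> (\int[mu]_x f_ n x = (h n%:R - h (- n%:R))%:E)%E.
  move=> n0; rewrite /f_.
  rewrite (_ : (fun x => _) = (EFin \o h') \_ `[- n%:R, n%:R]); last first.
    by rewrite restrict_EFin.
  rewrite -integral_mkcond (@continuous_FTC2 _ h' h)//.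
  - by rewrite gtrN// ltr0n.
  - exact: continuous_subspaceT.
  - split.
    + by move=> x _; exact: (@ex_derive _ _ _ _ _ _ _ (dh x)).
    + exact/cvg_at_right_filter/ch.
    + exact/cvg_at_left_filter/ch.
  - by move=> x _; rewrite derive1E (@derive_val _ _ _ _ _ _ _ (dh x)).
have [] := @dominated_convergence _ _ R mu setT measurableT f_ (EFin \o h')
  (fun x => `|h' x|%:E).
- move=> n; apply/measurable_EFinP.
  by apply/(measurable_restrictT _ _).1 => //; exact: measurable_funTS.
- exact/measurable_EFinP.
- apply: nearW => x _; rewrite /f_; apply: cvg_near_cst; near=> n.
  rewrite patchE ifT// inE /= in_itv/= -ler_norml.
  near: n; exact: nbhs_infty_ger.
- exact: rintegrable_norm.
- apply: nearW => x n _; rewrite /f_ /= lee_fin patchE; case: ifP => // _.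
  by rewrite normr0.
move=> _ _ lim1.
have lim2 : (fun n => \int[mu]_x f_ n x)%E @ \oo --> 0%E.
  apply: (@cvg_trans _ ((h n%:R - h (- n%:R))%:E @[n --> \oo])).
    apply: near_eq_cvg; near=> n; rewrite fE//; near: n; exact: nbhs_infty_gt.
  apply: cvg_EFin; first by near=> n.
  apply/cvgrPdist_le => e e0.
  have L : (fun n => 2 * M * decay n%:R) @ \oo --> 2 * M * (0 : R).
    by apply: cvgM; [exact: cvg_cst|exact: cvg_decay_nat].
  move: L; rewrite mulr0 => /cvgrPdist_le /(_ _ e0); apply: filterS => n.
  rewrite !sub0r !normrN /= => hn.
  apply: le_trans hn; apply: le_trans (ler_norm _).
  apply: (le_trans (ler_normB _ _)); have := lerD (hM n%:R) (hM (- n%:R)).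
  have -> : decay (- n%:R) = decay n%:R :> R by rewrite /decay /oneDsqr sqrrN.
  by move=> /le_trans; apply; set d := decay _; lra.
by rewrite /Rintegral (cvg_unique _ lim1 lim2).
Unshelve. all: by end_near. Qed.

End IntegralOfDerivative.

Section FourierDecay.
Context {R : realType}.
Notation mu := (@lebesgue_measure R).
Implicit Types a : R -> R.

Lemma is_derive_scaled (u : R -> R) (c x du : R) : is_derive (c * x) 1 u du ->
  is_derive x 1 (fun y : R => u (c * y)) (c * du).
Proof.
move=> hu; have := @is_derive_comp_affine R u c 0 x du; rewrite addr0 => /(_ hu).
by under [X in is_derive _ _ X _ -> _]eq_fun do rewrite addr0.
Qed.

(** Integration by parts against an oscillating factor; it is used with (u, v)
    equal to (sin, cos) and (- cos, sin). *)
Lemma rschwartz_parts a (u v : R -> R) (c : R) n : rschwartz a ->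
  (forall x : R, is_derive x 1 u (v x)) -> continuous v ->
  (forall x, `|u x| <= 1) -> (forall x, `|v x| <= 1) ->
  c * \int[mu]_x ((a^`(n))%classic x * v (c * x)) =
  - \int[mu]_x ((a^`(n.+1))%classic x * u (c * x)).
Proof.
move=> sa du cv u1 v1.
have cu : continuous u by move=> x; exact: is_derive_continuous (du x).
have cc : continuous (fun x : R => c * x).
  by move=> x; apply: cvgM; [exact: cvg_cst|exact: cvg_id].
have mk (w : R -> R) m : continuous w -> (forall x, `|w x| <= 1) ->
    rintegrable (fun x => (a^`(m))%classic x * w (c * x)).
  move=> cw w1; apply: (rintegrable_le _ (rintegrable_norm (rschwartz_integrable m sa))).
    apply: continuous_measurable_fun => x; apply: cvgM.
      exact: (rsmooth_continuous sa.1).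
    by apply: continuous_comp; [exact: cc|exact: cw].
  by move=> x; rewrite normrM ler_piMr.
have [M M0 hM] := rschwartz_decay n sa.
have := @Rintegral_derive_eq0 R (fun x => (a^`(n))%classic x * u (c * x))
  (fun x => (a^`(n.+1))%classic x * u (c * x) + c * ((a^`(n))%classic x * v (c * x))) M.
rewrite RintegralD//; last by exact/rintegrableZ/mk.
  rewrite RintegralZl//; last exact: mk.
  move=> H; apply/eqP; rewrite -subr_eq0 opprK addrC; apply/eqP; apply: H.
  - move=> x; have h1 := rsmooth_is_derive n x sa.1.
    have h2 := is_derive_scaled (du (c * x)).
    apply: (is_derive_eq (is_deriveM h1 h2)).
    by rewrite /GRing.scale/=; ring.
  - move=> x; apply: cvgD; first apply: cvgM.
    + exact: (rsmooth_continuous sa.1).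
    + by apply: continuous_comp; [exact: cc|exact: cu].
    apply: cvgM; first exact: cvg_cst.
    apply: cvgM; first exact: (rsmooth_continuous sa.1).
    by apply: continuous_comp; [exact: cc|exact: cv].
  - by apply: rintegrableD; [exact: mk|apply: rintegrableZ; exact: mk].
  - by move=> x; rewrite normrM; apply: le_trans (hM x); rewrite ler_piMr.
exact: mk.
Qed.

Lemma is_derive_Ncos (x : R) : is_derive x 1 (fun y => - cos y) (sin x).
Proof. by apply: (is_derive_eq (is_deriveN (is_derive_cos x))); rewrite opprK. Qed.

Lemma normr_cos (x : R) : `|cos x| <= 1.
Proof. by rewrite ler_norml cos_geN1 cos_le1. Qed.

Lemma normr_sin (x : R) : `|sin x| <= 1.
Proof. by rewrite ler_norml sin_geN1 sin_le1. Qed.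

(** Two integrations by parts gain the factor c^-2, which makes the Fourier
    transform integrable. *)
Lemma rschwartz_trig_decay a : rschwartz a -> exists2 M, 0 <= M & forall c,
  `|\int[mu]_x (a x * cos (c * x))| <= M * decay c /\
  `|\int[mu]_x (a x * sin (c * x))| <= M * decay c.
Proof.
move=> sa.
pose I n := \int[mu]_x `|(a^`(n))%classic x|.
have B n (w : R -> R) c : continuous w -> (forall x, `|w x| <= 1) ->
    `|\int[mu]_x ((a^`(n))%classic x * w (c * x))| <= I n.
  move=> cw w1; apply: Rintegral_le.
  - exact/rintegrable_norm/rschwartz_integrable.
  - apply: continuous_measurable_fun => x; apply: cvgM.
      exact: (rsmooth_continuous sa.1).
    apply: continuous_comp; last exact: cw.
    by apply: cvgM; [exact: cvg_cst|exact: cvg_id].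
  - by move=> x; rewrite normrM ler_piMr.
have cs := @continuous_sin R; have cc := @continuous_cos R.
have PC n c : c * \int[mu]_x ((a^`(n))%classic x * cos (c * x)) =
    - \int[mu]_x ((a^`(n.+1))%classic x * sin (c * x)).
  by apply: rschwartz_parts => //; [exact: normr_sin|exact: normr_cos].
have PS n c : c * \int[mu]_x ((a^`(n))%classic x * sin (c * x)) =
    \int[mu]_x ((a^`(n.+1))%classic x * cos (c * x)).
  have := @rschwartz_parts a (fun y => - cos y) sin c n sa is_derive_Ncos cs.
  move=> -> //; last 2 first.
  - by move=> x; rewrite normrN; exact: normr_cos.
  - exact: normr_sin.
  under eq_Rintegral do rewrite mulrN -mulN1r.
  rewrite RintegralZl//; first by rewrite mulN1r opprK.
  apply: (rintegrable_le _ (rintegrable_norm (rschwartz_integrable n.+1 sa))).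
    apply: continuous_measurable_fun => x; apply: cvgM.
      exact: (rsmooth_continuous sa.1).
    apply: continuous_comp; last exact: cc.
    by apply: cvgM; [exact: cvg_cst|exact: cvg_id].
  by move=> x; rewrite normrM ler_piMr// normr_cos.
exists (I 0%N + I 2%N); first by rewrite addr_ge0//; exact: Rintegral_ge0.
move=> c; split; apply: le_decay.
- by apply: (B 0%N cos) => //; exact: normr_cos.
- rewrite real_normK ?num_real// -[c ^+ 2]ger0_norm ?sqr_ge0// -normrM expr2 -mulrA.
  rewrite (PC 0%N) mulrN normrN (PS 1%N); apply: (B 2%N cos) => //; exact: normr_cos.
- by apply: (B 0%N sin) => //; exact: normr_sin.
- rewrite real_normK ?num_real// -[c ^+ 2]ger0_norm ?sqr_ge0// -normrM expr2 -mulrA.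
  rewrite (PS 0%N) (PC 1%N) normrN; apply: (B 2%N sin) => //; exact: normr_sin.
Qed.

End FourierDecay.

(** * The Gaussian and its Fourier transform *)

Section Gaussian.
Context {R : realType}.
Notation mu := (@lebesgue_measure R).
Implicit Types x y c : R.

(** The normalisation makes the Gaussian its own Fourier transform. *)
Definition gauss x : R := expR (- (pi * x ^+ 2)).

Lemma gauss_ge0 x : 0 <= gauss x. Proof. exact: expR_ge0. Qed.

Lemma gaussN x : gauss (- x) = gauss x.
Proof. by rewrite /gauss sqrrN. Qed.

Lemma gauss0 : gauss 0 = 1.
Proof. by rewrite /gauss expr0n/= mulr0 oppr0 expR0. Qed.

Lemma gauss_le1 x : gauss x <= 1.
Proof. by rewrite /gauss -expR0 ler_expR oppr_le0 mulr_ge0 ?pi_ge0 ?sqr_ge0. Qed.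

Lemma is_derive_expR_sqr (k x : R) :
  is_derive x 1 (fun y : R => expR (k * y ^+ 2)) (2 * k * x * expR (k * x ^+ 2)).
Proof.
have h0 : is_derive x 1 ((id : R -> R) * (id : R -> R)) (x *: 1 + x *: 1).
  exact: is_deriveM.
have h1 := @is_deriveZ R R R _ k x 1 _ h0.
have h3 := @is_derive1_comp R expR _ x _ _ (is_derive_expR _) h1.
rewrite (_ : (fun y => _) = expR \o (k *: ((id : R -> R) * (id : R -> R)))).
  apply: (is_derive_eq h3); rewrite /GRing.scale /= mulr1 expr2.
  by rewrite -[(_ * _) x]/(x * x); set e := expR _; ring.
by apply/funext => y; rewrite expr2.
Qed.

Lemma is_derive_gauss x : is_derive x 1 gauss (- (2 * pi * x) * gauss x).
Proof.
have := is_derive_expR_sqr (- pi) x; rewrite /gauss.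
under eq_fun do rewrite mulNr.
by move=> h; apply: (is_derive_eq h); rewrite mulNr; set e := expR _; ring.
Qed.

Lemma continuous_gauss : continuous gauss.
Proof. by move=> x; exact: is_derive_continuous (is_derive_gauss x). Qed.

(** The term of order n of the exponential series. *)
Lemma expR_ge_pow (t : R) n : 0 <= t -> t ^+ n <= n`!%:R * expR t.
Proof.
move=> t0; case: n => [|n].
  by rewrite expr0 fact0 mul1r -expR0 ler_expR.
have := expR_ge1Dxn n t0; rewrite -lerBrDl => h.
rewrite mulrC -ler_pdivrMr ?ltr0n ?fact_gt0//.
by apply: (le_trans h); rewrite lerBlDl lerDr.
Qed.

Lemma pow_gauss_bounded N : exists2 C, 0 <= C &
  forall x, (1 + `|x|) ^+ N * gauss x <= C.
Proof.
(* From (1 + t) ^ N <= 2 ^ N * (1 + t ^ 2N) and s ^ N <= N! * e ^ s with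
   s = pi * x ^ 2. *)
exists (2 ^+ N * (1 + N`!%:R)); first by rewrite mulr_ge0 ?exprn_ge0 ?addr_ge0.
move=> x.
have h1 : (1 + `|x|) ^+ N <= 2 ^+ N * (1 + (`|x| ^+ 2) ^+ N).
  have [x1|x1] := leP `|x| 1.
    apply: (@le_trans _ _ (2 ^+ N)).
      by rewrite lerXn2r ?nnegrE ?addr_ge0//; lra.
    by rewrite ler_peMr ?exprn_ge0// lerDl !exprn_ge0.
  apply: (@le_trans _ _ ((2 * `|x| ^+ 2) ^+ N)).
    rewrite lerXn2r ?nnegrE ?addr_ge0// ?mulr_ge0 ?exprn_ge0//.
    by rewrite expr2; nra.
  by rewrite exprMn ler_wpM2l ?exprn_ge0// lerDr.
have g0 := gauss_ge0 x; have g1 := gauss_le1 x.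
apply: (le_trans (ler_wpM2r g0 h1)); rewrite -mulrA ler_wpM2l ?exprn_ge0//.
rewrite mulrDl mul1r lerD//.
have t0 : 0 <= pi * x ^+ 2 :> R by rewrite mulr_ge0 ?pi_ge0 ?sqr_ge0.
apply: (@le_trans _ _ ((pi * x ^+ 2) ^+ N * gauss x)).
  rewrite ler_wpM2r// lerXn2r ?nnegrE ?sqr_ge0//.
  rewrite real_normK ?num_real// ler_peMl ?sqr_ge0//.
  by rewrite (le_trans _ (pi_ge2 R))// ler1n.
rewrite /gauss expRN ler_pdivrMr ?expR_gt0//.
exact: expR_ge_pow.
Qed.

Lemma pow_gauss_decay N : exists2 C, 0 <= C &
  forall x, (1 + `|x|) ^+ N * gauss x <= C * decay x.
Proof.
have [C C0 hC] := pow_gauss_bounded N.+2; exists C => // x.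
rewrite ler_pdivlMr; last by rewrite (lt_le_trans ltr01)// oneDsqr_ge1.
apply: le_trans (hC x); rewrite mulrAC ler_wpM2r ?gauss_ge0//.
rewrite -addn2 exprD ler_wpM2l ?exprn_ge0 ?addr_ge0//.
rewrite /oneDsqr -(real_normK (num_real x)) sqrrD expr1n mul1r.
by rewrite lerD2r lerDl mulrn_wge0.
Qed.

Lemma rintegrable_pow_gauss N : rintegrable (fun x => (1 + `|x|) ^+ N * gauss x).
Proof.
have [C C0 hC] := pow_gauss_decay N.
apply: (rintegrable_le _ (rintegrableZ C rintegrable_decay)).
  apply: measurable_funM; last first.
    by apply: continuous_measurable_fun; exact: continuous_gauss.
  by apply: measurable_funX; apply: measurable_funD => //; exact: measurableT_comp.
by move=> x; rewrite ger0_norm// mulr_ge0 ?gauss_ge0 ?exprn_ge0 ?addr_ge0.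
Qed.

Lemma rintegrable_gauss : rintegrable gauss.
Proof.
have := rintegrable_pow_gauss 0.
by under [fun x => _]eq_fun do rewrite expr0 mul1r.
Qed.

Lemma Rintegral_gauss : \int[mu]_x gauss x = 1.
Proof.
have pi0 : 0 < Num.sqrt pi :> R by rewrite sqrtr_gt0 pi_gt0.
have [_] := rintegrable_affine 0 pi0 (@integrableT_gauss R).
have -> : \int[mu]_x gauss_fun x = Num.sqrt pi by rewrite /Rintegral integralT_gauss.
rewrite mulVf ?gt_eqF// => <-; apply: eq_Rintegral => x _.
by rewrite addr0 /gauss_fun /gauss exprMn sqr_sqrtr ?pi_ge0.
Qed.

Lemma Rintegral_gauss_sin c : \int[mu]_x (gauss x * sin (c * x)) = 0.
Proof.
have ii : rintegrable (fun x => gauss x * sin (c * x)).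
  apply: (rintegrable_le _ rintegrable_gauss).
    apply: continuous_measurable_fun => x; apply: cvgM; first exact: continuous_gauss.
    apply: continuous_comp; last exact: continuous_sin.
    by apply: cvgM; [exact: cvg_cst|exact: cvg_id].
  by move=> x; rewrite normrM ger0_norm ?gauss_ge0// ler_piMr ?gauss_ge0 ?normr_sin.
have [_] := rintegrable_opp ii.
under eq_Rintegral do rewrite gaussN mulrN sinN mulrN -mulN1r.
by rewrite RintegralZl// mulN1r => h; lra.
Qed.

(** The total derivative of gauss x * sin (c x) has integral zero. *)
Lemma gauss_cos_parts c :
  \int[mu]_x (x * gauss x * sin (c * x)) =
  c / (2 * pi) * \int[mu]_x (gauss x * cos (c * x)).
Proof.
have cl : continuous (fun x : R => c * x).
  by move=> x; apply: cvgM; [exact: cvg_cst|exact: cvg_id].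
have csin : continuous (fun x => sin (c * x)).
  by move=> x; apply: continuous_comp; [exact: cl|exact: continuous_sin].
have ccos : continuous (fun x => cos (c * x)).
  by move=> x; apply: continuous_comp; [exact: cl|exact: continuous_cos].
have cxg : continuous (fun x => x * gauss x).
  by move=> x; apply: cvgM; [exact: cvg_id|exact: continuous_gauss].
have i1 : rintegrable (fun x => x * gauss x * sin (c * x)).
  apply: (rintegrable_le _ (rintegrable_pow_gauss 1)).
    by apply: continuous_measurable_fun => x; apply: cvgM; [exact: cxg|exact: csin].
  move=> x; rewrite 2!normrM (ger0_norm (gauss_ge0 x)) expr1.
  rewrite (@le_trans _ _ (`|x| * gauss x))//.
    by rewrite ler_piMr ?normr_sin// mulr_ge0// gauss_ge0.
  by rewrite ler_wpM2r ?gauss_ge0// lerDr.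
have i2 : rintegrable (fun x => gauss x * cos (c * x)).
  apply: (rintegrable_le _ rintegrable_gauss).
    by apply: continuous_measurable_fun => x; apply: cvgM;
      [exact: continuous_gauss|exact: ccos].
  by move=> x; rewrite normrM ger0_norm ?gauss_ge0// ler_piMr ?gauss_ge0 ?normr_cos.
have [C C0 hC] := pow_gauss_decay 0.
have := @Rintegral_derive_eq0 R (fun x => gauss x * sin (c * x))
  (fun x => c * (gauss x * cos (c * x)) + - (2 * pi) * (x * gauss x * sin (c * x))) C.
rewrite RintegralD//; [|exact: rintegrableZ|exact: rintegrableZ].
rewrite !RintegralZl// => H.
have {}H : c * \int[mu]_x (gauss x * cos (c * x)) +
    - (2 * pi) * \int[mu]_x (x * gauss x * sin (c * x)) = 0.
  apply: H.
  - move=> x; have h2 := is_derive_scaled (is_derive_sin (c * x)).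
    apply: (is_derive_eq (is_deriveM (is_derive_gauss x) h2)).
    by rewrite /GRing.scale/=; ring.
  - move=> x; apply: cvgD; apply: cvgM; try exact: cvg_cst.
      by apply: cvgM; [exact: continuous_gauss|exact: ccos].
    by apply: cvgM; [exact: cxg|exact: csin].
  - by apply: rintegrableD; exact: rintegrableZ.
  - move=> x; have := hC x; rewrite expr0 mul1r; apply: le_trans.
    by rewrite normrM ger0_norm ?gauss_ge0// ler_piMr ?gauss_ge0 ?normr_sin.
have p0 : 2 * pi != 0 :> R by rewrite mulf_neq0// gt_eqF// pi_gt0.
apply: (mulfI p0); rewrite mulrA [_ * (c / _)]mulrCA mulfV// mulr1.
by move/eqP: H; rewrite mulNr subr_eq0 => /eqP ->.
Qed.

(** As a function of c, the integral satisfies the differential equation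
    G' = - c / (2 pi) * G, by differentiation under the integral sign and
    [gauss_cos_parts].  The right-hand side solves the same equation, so the
    quotient is constant. *)
Lemma Rintegral_gauss_cos c :
  \int[mu]_x (gauss x * cos (c * x)) = expR (- (c ^+ 2 / (4 * pi))).
Proof.
pose G c := \int[mu]_x (gauss x * cos (c * x)).
have dG (b : R) : is_derive b 1 G (- (b / (2 * pi)) * G b).
  pose f (l x : R) := gauss x * cos (l * x).
  have fE (l x : R) : is_derive l 1 (f ^~ x) (- (x * gauss x * sin (l * x))).
    have h : is_derive l 1 (fun l : R => cos (x * l)) (x * - sin (x * l)).
      exact: is_derive_scaled (is_derive_cos _).
    have h2 := @is_deriveZ R R R _ (gauss x) l 1 _ h.
    rewrite (_ : f ^~ x = gauss x \*: (fun l : R => cos (x * l))); last first.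
      by apply/funext => z; rewrite /f /= (mulrC z).
    by apply: (is_derive_eq h2); rewrite /GRing.scale/= (mulrC l); ring.
  have cl l : continuous (fun x : R => l * x).
    by move=> x; apply: cvgM; [exact: cvg_cst|exact: cvg_id].
  have If (l : R) : (`]b - 1, b + 1[%classic : set R) l ->
      mu.-integrable setT (EFin \o f l).
    move=> _; apply: (rintegrable_le _ rintegrable_gauss).
      apply: continuous_measurable_fun => x; apply: cvgM; first exact: continuous_gauss.
      by apply: continuous_comp; [exact: cl|exact: continuous_cos].
    by move=> x; rewrite normrM ger0_norm ?gauss_ge0// ler_piMr ?gauss_ge0 ?normr_cos.
  have bI : (`]b - 1, b + 1[%classic : set R) b by rewrite /= in_itv/=; lra.
  have der (l x : R) : (`]b - 1, b + 1[%classic : set R) l -> setT x ->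
    derivable (f ^~ x) l 1 by move=> _ _; exact: (@ex_derive _ _ _ _ _ _ _ (fE l x)).
  have g0 (x : R) : 0 <= (1 + `|x|) ^+ 1 * gauss x.
    by rewrite mulr_ge0 ?gauss_ge0 ?exprn_ge0 ?addr_ge0.
  have gub (l x : R) : (`]b - 1, b + 1[%classic : set R) l -> setT x ->
     `|partial1of2 f l x| <= (1 + `|x|) ^+ 1 * gauss x.
    move=> _ _; rewrite partial1of2E (@derive_val _ _ _ _ _ _ _ (fE l x)).
    rewrite normrN 2!normrM (ger0_norm (gauss_ge0 x)) expr1.
    rewrite (@le_trans _ _ (`|x| * gauss x))//.
      by rewrite ler_piMr ?normr_sin// mulr_ge0// gauss_ge0.
    by rewrite ler_wpM2r ?gauss_ge0// lerDr.
  have H1 := @derivable_under_integral R _ _ mu f setT measurableT b (b - 1) (b + 1)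
    bI If der _ g0 (rintegrable_pow_gauss 1) gub.
  have H2 := @differentiation_under_integral R _ _ mu f setT measurableT b (b - 1) (b + 1)
    bI If der _ g0 (rintegrable_pow_gauss 1) gub.
  apply: DeriveDef; first exact: H1.
  rewrite -derive1E [LHS]H2.
  rewrite mulNr /G -gauss_cos_parts.
  transitivity (\int[mu]_x (-1 * (x * gauss x * sin (b * x)))).
    apply: eq_Rintegral => x _; rewrite partial1of2E.
    by rewrite (@derive_val _ _ _ _ _ _ _ (fE b x)) mulN1r.
  rewrite RintegralZl ?mulN1r//.
  apply: (rintegrable_le _ (rintegrable_pow_gauss 1)).
    apply: continuous_measurable_fun => x; apply: cvgM.
      by apply: cvgM; [exact: cvg_id|exact: continuous_gauss].
    by apply: continuous_comp; [exact: cl|exact: continuous_sin].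
  move=> x; have := gub b x bI I; rewrite partial1of2E.
  by rewrite (@derive_val _ _ _ _ _ _ _ (fE b x)) normrN.
pose k : R := (4 * pi)^-1.
(* E is the reciprocal of the expected value, so that E * G is constant. *)
pose E c := expR (k * c ^+ 2).
have dE (b : R) : is_derive b 1 E (2 * k * b * E b).
  exact: is_derive_expR_sqr.
have cst : forall b, (E * G) b = (E * G) 0.
  move=> d; apply: is_derive_0_is_cst => b.
  apply: (is_derive_eq (is_deriveM (dE b) (dG b))).
  rewrite /GRing.scale/=.
  have -> : b / (2 * pi) = 2 * k * b.
    have p0 : pi != 0 :> R by rewrite gt_eqF// pi_gt0.
    have e (u q : R) : q != 0 -> u / (2 * q) = 2 * (4 * q)^-1 * u.
      by move=> q0; field.
    exact: e.
  ring.
have : E c * G c = E 0 * G 0 by exact: cst.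
rewrite /E /G.
rewrite expr0n/= mulr0 expR0 mul1r.
under [in X in _ = X -> _]eq_Rintegral do rewrite mul0r cos0 mulr1.
rewrite Rintegral_gauss => h.
rewrite -[LHS]mul1r -[X in X * _](expRxMexpNx_1 (k * c ^+ 2)) mulrAC h mul1r.
by congr expR; rewrite /k mulrC.
Qed.

End Gaussian.

(** * Gaussian averages, Fourier inversion and uniqueness *)

Section ProductMeasurability.
Context {R : realType}.

Lemma cmeas_fst (g : R -> R[i]) : cmeas g -> cmeas (fun p : R * R => g p.1).
Proof.
by move=> mg; exact: (@cmeas_comp _ _ _ _ _ g (fun p : R * R => p.1) mg measurable_fst).
Qed.

Lemma cmeas_snd (g : R -> R[i]) : cmeas g -> cmeas (fun p : R * R => g p.2).
Proof.
by move=> mg; exact: (@cmeas_comp _ _ _ _ _ g (fun p : R * R => p.2) mg measurable_snd).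
Qed.

End ProductMeasurability.

Section GaussianKernel.
Context {R : realType}.
Notation mu := (@lebesgue_measure R).
Implicit Types f g phi : R -> R[i].

Lemma fourierE f xi :
  fourier f xi = cint (fun x => f x * expi (- (2 * pi * x * xi))).
Proof. by apply: eq_cint => x; rewrite expiN. Qed.

Lemma cint_gauss_expi (s : R) :
  cint (fun x => (gauss x)%:C * expi (2 * pi * x * s)) = (gauss s)%:C.
Proof.
apply: complex_ext.
  rewrite Re_cint /=.
  under eq_Rintegral do rewrite mul0r subr0 mulrAC.
  rewrite Rintegral_gauss_cos /gauss; congr expR; congr (- _).
  have e (p : R) : p != 0 -> (2 * p * s) ^+ 2 / (4 * p) = p * s ^+ 2.
    by move=> p0; field.
  by apply: e; rewrite gt_eqF// pi_gt0.
rewrite Im_cint /=.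
under eq_Rintegral do rewrite mul0r addr0 mulrAC.
exact: Rintegral_gauss_sin.
Qed.

Lemma cintegrable_gauss_expi (e s : R) : 0 < e ->
  cintegrable (fun x => (gauss (e * x))%:C * expi (2 * pi * x * s)).
Proof.
move=> e0; have [ig _] := rintegrable_affine 0 e0 (@rintegrable_gauss R).
apply: (cintegrable_le _ ig) => [|x].
  apply: cmeasM.
    apply: cmeas_real; apply: continuous_measurable_fun => x.
    apply: continuous_comp; last exact: continuous_gauss.
    by apply: cvgM; [exact: cvg_cst|exact: cvg_id].
  apply: (@cmeas_comp _ _ _ _ _ _ (fun x : R => 2 * pi * x * s)).
    exact: continuous_cmeas ccontinuous_expi.
  by apply: measurable_funM => //; apply: measurable_funM.
by rewrite normcM normc_real normc_expi mulr1 addr0 ger0_norm ?gauss_ge0.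
Qed.

Lemma cint_gauss_scaled (e s : R) : 0 < e ->
  cint (fun x => (gauss (e * x))%:C * expi (2 * pi * x * s)) =
  (e^-1 * gauss (s / e))%:C.
Proof.
move=> e0.
have := cint_affine 0 e0 (cintegrable_gauss_expi (s / e) ltr01).
under [X in _ = _ * cint X -> _]eq_fun do rewrite mul1r.
rewrite cint_gauss_expi rmorphM/= => <-; apply: eq_cint => x.
rewrite mul1r addr0; congr (_ * expi _).
by field; rewrite gt_eqF.
Qed.

(** A majorant that is uniform in the width e, for dominated convergence as e
    tends to 0. *)
Lemma poly_growth_shift f (y : R) : poly_growth f -> exists (C : R) (N : nat),
  0 <= C /\ forall e x, `|e| < 1 -> normc (f (y + e * x)) <= C * (1 + `|x|) ^+ N.
Proof.
move=> [C [N hC]].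
have C0 : 0 <= C.
  have := le_trans (normc_ge0 _) (hC 0).
  by rewrite normr0 addr0 expr1n mulr1.
exists (C * (1 + `|y|) ^+ N), N; split; first by rewrite mulr_ge0// exprn_ge0// addr_ge0.
move=> e x e1; apply: (le_trans (hC _)).
rewrite -mulrA ler_wpM2l// -exprMn lerXn2r ?nnegrE ?mulr_ge0 ?addr_ge0//.
have := ler_normD y (e * x); rewrite normrM.
have h1 : `|e| * `|x| <= `|x| by rewrite ler_piMl// ltW.
have := normr_ge0 x; have := normr_ge0 y; nra.
Qed.

(** The average of f around y with a Gaussian weight of width e.  At e = 0 it is
    f y, and it depends continuously on e there; this expresses that Gaussians
    of width e form an approximate identity. *)
Definition gauss_avg f (y e : R) := cint (fun x => f (y + e * x) * (gauss x)%:C).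

Section gauss_average.
Variables (f : R -> R[i]) (y : R).
Hypotheses (cf : ccontinuous f) (gf : poly_growth f).

Lemma gauss_avg_integrand_continuous x :
  ccontinuous (fun e => f (y + e * x) * (gauss x)%:C).
Proof.
apply: ccontinuousM; last exact: ccontinuous_cst.
apply: (ccontinuous_comp (u := fun e : R => y + e * x)) => // e.
apply: cvgD; first exact: cvg_cst.
by apply: cvgM; [exact: cvg_id|exact: cvg_cst].
Qed.

Lemma gauss_avg_integrand_meas (e : R) : cmeas (fun x : R => f (y + e * x) * (gauss x)%:C).
Proof.
apply: cmeasM; last first.
  by apply: cmeas_real; apply: continuous_measurable_fun; exact: continuous_gauss.
apply: (@cmeas_comp _ _ _ _ _ _ (fun x : R => y + e * x)).
  exact: continuous_cmeas.
by apply: measurable_funD => //; exact: measurable_funM.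
Qed.

Lemma gauss_avg_continuous0 :
  {for 0, continuous (re_fun (gauss_avg f y))} /\
  {for 0, continuous (im_fun (gauss_avg f y))}.
Proof.
have [C [N [C0 hC]]] := poly_growth_shift y gf.
apply: (@cint_continuous_at _ _ (fun x => C * ((1 + `|x|) ^+ N * gauss x)) 0
  gauss_avg_integrand_meas gauss_avg_integrand_continuous).
  exact/rintegrableZ/rintegrable_pow_gauss.
move=> e x; rewrite subr0 => e1; rewrite normcM normc_real ger0_norm ?gauss_ge0//.
by rewrite mulrA ler_wpM2r ?gauss_ge0// hC.
Qed.

Lemma gauss_avg0 : gauss_avg f y 0 = f y.
Proof.
rewrite /gauss_avg; under eq_fun do rewrite mul0r addr0.
rewrite cintZ; last first.
  split; first exact: rintegrable_gauss.
  by apply: (eq_integrable _ (cst 0)) => //; exact: integrable0.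
rewrite (_ : cint _ = 1) ?mulr1//.
apply: complex_ext; first exact: Rintegral_gauss.
by rewrite Im_cint /= Rintegral_cst// mul0r.
Qed.

(** In this form the average is a pairing with a function that is the Fourier
    transform of a modulated Gaussian. *)
Lemma gauss_avgE e : 0 < e -> e < 1 ->
  gauss_avg f y e = cint (fun t => f t * (e^-1 * gauss ((y - t) / e))%:C).
Proof.
move=> e0 e1.
have e0' : 0 < e^-1 by rewrite invr_gt0.
have ie : cintegrable (fun x => f (y + e * x) * (gauss x)%:C).
  have [C [N [C0 hC]]] := poly_growth_shift y gf.
  apply: (@cintegrable_le _ _ (fun x => C * ((1 + `|x|) ^+ N * gauss x))
    (gauss_avg_integrand_meas e)).
    exact/rintegrableZ/rintegrable_pow_gauss.
  move=> x; rewrite normcM normc_real ger0_norm ?gauss_ge0//.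
  by rewrite mulrA ler_wpM2r ?gauss_ge0// hC// ger0_norm ?ltW.
have := cint_affine (- y / e) e0' ie; rewrite invrK => h.
have e_neq0 : e%:C != 0 :> R[i].
  by rewrite -(rmorph0 (real_complex R)) (inj_eq (@complexI R)) gt_eqF.
apply: (mulfI e_neq0); rewrite -/(gauss_avg f y e) in h.
rewrite -h -cintZ; last first.
  have := cintegrableZ (e^-1)%:C (cintegrable_affine (- y / e) e0' ie).
  congr cintegrable; apply/funext => t.
  have -> : y + e * (e^-1 * t + - y / e) = t by field; rewrite gt_eqF.
  have -> : e^-1 * t + - y / e = - ((y - t) / e) by field; rewrite gt_eqF.
  by rewrite gaussN rmorphM/= mulrCA.
apply: eq_cint => t.
have -> : y + e * (e^-1 * t + - y / e) = t by field; rewrite gt_eqF.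
have -> : e^-1 * t + - y / e = - ((y - t) / e) by field; rewrite gt_eqF.
rewrite gaussN mulrCA -rmorphM/= mulrA divff ?gt_eqF// mul1r//.
Qed.

End gauss_average.

Lemma eq_at0 (u v : R -> R) : {for 0, continuous u} -> {for 0, continuous v} ->
  (forall e, 0 < e -> e < 1 -> u e = v e) -> u 0 = v 0.
Proof.
move=> cu cv uv.
have cu' : u x @[x --> 0^'+] --> u 0 by exact: cvg_at_right_filter.
have cv' : v x @[x --> 0^'+] --> v 0 by exact: cvg_at_right_filter.
have cu2 : u x @[x --> 0^'+] --> v 0; last exact: (cvg_unique _ cu' cu2).
apply: cvg_trans cv'; apply: near_eq_cvg.
near=> x; apply/esym; apply: uv; first by near: x; exact: nbhs_right_gt.
by near: x; apply: nbhs_right_lt.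
Unshelve. all: by end_near. Qed.

(** The pattern of both uses of Gaussian regularisation: identities valid for all
    small positive widths persist at width 0. *)
Lemma ceq_at0 (u v : R -> R[i]) :
  {for 0, continuous (re_fun u)} /\ {for 0, continuous (im_fun u)} ->
  {for 0, continuous (re_fun v)} /\ {for 0, continuous (im_fun v)} ->
  (forall e, 0 < e -> e < 1 -> u e = v e) -> u 0 = v 0.
Proof.
move=> [ur ui] [vr vi] uv; apply: complex_ext.
  by apply: (eq_at0 ur vr) => e e0 e1; rewrite /re_fun uv.
by apply: (eq_at0 ui vi) => e e0 e1; rewrite /im_fun uv.
Qed.

End GaussianKernel.

Section Inversion.
Context {R : realType}.
Notation mu := (@lebesgue_measure R).
Implicit Types f g phi : R -> R[i].

Lemma ccontinuous_phase (a b : R) : ccontinuous (fun x : R => expi (a * x * b)).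
Proof.
apply: (ccontinuous_comp (u := fun x => a * x * b)); first exact: ccontinuous_expi.
move=> x; apply: cvgM; last exact: cvg_cst.
by apply: cvgM; [exact: cvg_cst|exact: cvg_id].
Qed.

Lemma bounded_poly_growth f (B : R) : (forall x, normc (f x) <= B) -> poly_growth f.
Proof. by move=> fB; exists B, 0%N => x; rewrite expr0 mulr1. Qed.

(** The factor gauss (e * z) inserted in the inversion integral makes the double
    integral absolutely convergent; by Fubini the regularised integral is a
    Gaussian average of phi, and both sides are continuous at e = 0. *)
Lemma fourier_inversion phi (B : R) : ccontinuous phi -> cintegrable phi ->
  (forall x, normc (phi x) <= B) -> ccontinuous (fourier phi) ->
  cintegrable (fourier phi) ->
  forall xi, cint (fun z => fourier phi z * expi (2 * pi * z * xi)) = phi xi.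
Proof.
move=> cphi iphi phiB cK iK xi.
have gphi := bounded_poly_growth phiB.
pose L e := cint (fun z => fourier phi z * expi (2 * pi * z * xi) * (gauss (e * z))%:C).
have mg e : cmeas (fun z : R => (gauss (e * z))%:C).
  apply: cmeas_real; apply: continuous_measurable_fun => z.
  apply: continuous_comp; last exact: continuous_gauss.
  by apply: cvgM; [exact: cvg_cst|exact: cvg_id].
have cL : {for 0, continuous (re_fun L)} /\ {for 0, continuous (im_fun L)}.
  apply: (@cint_continuous_at _ _ (fun z => normc (fourier phi z)) 0).
  - move=> e; apply: cmeasM; last exact: mg.
    apply: cmeasM; first exact: continuous_cmeas.
    by apply: continuous_cmeas; exact: ccontinuous_phase.
  - move=> z; apply: ccontinuousM; first exact: ccontinuous_cst.
    split=> e; last exact: cvg_cst.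
    apply: continuous_comp; last exact: continuous_gauss.
    by apply: cvgM; [exact: cvg_id|exact: cvg_cst].
  - exact: cintegrable_normc.
  - move=> e z _; rewrite !normcM normc_expi mulr1 normc_real ger0_norm ?gauss_ge0//.
    by rewrite ler_piMr ?normc_ge0// gauss_le1.
rewrite -(gauss_avg0 phi xi) -(ceq_at0 cL (gauss_avg_continuous0 xi cphi gphi)).
  by apply: eq_cint => z; rewrite mul0r gauss0 mulr1.
move=> e e0 e1; rewrite (gauss_avgE xi cphi gphi e0 e1) /L.
(* Both sides are iterated integrals of this function, in opposite orders. *)
pose F (p : R * R) : R[i] := phi p.2 * expi (- (2 * pi * p.2 * p.1)) *
   (expi (2 * pi * p.1 * xi) * (gauss (e * p.1))%:C).
have [ig _] := rintegrable_affine 0 e0 (@rintegrable_gauss R).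
have ig' : rintegrable (fun x => gauss (e * x)).
  by move: ig; under [fun x => _]eq_fun do rewrite addr0.
have iphin := cintegrable_normc iphi.
transitivity (cint (fun z => cint (fun t => F (z, t)))).
  apply: eq_cint => z; rewrite fourierE -mulrA mulrC -cintZ.
    by apply: eq_cint => t; rewrite /F /= mulrC.
  apply: (cintegrable_le _ iphin) => [|t].
    apply: cmeasM; first exact: continuous_cmeas.
    under eq_fun do rewrite -!mulNr.
    apply: continuous_cmeas.
    have := ccontinuous_phase (- (2 * pi)) z.
    by congr ccontinuous; apply/funext => t; rewrite !mulNr.
  by rewrite normcM normc_expi mulr1.
have m1 := cmeas_snd (continuous_cmeas cphi).
have m2 : cmeas (fun p : R * R => expi (- (2 * pi * p.2 * p.1))).
  apply: (@cmeas_comp _ _ _ _ _ _ (fun p : R * R => - (2 * pi * p.2 * p.1))).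
    exact: continuous_cmeas ccontinuous_expi.
  by apply: measurableT_comp => //; apply: measurable_funM => //; apply: measurable_funM.
have m3 := cmeas_fst (continuous_cmeas (ccontinuous_phase (2 * pi) xi)).
have m4 := cmeas_fst (mg e).
rewrite (@cint_fubini _ F (fun z t => gauss (e * z) * normc (phi t))
    (fun z => (\int[mu]_t normc (phi t)) * gauss (e * z))).
- apply: eq_cint => t.
  have -> : (e^-1 * gauss ((xi - t) / e))%:C =
      cint (fun x => (gauss (e * x))%:C * expi (2 * pi * x * (xi - t))).
    by rewrite cint_gauss_scaled.
  rewrite -cintZ; last exact: cintegrable_gauss_expi.
  apply: eq_cint => z; rewrite /F /= -mulrA; congr (_ * _).
  rewrite mulrA -expiD mulrC; congr (_ * expi _); ring.
- by apply: cmeasM; apply: cmeasM.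
- by move=> z; exact: rintegrableZ.
- exact: rintegrableZ.
- by move=> z; rewrite RintegralZl// mulrC.
- move=> z t; rewrite /F /= !normcM !normc_expi mulr1 mul1r normc_real.
  by rewrite ger0_norm ?gauss_ge0// mulrC.
Qed.

End Inversion.

Section Uniqueness.
Context {R : realType}.
Notation mu := (@lebesgue_measure R).

Section gauss_schwartz.
Variables (e b : R).
Hypothesis e0 : 0 < e.

(** Modulated Gaussians times polynomials, a class closed under derivatives.
    It serves to see that modulated Gaussians are Schwartz functions. *)
Definition trig (p q : {poly R}) (x : R) :=
  (p.[x] * cos (b * x) + q.[x] * sin (b * x)) * gauss (e * x).

Lemma is_derive_trig p q (x : R) : is_derive x 1 (trig p q)
  (trig (p^`() + b *: q - (2 * pi * e ^+ 2) *: ('X * p))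
        (q^`() - b *: p - (2 * pi * e ^+ 2) *: ('X * q)) x).
Proof.
have hc := is_derive_scaled (is_derive_cos (b * x)).
have hs := is_derive_scaled (is_derive_sin (b * x)).
have hg := is_derive_scaled (is_derive_gauss (e * x)).
have h := is_deriveM (is_deriveD (is_deriveM (is_derive_poly p x) hc)
  (is_deriveM (is_derive_poly q x) hs)) hg.
apply: (is_derive_eq h); rewrite /trig /GRing.scale /= !hornerE /=.
rewrite (_ : (horner p * (fun y : R => cos (b * y)) +
  horner q * (fun y : R => sin (b * y)) : R -> R) x =
  p.[x] * cos (b * x) + q.[x] * sin (b * x)) //.
by ring.
Qed.

Lemma derive1n_trig n p q : exists p' q', ((trig p q)^`(n))%classic = trig p' q'.
Proof.
elim: n => [|n [p' [q' IH]]]; first by exists p, q.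
do 2 eexists; rewrite derive1nS IH; apply/funext => x; rewrite derive1E.
exact: (@derive_val _ _ _ _ _ _ _ (is_derive_trig p' q' x)).
Qed.

(** A crude bound suffices: the exponent, the size of p, is one more than the
    degree. *)
Lemma poly_bound (p : {poly R}) : exists2 C, 0 <= C &
  forall x : R, `|p.[x]| <= C * (1 + `|x|) ^+ size p.
Proof.
elim/poly_ind: p => [|p c [C C0 hC]].
  by exists 0 => // x; rewrite horner0 normr0 mul0r.
exists (C + `|c|); first by rewrite addr_ge0.
have [->|pc] := eqVneq (p * 'X + c%:P) 0.
  by move=> x; rewrite horner0 normr0 mulr_ge0 ?exprn_ge0 ?addr_ge0.
move=> x; rewrite !hornerE; apply: (le_trans (ler_normD _ _)).
have x1 : 1 <= 1 + `|x| by rewrite lerDl.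
have [p0|p0] := eqVneq p 0.
  rewrite p0 horner0 mul0r normr0 add0r.
  rewrite (le_trans (_ : _ <= C + `|c|)) ?lerDr// ler_peMr ?addr_ge0//.
  exact: exprn_ege1.
have -> : size (p * 'X + c%:P) = (size p).+1.
  by rewrite size_MXaddC (negbTE p0).
rewrite mulrDl lerD//; last by rewrite ler_peMr// exprn_ege1.
rewrite normrM exprSr mulrA ler_pM//.
by rewrite lerDr.
Qed.

Lemma rschwartz_trig p q : rschwartz (trig p q).
Proof.
split=> [n x|m n].
  have [p' [q' ->]] := derive1n_trig n p q.
  exact: (@ex_derive _ _ _ _ _ _ _ (is_derive_trig p' q' x)).
have [p' [q' ->]] := derive1n_trig n p q.
have [C C0 hC] := poly_bound p'; have [D D0 hD] := poly_bound q'.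
pose N := (m + maxn (size p') (size q'))%N.
have [G G0 hG] := @pow_gauss_bounded R N.
exists ((C + D) * (1 + e^-1) ^+ N * G) => x.
have x1 : 1 <= 1 + `|x| by rewrite lerDl.
rewrite /trig normrM (ger0_norm (gauss_ge0 _)).
apply: (@le_trans _ _ ((C + D) * (1 + `|x|) ^+ N * gauss (e * x))).
  rewrite mulrA ler_wpM2r ?gauss_ge0// /N exprD mulrCA.
  rewrite ler_pM ?exprn_ge0//.
    by rewrite lerXn2r ?nnegrE ?addr_ge0// lerDr.
  apply: (le_trans (ler_normD _ _)); rewrite mulrDl lerD// normrM.
    apply: (@le_trans _ _ (`|p'.[x]|)); first by rewrite ler_piMr// normr_cos.
    apply: (le_trans (hC x)); rewrite ler_wpM2l//.
    by rewrite ler_weXn2l// leq_maxl.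
  apply: (@le_trans _ _ (`|q'.[x]|)); first by rewrite ler_piMr// normr_sin.
  apply: (le_trans (hD x)); rewrite ler_wpM2l//.
  by rewrite ler_weXn2l// leq_maxr.
rewrite -2!mulrA ler_wpM2l ?addr_ge0//.
apply: (@le_trans _ _ ((1 + e^-1) ^+ N * ((1 + `|e * x|) ^+ N * gauss (e * x)))).
  rewrite mulrA ler_wpM2r ?gauss_ge0// -exprMn.
  have ei : 0 < e^-1 by rewrite invr_gt0.
  rewrite lerXn2r ?nnegrE ?mulr_ge0 ?addr_ge0// ?(ltW ei)//.
  rewrite normrM (gtr0_norm e0) mulrDl mul1r mulrDr mulr1 mulKf ?gt_eqF//.
  have : 0 <= e * `|x| by rewrite mulr_ge0// ltW.
  lra.
by rewrite ler_wpM2l ?exprn_ge0 ?addr_ge0// invr_ge0 ltW.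
Qed.

Lemma schwartz_gauss_expi : schwartz (fun x => (gauss (e * x))%:C * expi (b * x)).
Proof.
apply: schwartz_re_im.
  have := rschwartz_trig 1 0; congr rschwartz; apply/funext => x.
  by rewrite /trig /re_fun Re_mul /= !hornerE/=; ring.
have := rschwartz_trig 0 1; congr rschwartz; apply/funext => x.
by rewrite /trig /im_fun Im_mul /= !hornerE/=; ring.
Qed.

End gauss_schwartz.

(** Test with x |-> gauss (e x) expi (2 pi y x): its transform is a Gaussian of
    width e centred at y, so the Gaussian averages of g1 and g2 around y agree
    for every e > 0, and so do their limits g1 y and g2 y. *)
Lemma eq_of_fourier_dual (g1 g2 : R -> R[i]) : ccontinuous g1 -> poly_growth g1 ->
  ccontinuous g2 -> poly_growth g2 ->
  eqD (fourierD (distr_of g1)) (fourierD (distr_of g2)) -> g1 = g2.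
Proof.
move=> c1 p1 c2 p2 g12; apply/funext => y.
rewrite -(gauss_avg0 g1 y) -(gauss_avg0 g2 y).
apply: ceq_at0; [exact: gauss_avg_continuous0|exact: gauss_avg_continuous0|].
move=> e e0 e1; rewrite !gauss_avgE//.
have := g12 _ (schwartz_gauss_expi (2 * pi * y) e0).
rewrite /fourierD /distr_of -!/(cint _).
have E : fourier (fun x => (gauss (e * x))%:C * expi (2 * pi * y * x)) =
    (fun t => (e^-1 * gauss ((y - t) / e))%:C).
  apply/funext => t; rewrite fourierE -cint_gauss_scaled//.
  apply: eq_cint => x; rewrite -mulrA -expiD; congr (_ * expi _); ring.
by rewrite E.
Qed.

End Uniqueness.

(** * Fourier transforms of Schwartz functions *)

Section SchwartzFourier.
Context {R : realType}.
Notation mu := (@lebesgue_measure R).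
Implicit Types f g phi : R -> R[i].

Lemma schwartz_continuous phi : schwartz phi -> ccontinuous phi.
Proof.
move=> sphi; have [s1 _] := schwartz_re sphi; have [s2 _] := schwartz_im sphi.
by split; [exact: (rsmooth_continuous (n := 0) s1)|exact: (rsmooth_continuous (n := 0) s2)].
Qed.

Lemma schwartz_integrable phi : schwartz phi -> cintegrable phi.
Proof.
by move=> sphi; split; [exact: (rschwartz_integrable 0 (schwartz_re sphi))|
  exact: (rschwartz_integrable 0 (schwartz_im sphi))].
Qed.

Lemma schwartz_bounded phi : schwartz phi -> exists B, forall x, normc (phi x) <= B.
Proof.
move=> [_ /(_ 0%N 0%N) [B hB]]; exists B => x.
apply: le_trans (hB x); rewrite expr0 mul1r.
by rewrite (_ : cderiv 0 phi x = phi x) //; exact: complex_ext.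
Qed.

Lemma fourier_continuous phi : cintegrable phi -> ccontinuous (fourier phi).
Proof.
move=> iphi.
have -> : fourier phi = (fun xi => cint (fun x => phi x * expi (- (2 * pi * x * xi)))).
  by apply/funext => xi; rewrite fourierE.
apply: (cint_continuous _ _ (cintegrable_normc iphi)).
- move=> xi; apply: cmeasM; first exact: cintegrable_cmeas.
  have := continuous_cmeas (ccontinuous_phase (- (2 * pi)) xi).
  by congr cmeas; apply/funext => x; rewrite !mulNr.
- move=> x; apply: ccontinuousM; first exact: ccontinuous_cst.
  have := ccontinuous_comp ccontinuous_expi (u := fun xi => - (2 * pi * x * xi)).
  apply => xi; apply: cvgN.
  by apply: cvgM; [exact: cvg_cst|exact: cvg_id].
- by move=> xi x; rewrite normcM normc_expi mulr1.
Qed.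

Lemma decay_le_2pi (xi : R) : decay (2 * pi * xi) <= decay xi.
Proof.
rewrite lef_pV2 ?posrE ?(lt_le_trans ltr01 (oneDsqr_ge1 _))//.
rewrite /oneDsqr lerD2l exprMn ler_peMl ?sqr_ge0//.
have := pi_ge2 R; nra.
Qed.

Lemma fourier_decay phi : schwartz phi -> exists2 M, 0 <= M &
  forall xi, normc (fourier phi xi) <= M * decay xi.
Proof.
move=> sphi; have sr := schwartz_re sphi; have si := schwartz_im sphi.
have [M M0 hM] := rschwartz_trig_decay sr.
have [N N0 hN] := rschwartz_trig_decay si.
exists (2 * (M + N)); first by rewrite mulr_ge0// addr_ge0.
move=> xi; set c := 2 * pi * xi.
have mk (a w : R -> R) : rschwartz a -> continuous w -> (forall x, `|w x| <= 1) ->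
    rintegrable (fun x => a x * w (c * x)).
  move=> sa cw w1; apply: (rintegrable_le _ (rintegrable_norm (rschwartz_integrable 0 sa))).
    apply: continuous_measurable_fun => x; apply: cvgM.
      exact: (rsmooth_continuous (n := 0) sa.1).
    apply: continuous_comp; last exact: cw.
    by apply: cvgM; [exact: cvg_cst|exact: cvg_id].
  by move=> x; rewrite normrM ler_piMr.
have cs := @continuous_sin R; have cc := @continuous_cos R.
have n1 := @normr_cos R; have n2 := @normr_sin R.
have xE x : 2 * pi * x * xi = c * x by rewrite /c; ring.
have hre : `|complex.Re (fourier phi xi)| <= (M + N) * decay c.
  rewrite fourierE Re_cint.
  under eq_Rintegral do rewrite Re_mul expiN /= mulrN opprK xE.
  rewrite RintegralD//; [|exact: mk|exact: mk].
  apply: (le_trans (ler_normD _ _)); rewrite mulrDl.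
  by rewrite lerD//; [have [] := hM c|have [] := hN c].
have him : `|complex.Im (fourier phi xi)| <= (M + N) * decay c.
  rewrite fourierE Im_cint.
  under eq_Rintegral do rewrite Im_mul expiN /= mulrN xE addrC.
  rewrite RintegralB//; [|exact: mk|exact: mk].
  apply: (le_trans (ler_normB _ _)); rewrite mulrDl addrC.
  by rewrite lerD//; [have [] := hM c|have [] := hN c].
apply: (le_trans (normc_le _)); apply: (le_trans (lerD hre him)).
have := @ler_wpM2l R (M + N) _ _ _ (decay_le_2pi xi); rewrite addr_ge0// => /(_ isT).
rewrite -/c; set u := decay c; set v := decay xi; lra.
Qed.

Lemma schwartz_fourier_integrable phi : schwartz phi -> cintegrable (fourier phi).
Proof.
move=> sphi; have [M M0 hM] := fourier_decay sphi.
apply: (cintegrable_le _ (rintegrableZ M rintegrable_decay) hM).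
exact/continuous_cmeas/fourier_continuous/schwartz_integrable.
Qed.

(** Outside the support all derivatives vanish, and on a compact interval a
    continuous function is bounded. *)
Lemma rschwartz_compact (a : R -> R) (r : R) : rsmooth a ->
  (forall x, r < `|x| -> a x = 0) -> rschwartz a.
Proof.
move=> sa a0; split => // m n.
pose w x : R := `|x| ^+ m * `|(a^`(n))%classic x|.
have cw : continuous w.
  move=> x; apply: cvgM.
    exact: (continuous_comp (@norm_continuous _ _ x) (@exprn_continuous _ m _)).
  by apply: cvg_norm; exact: rsmooth_continuous.
pose s : R := `|r|.
have s0 : - s <= s by have : 0 <= s := normr_ge0 r; lra.
have [c cs hc] := EVT_max s0 (continuous_subspaceT cw).
exists (w c) => x; have [xs|xs] := leP `|x| s.
  by apply: hc; rewrite in_itv/= -ler_norml.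
have z : \forall y \near x, a y = cst 0 y.
  have : \forall y \near x, s < `|y|.
    have nx : (`|y| : R) @[y --> x] --> (`|x| : R) by exact: norm_continuous.
    exact: (cvgr_gt _ nx _ xs).
  by apply: filterS => y hy; rewrite a0//; exact: le_lt_trans (ler_norm _) hy.
have /nbhs_singleton -> := near_eq_derive1n n z.
have -> : ((cst (0:R))^`(n))%classic x = 0 by case: (n) => [//|k]; rewrite derive1n_cst.
by rewrite normr0 mulr0 mulr_ge0.
Qed.

Lemma cutoff_out eta0 xi : cutoff eta0 -> 3 / 4 < `|xi| -> eta0 xi = 0 :> R[i].
Proof.
move=> [_ supp _] hxi; apply/eqP/negPn/negP => e0.
have : csupport eta0 xi by exact: subset_closure.
by move/supp => /=; rewrite ltNge (ltW hxi).
Qed.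

Lemma cutoff_schwartz (eta0 : R -> R[i]) : cutoff eta0 -> schwartz eta0.
Proof.
move=> ce; have [[se _] _ _] := ce.
by apply: schwartz_re_im; apply: (@rschwartz_compact _ (3 / 4)) => [n x|x hx];
  [have [] := se n x| rewrite /re_fun (cutoff_out ce)|
   have [] := se n x| rewrite /im_fun (cutoff_out ce)].
Qed.

Lemma cutoff_inversion (eta0 : R -> R[i]) : cutoff eta0 -> forall xi,
  cint (fun z => fourier eta0 z * expi (2 * pi * z * xi)) = eta0 xi.
Proof.
move=> /cutoff_schwartz se; have [B hB] := schwartz_bounded se.
apply: (@fourier_inversion _ _ B) => //.
- exact: schwartz_continuous.
- exact: schwartz_integrable.
- exact/fourier_continuous/schwartz_integrable.
- exact: schwartz_fourier_integrable.
Qed.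

End SchwartzFourier.

(** * Fourier multipliers with an integrable kernel *)

Section Filters.
Context {R : realType}.
Notation mu := (@lebesgue_measure R).
Implicit Types k m phi F : R -> R[i].

(** Correlation of F with k.  On the Fourier side it multiplies by [symbol k],
    the inverse transform of k; see [filt_dual]. *)
Definition filt k F (y : R) : R[i] := cint (fun z => F (y + z) * k z).

Definition symbol k (xi : R) : R[i] := cint (fun z => k z * expi (2 * pi * z * xi)).

Section bounded_continuous.
Variables (F : R -> R[i]) (B : R).
Hypotheses (cF : ccontinuous F) (FB : forall x, normc (F x) <= B).

Lemma bound_ge0 : 0 <= B.
Proof. exact: le_trans (normc_ge0 _) (FB 0). Qed.

Lemma filt_integrand_meas k y : cmeas k -> cmeas (fun z : R => F (y + z) * k z).
Proof.
move=> mk; apply: cmeasM => //.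
apply: (@cmeas_comp _ _ _ _ _ F (fun z : R => y + z)).
  exact: continuous_cmeas.
exact: measurable_funD.
Qed.

Lemma filt_integrand_integrable k y : cintegrable k ->
  cintegrable (fun z => F (y + z) * k z).
Proof.
move=> ik; apply: (cintegrable_le _ (rintegrableZ B (cintegrable_normc ik))).
  exact/filt_integrand_meas/cintegrable_cmeas.
by move=> z; rewrite normcM ler_wpM2r ?normc_ge0.
Qed.

Lemma filt_continuous k : cintegrable k -> ccontinuous (filt k F).
Proof.
move=> ik; apply: (cint_continuous _ _ (rintegrableZ B (cintegrable_normc ik))).
- by move=> y; exact/filt_integrand_meas/cintegrable_cmeas.
- move=> z; apply: ccontinuousM; last exact: ccontinuous_cst.
  apply: (ccontinuous_comp (u := fun y : R => y + z)) => // y.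
  by apply: cvgD; [exact: cvg_id|exact: cvg_cst].
- by move=> y z; rewrite normcM ler_wpM2r ?normc_ge0.
Qed.

Lemma symbol_continuous k : cintegrable k -> ccontinuous (symbol k).
Proof.
move=> ik; apply: (cint_continuous _ _ (cintegrable_normc ik)).
- move=> xi; apply: cmeasM; first exact: cintegrable_cmeas.
  exact: continuous_cmeas (ccontinuous_phase _ _).
- move=> x; apply: ccontinuousM; first exact: ccontinuous_cst.
  have := ccontinuous_comp ccontinuous_expi (u := fun xi => 2 * pi * x * xi).
  apply => xi; by apply: cvgM; [exact: cvg_cst|exact: cvg_id].
- by move=> xi x; rewrite normcM normc_expi mulr1.
Qed.

Lemma symbol_bounded k xi : cintegrable k ->
  normc (symbol k xi) <= 2 * \int[mu]_z normc (k z).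
Proof.
move=> ik; apply: normc_cint_le.
- apply: cmeasM; first exact: cintegrable_cmeas.
  exact: continuous_cmeas (ccontinuous_phase _ _).
- exact: cintegrable_normc.
- by move=> z; rewrite normcM normc_expi mulr1.
Qed.

Lemma symbol_mul_integrable k phi : cintegrable k -> cintegrable phi ->
  cintegrable (fun xi => symbol k xi * phi xi).
Proof.
move=> ik iphi.
apply: (cintegrable_le _ (rintegrableZ (2 * \int[mu]_z normc (k z)) (cintegrable_normc iphi))).
  apply: cmeasM; last exact: cintegrable_cmeas.
  exact/continuous_cmeas/symbol_continuous.
by move=> xi; rewrite normcM ler_wpM2r ?normc_ge0 ?symbol_bounded.
Qed.

Lemma meas_phase_joint : cmeas (fun p : R * R => expi (2 * pi * p.2 * p.1)).
Proof.
apply: (@cmeas_comp _ _ _ _ _ _ (fun p : R * R => 2 * pi * p.2 * p.1)).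
  exact: continuous_cmeas ccontinuous_expi.
by apply: measurable_funM => //; apply: measurable_funM.
Qed.

(** Fubini, after writing out the symbol: a product of symbol and function
    becomes a convolution of kernel and transform. *)
Lemma fourier_symbol_mul k phi x : cintegrable k -> cintegrable phi ->
  fourier (fun xi => symbol k xi * phi xi) x =
  cint (fun z => k z * fourier phi (x - z)).
Proof.
move=> ik iphi; rewrite fourierE.
have nk := cintegrable_normc ik; have nphi := cintegrable_normc iphi.
have mk := cintegrable_cmeas ik; have mphi := cintegrable_cmeas iphi.
pose f (p : R * R) : R[i] := phi p.1 * expi (- (2 * pi * p.1 * x)) *
  (k p.2 * expi (2 * pi * p.2 * p.1)).
have mph (s : R) : cmeas (fun t : R => expi (- (2 * pi * t * s))).
  have := continuous_cmeas (ccontinuous_phase (- (2 * pi)) s).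
  by congr cmeas; apply/funext => t; rewrite !mulNr.
transitivity (cint (fun xi => cint (fun z => f (xi, z)))).
  apply: eq_cint => xi; rewrite /symbol -mulrA mulrC -cintZ//.
  apply: (cintegrable_le _ nk) => [|z].
    apply: cmeasM => //; exact: continuous_cmeas (ccontinuous_phase _ _).
  by rewrite normcM normc_expi mulr1.
rewrite (@cint_fubini _ f (fun xi z => normc (phi xi) * normc (k z))
    (fun xi => (\int[mu]_z normc (k z)) * normc (phi xi))).
- apply: eq_cint => z; rewrite fourierE -cintZ.
    apply: eq_cint => xi; rewrite /f /= mulrC -!mulrA; congr (_ * _).
    rewrite mulrCA; congr (_ * _); rewrite -expiD; congr expi; ring.
  apply: (cintegrable_le _ nphi) => [|xi]; first by apply: cmeasM.
  by rewrite normcM normc_expi mulr1.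
- apply: cmeasM; apply: cmeasM.
  + exact: cmeas_fst.
  + exact: (cmeas_fst (mph x)).
  + exact: cmeas_snd.
  + exact: meas_phase_joint.
- by move=> xi; exact: rintegrableZ.
- exact: rintegrableZ.
- by move=> xi; rewrite RintegralZl// mulrC.
- by move=> xi z; rewrite /f /= !normcM !normc_expi !mulr1.
Qed.

(** Fubini twice, with the translation x = y + z in between: the kernel moves
    from F to the function F is paired with. *)
Lemma filt_pairing k psi (D : R) : cintegrable k -> cintegrable psi ->
  (forall x, normc (psi x) <= D) ->
  cint (fun y => filt k F y * psi y) =
  cint (fun x => F x * cint (fun z => k z * psi (x - z))).
Proof.
move=> ik ipsi hD.
have B0 := bound_ge0.
have nk := cintegrable_normc ik; have npsi := cintegrable_normc ipsi.
have mk := cintegrable_cmeas ik; have mpsi := cintegrable_cmeas ipsi.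
have mF := continuous_cmeas cF.
have ipsi_shift z : cintegrable (fun x => psi (x - z)).
  have := cintegrable_affine (- z) ltr01 ipsi.
  by congr cintegrable; apply/funext => x; rewrite mul1r.
have iFpsi z : cintegrable (fun x => F x * psi (x - z)).
  apply: (cintegrable_le _ (rintegrableZ B (cintegrable_normc (ipsi_shift z)))).
    by apply: cmeasM => //; exact: cintegrable_cmeas.
  by move=> x; rewrite normcM ler_wpM2r ?normc_ge0.
pose f1 (p : R * R) : R[i] := k p.1 * (F p.2 * psi (p.2 - p.1)).
pose f2 (p : R * R) : R[i] := k p.1 * (F (p.2 + p.1) * psi p.2).
transitivity (cint (fun y => cint (fun z => f2 (z, y)))).
  apply: eq_cint => y; rewrite /filt mulrC -cintZ; last exact: filt_integrand_integrable.
  by apply: eq_cint => z; rewrite /f2 /=; ring.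
have mplus : measurable_fun setT (fun p : R * R => p.2 + p.1).
  exact: measurable_funD.
have mminus : measurable_fun setT (fun p : R * R => p.2 - p.1).
  exact: measurable_funB.
have EA z : \int[mu]_x normc (psi (x - z)) = \int[mu]_x normc (psi x).
  have [_] := rintegrable_affine (- z) ltr01 npsi.
  rewrite invr1 mul1r => <-; apply: eq_Rintegral => x _.
  by rewrite mul1r.
have iA : rintegrable (fun z => B * (\int[mu]_y normc (psi y)) * normc (k z)).
  exact: rintegrableZ.
rewrite -(@cint_fubini _ f2 (fun z y => B * normc (k z) * normc (psi y)) _ _ _ iA); last 4 first.
- apply: cmeasM; first exact: cmeas_fst.
  apply: cmeasM; last exact: cmeas_snd.
  exact: (@cmeas_comp _ _ _ _ _ F (fun p : R * R => p.2 + p.1)).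
- by move=> z; exact: rintegrableZ.
- by move=> z; rewrite RintegralZl// mulrAC.
- move=> z y; rewrite /f2 /= !normcM mulrA ler_wpM2r ?normc_ge0// mulrC.
  by rewrite ler_wpM2r ?normc_ge0.
transitivity (cint (fun z => cint (fun x => f1 (z, x)))).
  apply: eq_cint => z; rewrite /f1 /f2 /=.
  rewrite -[RHS](cint_shift z); last exact: cintegrableZ.
  by apply: eq_cint => y; rewrite addrK.
rewrite (@cint_fubini _ f1 (fun z x => B * normc (k z) * normc (psi (x - z))) _ _ _ iA).
- apply: eq_cint => x; rewrite -cintZ.
    by apply: eq_cint => z; rewrite /f1 /=; ring.
  apply: (cintegrable_le _ (rintegrableZ D nk)).
    apply: cmeasM => //; apply: (@cmeas_comp _ _ _ _ _ psi (fun z : R => x - z)) => //.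
    exact: measurable_funB.
  by move=> z; rewrite normcM mulrC ler_wpM2r ?normc_ge0// hD.
- apply: cmeasM; first exact: cmeas_fst.
  apply: cmeasM; first exact: cmeas_snd.
  exact: (@cmeas_comp _ _ _ _ _ psi (fun p : R * R => p.2 - p.1)).
- by move=> z; exact/rintegrableZ/cintegrable_normc.
- move=> z; rewrite RintegralZl//; last exact: cintegrable_normc.
  by rewrite EA mulrAC.
- move=> z x; rewrite /f1 /= !normcM mulrA ler_wpM2r ?normc_ge0// mulrC.
  by rewrite ler_wpM2r ?normc_ge0.
Qed.

Lemma fourier_bounded phi xi : cintegrable phi ->
  normc (fourier phi xi) <= 2 * \int[mu]_t normc (phi t).
Proof.
move=> iphi; rewrite fourierE; apply: normc_cint_le.
- apply: cmeasM; first exact: cintegrable_cmeas.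
  have := continuous_cmeas (ccontinuous_phase (- (2 * pi)) xi).
  by congr cmeas; apply/funext => t; rewrite !mulNr.
- exact: cintegrable_normc.
- by move=> t; rewrite normcM normc_expi mulr1.
Qed.

(** This identifies filt k F, for bounded F that may have no Fourier transform as
    a function, as the multiplier with symbol k applied to F in the sense of
    distributions. *)
Lemma filt_dual k phi : cintegrable k -> cintegrable phi -> cintegrable (fourier phi) ->
  distr_of (filt k F) (fourier phi) =
  distr_of F (fourier (fun xi => symbol k xi * phi xi)).
Proof.
move=> ik iphi ihphi; rewrite /distr_of -!/(cint _).
rewrite (filt_pairing ik ihphi (fun xi => fourier_bounded xi iphi)).
by apply: eq_cint => x; rewrite fourier_symbol_mul.
Qed.

End bounded_continuous.

End Filters.

(** * Littlewood-Paley pieces of a bounded continuous function *)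

Section LittlewoodPaley.
Context {R : realType}.
Notation mu := (@lebesgue_measure R).
Implicit Types (F : R -> R[i]) (e : R) (T : schwartz_functional R).

Lemma bounded_integrable (A : set R) (w : R -> R) (M : R) :
  measurable A -> (mu A < +oo)%E -> measurable_fun setT w ->
  (forall x, `|w x| <= M) -> mu.-integrable A (EFin \o w).
Proof.
move=> mA fA mw wb; apply: measurable_bounded_integrable => //.
  exact: (measurable_funS measurableT (@subsetT _ _) mw).
exists M; split; first exact: num_real.
by move=> x hx y _ /=; rewrite (le_trans (wb y))// ltW.
Qed.

(** Dominated convergence with a constant majorant. *)
Lemma Rintegral_bounded_cvg (A : set R) (u : nat -> R -> R) (v : R -> R) (M : R) :
  measurable A -> (mu A < +oo)%E -> (forall n, measurable_fun setT (u n)) ->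
  (forall x, u n x @[n --> \oo] --> v x) -> (forall n x, `|u n x| <= M) ->
  \int[mu]_(x in A) u n x @[n --> \oo] --> \int[mu]_(x in A) v x.
Proof.
move=> mA fA mu_ uv uM.
have mv : measurable_fun setT v.
  apply: (@measurable_fun_cvg _ _ _ setT u v) => // x _; exact: uv.
have [] := @dominated_convergence _ _ R mu A mA (fun n x => (u n x)%:E) (EFin \o v)
  (cst M%:E).
- move=> n; apply/measurable_EFinP.
  exact: (measurable_funS measurableT (@subsetT _ _) (mu_ n)).
- by apply/measurable_EFinP; exact: measurable_funTS.
- by apply: nearW => x _; apply: cvg_EFin; [near=> n|exact: uv].
- exact: (bounded_integrable (w := cst M) (M := `|M|) mA fA).
- by apply: nearW => x n _; rewrite /= lee_fin.
move=> iv _ cv; apply: fine_cvg; rewrite fineK//.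
exact: integrable_fin_num.
Unshelve. all: by end_near. Qed.

(** The partial sums of the d n telescope to L n. *)
Lemma limn_series_Rintegral (A : set R) (d L : nat -> R -> R) (v : R -> R) (M : R) :
  measurable A -> (mu A < +oo)%E -> (forall n, measurable_fun setT (L n)) ->
  (forall x, L n x @[n --> \oo] --> v x) -> (forall n x, `|L n x| <= M) ->
  (forall x, d 0%N x = L 0%N x) -> (forall n x, d n.+1 x = L n.+1 x - L n x) ->
  limn (series (fun k => \int[mu]_(x in A) d k x)) = \int[mu]_(x in A) v x.
Proof.
move=> mA fA mL Lv LM d0 dS; apply/cvg_lim => //; rewrite -cvg_shiftS.
have -> : [sequence series (fun k => \int[mu]_(x in A) d k x) n.+1]_n =
    (fun n => \int[mu]_(x in A) L n x).
  apply/funext => n /=; elim: n => [|n IH].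
    by rewrite seriesEnat /= big_nat1; apply: eq_Rintegral => x _.
  rewrite seriesEnat /= big_nat_recr//= -[X in X + _]/(series _ n.+1) IH.
  under [X in _ + X]eq_Rintegral do rewrite dS.
  rewrite RintegralB//; [|exact: (bounded_integrable mA fA (mL _) (LM _))..].
  by rewrite addrC subrK.
exact: (Rintegral_bounded_cvg mA fA mL Lv LM).
Qed.

Section cutoff.
Variable eta0 : R -> R[i].
Hypothesis ce : cutoff eta0.

Let K := fourier eta0.

Lemma cutoff_kernel_integrable : cintegrable K.
Proof. exact/schwartz_fourier_integrable/cutoff_schwartz. Qed.

Lemma symbol_kernel xi : symbol K xi = eta0 xi.
Proof. exact: cutoff_inversion. Qed.

(** With the dilation normalised to preserve the integral, the symbol is
    xi |-> eta0 (e * xi); see [symbol_dil_kernel]. *)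
Definition dil_kernel e (z : R) : R[i] := (e^-1)%:C * K (e^-1 * z).

Lemma dil_kernel_integrable e : 0 < e -> cintegrable (dil_kernel e).
Proof.
move=> e0; apply: cintegrableZ.
have e0' : 0 < e^-1 by rewrite invr_gt0.
have := cintegrable_affine 0 e0' cutoff_kernel_integrable.
by congr cintegrable; apply/funext => z; rewrite addr0.
Qed.

Lemma symbol_dil_kernel e xi : 0 < e -> symbol (dil_kernel e) xi = eta0 (e * xi).
Proof.
move=> e0; have e0' : 0 < e^-1 by rewrite invr_gt0.
rewrite -symbol_kernel /symbol.
have ii : cintegrable (fun z => K z * expi (2 * pi * z * (e * xi))).
  apply: (cintegrable_le _ (cintegrable_normc cutoff_kernel_integrable)).
    apply: cmeasM; first exact: cintegrable_cmeas cutoff_kernel_integrable.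
    exact: continuous_cmeas (ccontinuous_phase _ _).
  by move=> z; rewrite normcM normc_expi mulr1.
have := cint_affine 0 e0' ii; rewrite invrK => h.
transitivity ((e^-1)%:C * (e%:C * cint (fun z => K z * expi (2 * pi * z * (e * xi))))).
  rewrite -h -cintZ; last exact: (cintegrable_affine 0 e0' ii).
  apply: eq_cint => z; rewrite /dil_kernel addr0 mulrA; congr (_ * _ * expi _).
  by field; rewrite gt_eqF.
by rewrite mulrA -rmorphM/= mulVf ?gt_eqF// mul1r.
Qed.

(** The part of F at frequencies up to 1 / e.  Written as an average of F at
    scale e it makes sense at e = 0, where it is F itself; see [lowpass0]. *)
Definition lowpass F e (y : R) : R[i] := cint (fun z => F (y + e * z) * K z).

Section bounded_continuous.
Variables (F : R -> R[i]) (B : R).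
Hypotheses (cF : ccontinuous F) (FB : forall x, normc (F x) <= B).

Lemma lowpass_integrand_meas e y : cmeas (fun z : R => F (y + e * z) * K z).
Proof.
apply: cmeasM; last exact: cintegrable_cmeas cutoff_kernel_integrable.
apply: (@cmeas_comp _ _ _ _ _ F (fun z : R => y + e * z)).
  exact: continuous_cmeas.
by apply: measurable_funD => //; exact: measurable_funM.
Qed.

Lemma lowpass_integrand_integrable e y : cintegrable (fun z => F (y + e * z) * K z).
Proof.
apply: (cintegrable_le (lowpass_integrand_meas e y)
  (rintegrableZ B (cintegrable_normc cutoff_kernel_integrable))).
by move=> z; rewrite normcM ler_wpM2r ?normc_ge0.
Qed.

Definition kernel_mass := \int[mu]_z normc (K z).

Lemma kernel_mass_ge0 : 0 <= kernel_mass.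
Proof. by apply: Rintegral_ge0 => z _; exact: normc_ge0. Qed.

Lemma lowpass_bounded e y : normc (lowpass F e y) <= 2 * (B * kernel_mass).
Proof.
have nK := cintegrable_normc cutoff_kernel_integrable.
rewrite /kernel_mass -RintegralZl//; apply: normc_cint_le.
- exact: lowpass_integrand_meas.
- exact: rintegrableZ.
- by move=> z; rewrite normcM ler_wpM2r ?normc_ge0.
Qed.

Lemma filt_dil_kernel e y : 0 < e -> filt (dil_kernel e) F y = lowpass F e y.
Proof.
move=> e0; have e0' : 0 < e^-1 by rewrite invr_gt0.
have ii := lowpass_integrand_integrable e y.
have := cint_affine 0 e0' ii; rewrite invrK => h.
transitivity ((e^-1)%:C * (e%:C * lowpass F e y)).
  rewrite -h -cintZ; last exact: (cintegrable_affine 0 e0' ii).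
  apply: eq_cint => z; rewrite /dil_kernel addr0 mulrCA; congr (_ * (F _ * _)).
  by rewrite mulrA divff ?gt_eqF// mul1r.
by rewrite mulrA -rmorphM/= mulVf ?gt_eqF// mul1r.
Qed.

(** The kernel has integral eta0 0 = 1. *)
Lemma lowpass0 y : lowpass F 0 y = F y.
Proof.
rewrite /lowpass; under eq_fun do rewrite mul0r addr0.
rewrite cintZ; last exact: cutoff_kernel_integrable.
have -> : cint K = 1.
  have [_ _ h1] := ce; rewrite -(h1 0); last by rewrite normr0 mul1r invr_ge0.
  rewrite -symbol_kernel; apply: eq_cint => z.
  by rewrite mulr0 expi0 mulr1.
by rewrite mulr1.
Qed.

Lemma lowpass_continuous0 y :
  {for 0, continuous (re_fun (fun e => lowpass F e y))} /\
  {for 0, continuous (im_fun (fun e => lowpass F e y))}.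
Proof.
apply: (@cint_continuous_at _ (fun e z => F (y + e * z) * K z)
  (fun z => B * normc (K z)) 0).
- by move=> e; exact: lowpass_integrand_meas.
- move=> z; apply: ccontinuousM; last exact: ccontinuous_cst.
  apply: (ccontinuous_comp (u := fun e : R => y + e * z)) => // e.
  apply: cvgD; first exact: cvg_cst.
  by apply: cvgM; [exact: cvg_id|exact: cvg_cst].
- exact/rintegrableZ/cintegrable_normc/cutoff_kernel_integrable.
- by move=> e z _; rewrite normcM ler_wpM2r ?normc_ge0.
Qed.

Lemma cvg_dyadic : (fun n => 2 ^- n : R) @ \oo --> (0 : R).
Proof.
have h : `|2^-1 : R| < 1 by rewrite ger0_norm ?invr_ge0// invf_lt1// ltr1n.
rewrite (_ : (fun n => _) = GRing.exp (2^-1 : R)); first exact: cvg_expr.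
by apply/funext => n; rewrite exprVn.
Qed.

Lemma lowpass_cvg y :
  (complex.Re (lowpass F (2 ^- n) y) @[n --> \oo] --> complex.Re (F y)) /\
  (complex.Im (lowpass F (2 ^- n) y) @[n --> \oo] --> complex.Im (F y)).
Proof.
have [hr hi] := lowpass_continuous0 y.
rewrite -(lowpass0 y); split.
  exact: (cvg_comp _ _ cvg_dyadic hr).
exact: (cvg_comp _ _ cvg_dyadic hi).
Qed.

(** The kernel of the k-th Littlewood-Paley projection. *)
Definition band_kernel (k : nat) : R -> R[i] :=
  if k is k'.+1 then fun z => dil_kernel (2 ^- k'.+1) z - dil_kernel (2 ^- k') z
  else dil_kernel (2 ^- 0).

Lemma dyadic_gt0 k : 0 < 2 ^- k :> R.
Proof. by rewrite invr_gt0 exprn_gt0. Qed.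

Lemma band_kernel_integrable k : cintegrable (band_kernel k).
Proof.
case: k => [|k]; first exact: dil_kernel_integrable (dyadic_gt0 0).
have h1 := dil_kernel_integrable (dyadic_gt0 k.+1).
have h2 := cintegrableZ (-1) (dil_kernel_integrable (dyadic_gt0 k)).
have := cintegrableD h1 h2.
by congr cintegrable; apply/funext => z; rewrite mulN1r.
Qed.

Lemma symbol_band_kernel k : symbol (band_kernel k) = etak eta0 k.
Proof.
apply/funext => xi; case: k => [|k] /=.
  by rewrite symbol_dil_kernel ?dyadic_gt0// expr0 invr1 mul1r.
have phase (kk : R -> R[i]) : cintegrable kk ->
    cintegrable (fun z => kk z * expi (2 * pi * z * xi)).
  move=> ik; apply: (cintegrable_le _ (cintegrable_normc ik)).
    apply: cmeasM; first exact: cintegrable_cmeas.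
    exact: continuous_cmeas (ccontinuous_phase _ _).
  by move=> z; rewrite normcM normc_expi mulr1.
have e1 := dyadic_gt0 k.+1; have e2 := dyadic_gt0 k.
rewrite mulrC -(symbol_dil_kernel xi e1) [xi / _]mulrC -(symbol_dil_kernel xi e2).
rewrite /symbol -cintB; [|exact/phase/dil_kernel_integrable..].
by apply: eq_cint => z; rewrite mulrBl.
Qed.

Lemma filt_band_kernel k y : filt (band_kernel k) F y =
  if k is k'.+1 then lowpass F (2 ^- k'.+1) y - lowpass F (2 ^- k') y
  else lowpass F (2 ^- 0) y.
Proof.
case: k => [|k]; first by rewrite filt_dil_kernel ?dyadic_gt0.
have e1 := dyadic_gt0 k.+1; have e2 := dyadic_gt0 k.
rewrite -(filt_dil_kernel y e1) -(filt_dil_kernel y e2).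
rewrite /filt -cintB;
  [|exact: (filt_integrand_integrable cF FB _ (dil_kernel_integrable _))..].
by apply: eq_cint => z; rewrite mulrBr.
Qed.

Lemma filt_band_kernel_bounded k y :
  normc (filt (band_kernel k) F y) <= 4 * (B * kernel_mass).
Proof.
have h e := lowpass_bounded e y.
have m0 : 0 <= B * kernel_mass.
  by rewrite mulr_ge0 ?kernel_mass_ge0//; exact: bound_ge0 FB.
rewrite filt_band_kernel; case: k => [|k].
  by apply: (le_trans (h _)); rewrite ler_wpM2r// ler_nat.
apply: (le_trans (normc_sub _ _)); apply: (le_trans (lerD (h _) (h _))); lra.
Qed.

Section functional.
(* T is to be the distribution of a function equal to F almost everywhere. *)
Variable T : schwartz_functional R.
Hypothesis TF : forall psi, ccontinuous psi -> T psi = distr_of F psi.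

(** The filtered function has the Fourier side prescribed by eta0, and a
    continuous function of polynomial growth is determined by it. *)
Lemma Delta_filt k : Delta eta0 k T = filt (band_kernel k) F.
Proof.
have ik := band_kernel_integrable k.
have D : is_Delta eta0 k T (filt (band_kernel k) F).
  split.
  - exact: (filt_continuous cF FB).
  - exact: (bounded_poly_growth (filt_band_kernel_bounded k)).
  - move=> phi sphi; rewrite /fourierD /mulD.
    have iphi := schwartz_integrable sphi.
    rewrite (filt_dual cF FB ik iphi (schwartz_fourier_integrable sphi)).
    rewrite symbol_band_kernel TF//; apply: fourier_continuous.
    by rewrite -symbol_band_kernel; exact: symbol_mul_integrable.
have [c p q] := xgetPex (cst 0) (ex_intro _ _ D).
have [c' p' q'] := D.
by apply: eq_of_fourier_dual => // phi sphi; rewrite q// q'.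
Qed.

(** The integral of |phi| is bounded by the seminorms of phi with weights 1 and
    x^2. *)
Lemma tempered_bounded : tempered T.
Proof.
have B0 := bound_ge0 FB.
have iF phi : ccontinuous phi -> cintegrable phi -> cintegrable (fun x => F x * phi x).
  move=> cphi iphi; apply: (cintegrable_le _ (rintegrableZ B (cintegrable_normc iphi))).
    by apply: cmeasM; exact: continuous_cmeas.
  by move=> x; rewrite normcM ler_wpM2r ?normc_ge0.
split.
  move=> a phi psi sphi spsi.
  have cphi := schwartz_continuous sphi; have cpsi := schwartz_continuous spsi.
  have iphi := schwartz_integrable sphi; have ipsi := schwartz_integrable spsi.
  rewrite !TF//; last first.
    have -> : (fun x => a * phi x + psi x) = (fun x => a * phi x - (-1) * psi x).
      by apply/funext => x; rewrite mulN1r opprK.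
    by apply: ccontinuousB; apply: ccontinuousM => //; exact: ccontinuous_cst.
  rewrite /distr_of -!/(cint _) -cintZ; last exact: iF.
  rewrite -cintD; [|exact/cintegrableZ/iF|exact: iF].
  by apply: eq_cint => x; ring.
exists (4 * B * \int[mu]_x decay x), 2%N => phi M sphi hM.
rewrite TF; last exact: schwartz_continuous.
have phiE x : cderiv 0 phi x = phi x by exact: complex_ext.
have hphi x : normc (phi x) <= (M + M) * decay x.
  apply: le_decay.
    by have := hM 0%N 0%N isT isT x; rewrite expr0 mul1r phiE.
  by have := hM 2%N 0%N isT isT x; rewrite phiE.
have ih := rintegrableZ (B * (M + M)) (@rintegrable_decay R).
have := @normc_cint_le _ (fun x => F x * phi x) _ _ ih.
move=> /(_ _ _)/le_trans; apply.
- by apply: cmeasM; apply: continuous_cmeas => //; exact: schwartz_continuous.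
- by move=> x; rewrite normcM -mulrA ler_pM ?normc_ge0.
rewrite RintegralZl//; last exact: rintegrable_decay.
by set J := \int[mu]_x _; rewrite le_eqVlt; apply/orP; left; apply/eqP; ring.
Qed.

(** The pieces are bounded uniformly in k, so the weights 2^-k sum to a finite
    norm. *)
Lemma besov_norm_bounded : (besov_norm eta0 T < +oo)%E.
Proof.
set M := 4 * (B * kernel_mass).
have M0 : 0 <= M by rewrite !mulr_ge0 ?kernel_mass_ge0//; exact: bound_ge0 FB.
have M20 : 0 <= 2 * M by rewrite mulr_ge0.
apply: (@le_lt_trans _ _ (2 * M)%:E); last exact: ltry.
apply: (le_trans _ (epsilon_trick0 xpredT M20)).
apply: lee_nneseries => [k _ _|k _].
  by rewrite mule_ge0// ?lee_fin ?(ltW (dyadic_gt0 _))// Lnorm_ge0.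
apply: (@le_trans _ _ ((2 ^- k)%:E * M%:E)%E).
  rewrite lee_wpmul2l ?lee_fin ?(ltW (dyadic_gt0 _))//.
  rewrite /cLnorm unlock; case: ifPn => _; last by rewrite lee_fin.
  apply/ess_supP; apply: nearW => x /=; rewrite lee_fin.
  by rewrite ger0_norm ?normc_ge0// Delta_filt; exact: filt_band_kernel_bounded.
rewrite -EFinM lee_fin natrX exprS invfM mulrACA mulrC.
by rewrite divff ?mul1r// pnatr_eq0.
Qed.

(** The partial sums of the Littlewood-Paley pieces are the low-pass parts at
    scales 2^-n, which are uniformly bounded and tend to F pointwise. *)
Lemma pair_indicE (a b : R) :
  pair_indic eta0 T `[a, b[ = cintegral [set` `[a, b[] F.
Proof.
set A := [set` `[a, b[].
have mA : measurable A by exact: measurable_itv.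
have fA : (mu A < +oo)%E by rewrite lebesgue_measure_itv; case: ifPn => _; rewrite -?EFinD ltry.
have cl n : cmeas (lowpass F (2 ^- n)).
  have -> : lowpass F (2 ^- n) = filt (dil_kernel (2 ^- n)) F.
    by apply/funext => y; rewrite filt_dil_kernel ?dyadic_gt0.
  exact/continuous_cmeas/(filt_continuous cF FB)/dil_kernel_integrable/dyadic_gt0.
rewrite /pair_indic; apply: complex_ext.
  apply: (@limn_series_Rintegral A _ (fun n x => complex.Re (lowpass F (2 ^- n) x))
    (re_fun F) (2 * (B * kernel_mass)) mA fA).
  - by move=> n; exact: (cl n).1.
  - by move=> x; exact: (lowpass_cvg x).1.
  - by move=> n x; exact: le_trans (normr_Re_le _) (lowpass_bounded _ _).
  - by move=> x; rewrite /re_fun Delta_filt filt_band_kernel.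
  - by move=> n x; rewrite /re_fun Delta_filt filt_band_kernel Re_add Re_opp.
apply: (@limn_series_Rintegral A _ (fun n x => complex.Im (lowpass F (2 ^- n) x))
  (im_fun F) (2 * (B * kernel_mass)) mA fA).
- by move=> n; exact: (cl n).2.
- by move=> x; exact: (lowpass_cvg x).2.
- by move=> n x; exact: le_trans (normr_Im_le _) (lowpass_bounded _ _).
- by move=> x; rewrite /im_fun Delta_filt filt_band_kernel.
- by move=> n x; rewrite /im_fun Delta_filt filt_band_kernel Im_add Im_opp.
Qed.

End functional.

End bounded_continuous.

End cutoff.

End LittlewoodPaley.

(** * Local integrability and Lebesgue points *)

Section LocallyIntegrable.
Context {R : realType}.
Notation mu := (@lebesgue_measure R).
Implicit Types u v w : R -> R.

Definition locint u := locally_integrable [set: R] u.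

Lemma locint_meas u : locint u -> measurable_fun setT u.
Proof. by case. Qed.

Lemma locint_itv u (a b : R) : locint u -> mu.-integrable `[a, b] (EFin \o u).
Proof.
move=> [mu_ _ iu]; apply/integrableP; split.
  by apply/measurable_EFinP; exact: (measurable_funS measurableT (@subsetT _ _) mu_).
by apply: iu => //; exact: segment_compact.
Qed.

Lemma locint_restrict u (a b : R) : locint u -> rintegrable (u \_ `[a, b]).
Proof.
move=> lu; have mI : measurable (`[a, b]%classic : set (measurableTypeR R)).
  exact: measurable_itv.
have := (@integrable_mkcond _ (measurableTypeR R) R mu _ (EFin \o u) mI).1 (locint_itv a b lu).
by rewrite restrict_EFin.
Qed.

Lemma locint_mul u w (r M : R) : locint u -> measurable_fun setT w ->
  (forall x, `|w x| <= M) -> (forall x, r < `|x| -> w x = 0) ->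
  rintegrable (fun x => u x * w x).
Proof.
move=> lu mw wM w0.
apply: (rintegrable_le _ (rintegrableZ M (rintegrable_norm (locint_restrict (- r) r lu)))).
  by apply: measurable_funM => //; exact: locint_meas.
move=> x; rewrite patchE; case: ifPn => [_|xr].
  by rewrite normrM mulrC ler_wpM2r.
rewrite w0 ?mulr0 ?normr0 ?mulr0//.
by move: xr; rewrite notin_setE /= in_itv/= -ler_norml => /negP; rewrite -ltNge.
Qed.

Lemma locint_addcst u (c : R) : locint u -> locint (fun x => u x - c).
Proof.
move=> lu; apply: (@locally_integrableB R setT u (cst c)) => //.
split=> [//| |K _ cK]; first exact: openT.
rewrite /= integral_cst//; last exact: compact_measurable.
by rewrite lte_mul_pinfty// compact_finite_measure.
Qed.

Definition width n : R := n.+1%:R^-1.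

Lemma width_gt0 n : 0 < width n. Proof. by rewrite invr_gt0. Qed.

Lemma width_le1 n : width n <= 1.
Proof. by rewrite invf_le1// ler1n. Qed.

Lemma cvg_width : width @ \oo --> (0 : R).
Proof. exact: cvg_harmonic. Qed.

(** At a Lebesgue point, dilates of a bounded compactly supported kernel w act as
    a multiple of an approximate identity: the error is at most a constant times
    the mean oscillation of u around a.  No continuity of w is needed, which
    allows one-sided kernels. *)
Lemma lebesgue_pt_kernel u a w (D : R) : locint u -> lebesgue_pt u a ->
  measurable_fun setT w -> (forall t, `|w t| <= D) ->
  (forall t, 1 < `|t| -> w t = 0) ->
  \int[mu]_x (u x * ((width n)^-1 * w ((x - a) / width n))) @[n --> \oo] -->
  u a * \int[mu]_x w x.
Proof.
move=> lu pa mw wD w0.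
have D0 : 0 <= D by apply: le_trans (wD 0).
pose we n x := (width n)^-1 * w ((x - a) / width n).
have iw : rintegrable w.
  have l1 : locint (cst (1 : R)).
    split=> [//| |K _ cK]; first exact: openT.
    rewrite /= integral_cst//; last exact: compact_measurable.
    by rewrite lte_mul_pinfty// compact_finite_measure.
  by have := locint_mul l1 mw wD w0; under [fun x => _ * _]eq_fun do rewrite mul1r.
have e0 n : 0 < (width n)^-1 by rewrite invr_gt0 width_gt0.
have weE n x : we n x = (width n)^-1 * w ((width n)^-1 * x + - a / width n).
  by rewrite /we mulrBl mulrC [X in w (X - _)]mulrC mulNr mulrC.
have iwe n : rintegrable (we n).
  have [i1 _] := rintegrable_affine (- a / width n) (e0 n) iw.
  have := rintegrableZ (width n)^-1 i1.
  by congr rintegrable; apply/funext => x; rewrite weE.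
have Iwe n : \int[mu]_x we n x = \int[mu]_x w x.
  have [i1 E] := rintegrable_affine (- a / width n) (e0 n) iw.
  under eq_Rintegral do rewrite weE.
  by rewrite RintegralZl// E mulrA mulfV ?mul1r// gt_eqF.
have wesupp n x : ~ ball a (2 * width n) x -> we n x = 0.
  rewrite /we => nb; rewrite w0 ?mulr0//.
  rewrite normrM normfV (gtr0_norm (width_gt0 n)) ltr_pdivlMr ?width_gt0// mul1r.
  move/negP: nb; rewrite /ball/= -leNgt distrC; apply: lt_le_trans.
  by have := width_gt0 n; lra.
have mwe n : measurable_fun setT (we n) by exact: rintegrable_meas.
have iuwe n v : locint v -> rintegrable (fun x => v x * we n x).
  move=> lv; apply: (@locint_mul v (we n) (`|a| + 2 * width n) ((width n)^-1 * D)) => //.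
    by move=> x; rewrite /we normrM gtr0_norm// ler_wpM2l// ltW.
  move=> x hx; apply: wesupp; rewrite /ball/= => hb.
  have := ler_normB (a) (a - x); rewrite opprB addrC subrK => h; lra.
have lua := locint_addcst (u a) lu.
(* Since the kernels we n have the same mass, only the oscillation of u around a
   has to tend to 0. *)
pose c n := \int[mu]_x ((u x - u a) * we n x).
have split n : \int[mu]_x (u x * we n x) = c n + u a * \int[mu]_x w x.
  have -> : u a * \int[mu]_x w x = \int[mu]_x (u a * we n x).
    by rewrite RintegralZl ?Iwe//; exact: iwe.
  rewrite /c -RintegralD//; last exact: (rintegrableZ (u a) (iwe n)).
    by apply: eq_Rintegral => x _; ring.
  exact: (iuwe n _ lua).
have c0 : c n @[n --> \oo] --> (0 : R).
  have davg0 : davg u a (2 * width n) @[n --> \oo] --> 0%E.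
    have h : (fun n => 2 * width n) @ \oo --> (2 * 0 : R).
      by apply: cvgM; [exact: cvg_cst|exact: cvg_width].
    rewrite mulr0 in h.
    move=> A /pa [d /= d0 hd].
    have : \forall n \near \oo, 2 * width n < d by exact: (cvgr_lt _ h _ d0).
    apply: filterS => n hn; apply: (hd (2 * width n)).
      rewrite /ball_/= sub0r normrN gtr0_norm ?mulr_gt0 ?width_gt0//.
    by rewrite mulr_gt0 ?width_gt0.
  (* The ball of radius 2 * width n contains the support and has measure
     4 * width n, while |we n| <= D / width n. *)
  have bd n : (`|c n|%:E <= (4 * D)%:E * davg u a (2 * width n))%E.
    have mb : measurable (ball a (2 * width n)) by exact: measurable_ball.
    have mua : measurable_fun setT (fun x => u x - u a) by exact: locint_meas.
    have ip := iuwe n _ lua.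
    rewrite EFin_normr_Rintegral//.
    apply: (le_trans (le_abse_integral _ _ _)) => //; first exact: (measurable_int mu ip).
    apply: (@le_trans _ _ (\int[mu]_(x in ball a (2 * width n))
        ((D / width n)%:E * `|u x - u a|%:E))%E).
      rewrite [leRHS]integral_mkcond; apply: ge0_le_integral => //.
      - by apply: measurableT_comp => //; exact: (measurable_int mu ip).
      - apply/(measurable_restrictT _ _).1 => //.
        apply: (measurable_funS measurableT (@subsetT _ _)).
        apply/measurable_EFinP; apply: measurable_funM => //.
        exact: measurableT_comp.
      move=> x _; rewrite patchE; case: ifPn => xb.
        rewrite /= -EFinM lee_fin normrM mulrC ler_wpM2r//.
        by rewrite /we normrM gtr0_norm// mulrC ler_wpM2r// ltW.
      by rewrite /= wesupp ?mulr0 ?normr0//; move: xb; rewrite notin_setE.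
    rewrite ge0_integralZl//.
    - rewrite /davg /iavg lebesgue_measure_ball ?mulr_ge0 ?(ltW (width_gt0 n))//.
      rewrite inver mulrn_eq0/= mulf_eq0 pnatr_eq0/= (gt_eqF (width_gt0 n)).
      rewrite muleA -EFinM (_ : 4 * D * (2 * width n *+ 2)^-1 = D / width n)//.
      by field; rewrite gt_eqF// width_gt0.
    - apply: (measurable_funS measurableT (@subsetT _ _)).
      by apply/measurable_EFinP; exact: measurableT_comp.
    - by rewrite lee_fin divr_ge0// ltW// width_gt0.
  have lim : (fun n => (4 * D)%:E * davg u a (2 * width n))%E @ \oo --> 0%E.
    by rewrite -[X in _ --> X](mule0 (4 * D)%:E); apply: cvgeZl.
  apply/norm_cvg0P; apply: (@fine_cvg _ _ _ _ (fun n => `|c n|%:E)).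
  apply: (squeeze_cvge _ (cvg_cst _) lim).
  by near=> n; rewrite bd lee_fin normr_ge0.
rewrite (_ : (fun n => _) = (fun n => c n + u a * \int[mu]_x w x)).
  by rewrite -[X in _ --> X]add0r; apply: cvgD; [exact: c0|exact: cvg_cst].
by apply/funext => n; rewrite -split.
Unshelve. all: by end_near. Qed.

Lemma Rintegral_dominated_cvg (q : nat -> R -> R) (q0 h : R -> R) :
  (forall n, measurable_fun setT (q n)) -> (forall x, q n x @[n --> \oo] --> q0 x) ->
  rintegrable h -> (forall n x, `|q n x| <= h x) ->
  \int[mu]_x q n x @[n --> \oo] --> \int[mu]_x q0 x.
Proof.
move=> mq qq0 ih qh.
have mq0 : measurable_fun setT q0.
  by apply: (@measurable_fun_cvg _ _ _ setT q q0) => // x _; exact: qq0.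
have [] := @dominated_convergence _ _ R mu setT measurableT (fun n x => (q n x)%:E)
  (EFin \o q0) (EFin \o h).
- by move=> n; apply/measurable_EFinP; exact: mq.
- exact/measurable_EFinP.
- by apply: nearW => x _; apply: cvg_EFin; [near=> n|exact: qq0].
- exact: ih.
- by apply: nearW => x n _; rewrite /= lee_fin.
move=> iq0 _ cq; apply: fine_cvg; rewrite fineK//.
exact: integrable_fin_num.
Unshelve. all: by end_near. Qed.

End LocallyIntegrable.

(** * Smooth trapezoidal test functions *)

Section Trapezoid.
Context {R : realType}.
Notation mu := (@lebesgue_measure R).
Variable eta : R -> R.
Hypotheses (seta : rsmooth eta)
  (eta1 : forall t, `|t| <= 1 / 2 -> eta t = 1)
  (eta0 : forall t, 3 / 4 < `|t| -> eta t = 0).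

Let eta' := (eta^`(1))%classic.

Lemma bump_derive_out t : 3 / 4 < `|t| -> eta' t = 0.
Proof.
move=> ht.
have z : \forall y \near t, eta y = cst 0 y.
  have nx : (`|y| : R) @[y --> t] --> (`|t| : R) by exact: norm_continuous.
  have h : \forall y \near t, 3 / 4 < `|y| by exact: (cvgr_gt _ nx _ ht).
  by apply: filterS h => y hy; rewrite eta0.
by rewrite /eta'; have /nbhs_singleton -> := near_eq_derive1n 1 z; rewrite derive1n_cst.
Qed.

(** The derivative of the bump, cut at 0.  The rising half has mass 1 and the
    falling half has mass -1. *)
Definition rise := eta' \_ `[-1, 0].
Definition fall := eta' \_ `[0, 1].

Lemma Rintegral_bump_derive (c d : R) : c < d ->
  \int[mu]_(x in `[c, d]) eta' x = eta d - eta c.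
Proof.
move=> cd; rewrite /Rintegral (@continuous_FTC2 _ eta' eta)//.
- by apply: continuous_subspaceT; exact: (rsmooth_continuous (n := 1) seta).
- have ceta : continuous eta by exact: (rsmooth_continuous (n := 0) seta).
  have deta y : derivable eta y 1 by exact: (@ex_derive _ _ _ _ _ _ _ (rsmooth_is_derive 0 y seta)).
  split; [by move=> x _; exact: deta|exact/cvg_at_right_filter/ceta|
    exact/cvg_at_left_filter/ceta].
Qed.

Lemma Rintegral_rise : \int[mu]_x rise x = 1.
Proof.
rewrite -Rintegral_mkcond Rintegral_bump_derive ?ltrN10// eta1 ?eta0 ?subr0//.
  by rewrite normrN normr1; lra.
by rewrite normr0; lra.
Qed.

Lemma Rintegral_fall : \int[mu]_x fall x = -1.
Proof.
rewrite -Rintegral_mkcond Rintegral_bump_derive ?ltr01// eta0 ?eta1 ?sub0r//.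
  by rewrite normr0; lra.
by rewrite normr1; lra.
Qed.

Section shape.
Variables (a b e : R).
Hypotheses (ab : a < b) (e0 : 0 < e) (eab : e < b - a).

(** A smooth version of the indicator function of [a, b]: the left half of the
    bump dilated by e, then the constant 1, then the right half of the bump. *)
Definition trapezoid (x : R) : R :=
  if x <= a then eta ((x - a) / e) else if x < b then 1 else eta ((x - b) / e).

Lemma trapezoid_left (x : R) : x < a + e / 2 -> trapezoid x = eta (e^-1 * x + - a / e).
Proof.
have [ab' e0' eab'] := And3 ab e0 eab.
move=> xa; rewrite (_ : e^-1 * x + - a / e = (x - a) / e); last by rewrite mulrBl mulrC mulNr.
rewrite /trapezoid; have [//|ax] := leP x a.
have -> : x < b by lra.
rewrite eta1// ger0_norm; last by rewrite divr_ge0//; lra.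
by rewrite ler_pdivrMr//; lra.
Qed.

Lemma trapezoid_right (x : R) : b - e / 2 < x -> trapezoid x = eta (e^-1 * x + - b / e).
Proof.
have [ab' e0' eab'] := And3 ab e0 eab.
move=> bx; rewrite (_ : e^-1 * x + - b / e = (x - b) / e); last by rewrite mulrBl mulrC mulNr.
rewrite /trapezoid ifF; last by apply/negbTE; rewrite -ltNge; lra.
case: ltP => // xb; rewrite eta1// normrM ltr0_norm ?normfV ?(gtr0_norm e0); last by lra.
by rewrite ler_pdivrMr//; lra.
Qed.

Lemma trapezoid_mid (x : R) : a < x -> x < b -> trapezoid x = 1.
Proof. by move=> ax xb; rewrite /trapezoid leNgt ax/= xb. Qed.

Lemma trapezoid_near_left x : x <= a ->
  \forall y \near x, trapezoid y = (fun y => eta (e^-1 * y + - a / e)) y.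
Proof.
have [ab' e0' eab'] := And3 ab e0 eab.
move=> xa; have : x < a + e / 2 by lra.
by move=> /lt_nbhsl; apply: filterS => y; exact: trapezoid_left.
Qed.

Lemma trapezoid_near_right x : b <= x ->
  \forall y \near x, trapezoid y = (fun y => eta (e^-1 * y + - b / e)) y.
Proof.
have [ab' e0' eab'] := And3 ab e0 eab.
move=> xb; have : b - e / 2 < x by lra.
by move=> /lt_nbhsr; apply: filterS => y; exact: trapezoid_right.
Qed.

Lemma trapezoid_near_mid x : a < x -> x < b ->
  \forall y \near x, trapezoid y = (cst 1 : R -> R) y.
Proof.
move=> ax xb; near=> y; apply: trapezoid_mid; near: y.
  exact: lt_nbhsr.
exact: lt_nbhsl.
Unshelve. all: by end_near. Qed.

Lemma rsmooth_trapezoid : rsmooth trapezoid.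
Proof.
apply: rsmooth_local => x; have [xa|ax] := leP x a.
  exists (fun y => eta (e^-1 * y + - a / e)); first exact: rsmooth_affine.
  exact: trapezoid_near_left.
have [xb|bx] := ltP x b.
  exists (cst 1); first exact: rsmooth_cst.
  exact: trapezoid_near_mid.
exists (fun y => eta (e^-1 * y + - b / e)); first exact: rsmooth_affine.
exact: trapezoid_near_right.
Qed.

(** A one-sided approximate identity at a minus one at b. *)
Lemma derive_trapezoid x : (trapezoid^`(1))%classic x =
  e^-1 * rise ((x - a) / e) + e^-1 * fall ((x - b) / e).
Proof.
have [ab' e0' eab'] := And3 ab e0 eab.
have ae y c : e^-1 * y + - c / e = (y - c) / e by rewrite mulrBl mulrC mulNr.
have [xa|ax] := leP x a.
  have /nbhs_singleton -> := near_eq_derive1n 1 (trapezoid_near_left xa).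
  rewrite derive1n_affine// expr1 ae -/eta'.
  rewrite [X in _ + _ * X](_ : fall _ = 0) ?mulr0 ?addr0; last first.
    rewrite /fall patchE ifF//; apply/negbTE/negP; rewrite inE/= in_itv/= => /andP[h _].
    by move: h; rewrite ler_pdivlMr// mul0r; lra.
  congr (_ * _); rewrite /rise patchE; case: ifPn => //; rewrite notin_setE/= in_itv/=.
  have h0 : (x - a) / e <= 0 by rewrite ler_pdivrMr// mul0r; lra.
  rewrite h0 andbT => /negP; rewrite -ltNge => h1; apply: bump_derive_out.
  by rewrite ler0_norm//; lra.
have hx : 0 < (x - a) / e by rewrite divr_gt0//; lra.
rewrite [X in _ * X + _](_ : rise _ = 0) ?mulr0 ?add0r; last first.
  rewrite /rise patchE ifF//; apply/negbTE/negP; rewrite inE/= in_itv/= => /andP[_].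
  by rewrite leNgt hx.
have [xb|bx] := ltP x b.
  have /nbhs_singleton -> := near_eq_derive1n 1 (trapezoid_near_mid ax xb).
  rewrite derive1n_cst/= (_ : fall _ = 0) ?mulr0//.
  rewrite /fall patchE ifF//; apply/negbTE/negP; rewrite inE/= in_itv/= => /andP[h _].
  by move: h; rewrite ler_pdivlMr// mul0r; lra.
have /nbhs_singleton -> := near_eq_derive1n 1 (trapezoid_near_right bx).
rewrite derive1n_affine// expr1 ae -/eta'.
congr (_ * _); rewrite /fall patchE; case: ifPn => //; rewrite notin_setE/= in_itv/=.
have h0 : 0 <= (x - b) / e by apply: divr_ge0; lra.
rewrite h0 /= => /negP; rewrite -ltNge => h1; apply: bump_derive_out.
by rewrite ger0_norm//; lra.
Qed.

Lemma trapezoid_out x : e <= 1 -> `|a| + `|b| + 1 < `|x| -> trapezoid x = 0.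
Proof.
have [ab' e0'] := conj ab e0.
move=> e1 hx; have [x0|x0] := leP 0 x.
  move: hx; rewrite (ger0_norm x0) => hx.
  have bx : b + 1 < x by have := ler_norm b; have := normr_ge0 a; lra.
  rewrite /trapezoid ifF; last by apply/negbTE; rewrite -ltNge; lra.
  rewrite ifF; last by apply/negbTE; rewrite -leNgt; lra.
  rewrite eta0// ger0_norm; last by rewrite divr_ge0// ?ltW//; lra.
  by rewrite ltr_pdivlMr//; lra.
move: hx; rewrite (ltr0_norm x0) => hx.
have xa : x < a - 1.
  by have := ler_norm (- a); rewrite normrN; have := normr_ge0 b; lra.
rewrite /trapezoid ifT; last by lra.
rewrite eta0// ltr0_norm; last by rewrite pmulr_llt0 ?invr_gt0//; lra.
by rewrite -mulNr ltr_pdivlMr//; lra.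
Qed.

End shape.

End Trapezoid.

(** * Weak derivatives and continuous primitives *)

Section WeakDerivative.
Context {R : realType}.
Notation mu := (@lebesgue_measure R).
Implicit Types u v : R -> R.

(** Testing only with real functions reduces the weak derivative to the real and
    imaginary parts; the support condition is stated with an explicit radius. *)
Definition rweak u v := forall rho r, rsmooth rho ->
  (forall x, r < `|x| -> rho x = 0) ->
  \int[mu]_x (u x * (rho^`(1))%classic x) = - \int[mu]_x (v x * rho x).

Lemma test_function_real (rho : R -> R) (r : R) : rsmooth rho ->
  (forall x, r < `|x| -> rho x = 0) -> test_function (fun x => (rho x)%:C).
Proof.
move=> srho rho0; split=> [n x|].
  split; first exact: (srho n x).
  exact: (@rsmooth_cst R 0 n x).
apply: (@subclosed_compact _ _ `[- r, r]).
- exact: closed_closure.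
- exact: segment_compact.
have : [set x | (rho x)%:C != 0] `<=` [set` `[- r, r]].
  move=> x /=; rewrite in_itv/= -ler_norml leNgt; apply: contra => /rho0 ->.
  by [].
have cI : closed [set` `[- r, r]] by apply: compact_closed => //; exact: segment_compact.
by move=> /closure_subset; rewrite -((closure_id _).1 cI).
Qed.

Lemma cderiv_real (rho : R -> R) x :
  cderiv 1 (fun x => (rho x)%:C) x = ((rho^`(1))%classic x)%:C.
Proof.
by apply: complex_ext => //; rewrite -[LHS]/((cst (0 : R))^`(1)%classic x) derive1n_cst.
Qed.

Lemma weak_derivative_real (f g : R -> R[i]) : weak_derivative f g ->
  rweak (re_fun f) (re_fun g) /\ rweak (im_fun f) (im_fun g).
Proof.
move=> [_ fg]; split=> rho r srho rho0.
  have := fg _ (test_function_real srho rho0) => /(congr1 (@complex.Re R)).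
  rewrite Re_opp /cintegral /= => h.
  transitivity (\int[mu]_x re_fun (fun x => f x * cderiv 1 (fun x => (rho x)%:C) x) x).
    apply: eq_Rintegral => x _; rewrite {2}/re_fun cderiv_real Re_mul.
    by rewrite /= mulr0 subr0.
  rewrite h; congr (- _); apply: eq_Rintegral => x _.
  by rewrite {1}/re_fun Re_mul /= mulr0 subr0.
have := fg _ (test_function_real srho rho0) => /(congr1 (@complex.Im R)).
rewrite Im_opp /cintegral /= => h.
transitivity (\int[mu]_x im_fun (fun x => f x * cderiv 1 (fun x => (rho x)%:C) x) x).
  apply: eq_Rintegral => x _; rewrite {2}/im_fun cderiv_real Im_mul.
  by rewrite /= mulr0 add0r.
rewrite h; congr (- _); apply: eq_Rintegral => x _.
by rewrite {1}/im_fun Im_mul /= mulr0 add0r.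
Qed.

End WeakDerivative.

Section WeakIncrement.
Context {R : realType}.
Notation mu := (@lebesgue_measure R).
Implicit Types u v : R -> R.

Section bump.
Variable eta : R -> R.
Hypotheses (seta : rsmooth eta)
  (eta1 : forall t, `|t| <= 1 / 2 -> eta t = 1)
  (eta0 : forall t, 3 / 4 < `|t| -> eta t = 0).

Lemma bump_bounded n : exists D, forall t, `|(eta^`(n))%classic t| <= D.
Proof.
have /rschwartz_decay : rschwartz eta by exact: (rschwartz_compact seta eta0).
move=> /(_ n) [D D0 hD]; exists D => t; apply: (le_trans (hD t)).
by rewrite ler_piMr// oneDsqrV_le1.
Qed.

(** The limit is the indicator function of the closed interval because the bump
    is 1 at 0. *)
Lemma cvg_trapezoid (a b x : R) : a < b ->
  trapezoid eta a b (width n) x @[n --> \oo] --> ((\1_`[a, b] x) : R).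
Proof.
move=> ab; apply: cvg_near_cst.
have smal d : 0 < d -> \forall n \near \oo, width n < d :> R.
  by move=> d0; exact: (cvgr_lt _ cvg_width _ d0).
rewrite indicE; have [xa|ax] := ltP x a.
  rewrite memNset; last by rewrite /= in_itv/= leNgt xa.
  have := smal (a - x); rewrite subr_gt0 => /(_ xa); apply: filterS => n hn.
  have w0 := @width_gt0 R n.
  rewrite /trapezoid ltW// eta0// ltr0_norm; last first.
    by rewrite pmulr_llt0 ?invr_gt0//; lra.
  by rewrite -mulNr ltr_pdivlMr//; lra.
have [bx|xb] := ltP b x.
  rewrite memNset; last by rewrite /= in_itv/= ax leNgt bx.
  have := smal (x - b); rewrite subr_gt0 => /(_ bx); apply: filterS => n hn.
  have w0 := @width_gt0 R n.
  rewrite /trapezoid leNgt (lt_trans ab bx)/= ltNge (ltW bx)/= eta0// gtr0_norm; last first.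
    by rewrite divr_gt0//; lra.
  by rewrite ltr_pdivlMr//; lra.
rewrite mem_set; last by rewrite /= in_itv/= ax xb.
apply: nearW => n; rewrite /trapezoid.
have [xa|ax'] := leP x a.
  have -> : x = a by apply/eqP; rewrite eq_le xa ax.
  by rewrite subrr mul0r eta1// normr0 mul1r invr_ge0.
have [//|bx] := ltP x b.
have -> : x = b by apply/eqP; rewrite eq_le xb bx.
by rewrite subrr mul0r eta1// normr0 mul1r invr_ge0.
Qed.

Lemma measurable_trapezoid (a b e : R) : measurable_fun setT (trapezoid eta a b e).
Proof.
have me c : measurable_fun setT (fun x : R => eta ((x - c) / e)).
  apply: continuous_measurable_fun => x.
  apply: (@continuous_comp _ _ _ (fun x : R => (x - c) / e) eta).
    by apply: cvgM; [apply: cvgB; [exact: cvg_id|exact: cvg_cst]|exact: cvg_cst].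
  exact: (rsmooth_continuous (n := 0) seta).
apply: measurable_fun_ifT => //; first exact: measurable_fun_ler.
by apply: measurable_fun_ifT => //; exact: measurable_fun_ltr.
Qed.

(** Test with trapezoids of width tending to 0.  The pairing of u with the
    derivative tends to u a - u b because a and b are Lebesgue points, and the
    pairing of v with the trapezoid tends to the integral of v over [a, b]. *)
Lemma weak_increment u v a b : locint u -> locint v -> rweak u v ->
  lebesgue_pt u a -> lebesgue_pt u b -> a < b ->
  u b - u a = \int[mu]_(x in `[a, b]) v x.
Proof.
move=> lu lv uv pa pb ab.
have [D0 hD0] := bump_bounded 0; have [D1 hD1] := bump_bounded 1.
have D10 : 0 <= D1 by apply: le_trans (hD1 0).
have mI (c d : R) : measurable (`[c, d]%classic : set R) by exact: measurable_itv.
have meta' : measurable_fun setT (eta^`(1))%classic.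
  by apply: continuous_measurable_fun; exact: (rsmooth_continuous (n := 1) seta).
have part (c d : R) : -1 <= c -> d <= 1 ->
  [/\ measurable_fun setT ((eta^`(1))%classic \_ `[c, d]),
    (forall t, `|((eta^`(1))%classic \_ `[c, d]) t| <= D1) &
    (forall t, 1 < `|t| -> ((eta^`(1))%classic \_ `[c, d]) t = 0)].
  move=> hc hd; split.
  - apply/(measurable_restrictT _ _).1 => //.
    by apply: (measurable_funS measurableT _ meta').
  - by move=> t; rewrite patchE; case: ifPn => _; [exact: hD1|rewrite normr0].
  - move=> t ht; rewrite patchE ifF//; apply/negbTE/negP; rewrite inE/= in_itv/= => /andP[h1 h2].
    by move: ht; rewrite ltNge ler_norml => /negP; apply; apply/andP; split; lra.
have [mr br zr] := part (-1) 0 (lexx _) ler01.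
have [mf bf zf] := part 0 1 (lerN10 _) (lexx _).
have A := lebesgue_pt_kernel lu pa mr br zr; have B := lebesgue_pt_kernel lu pb mf bf zf.
rewrite (Rintegral_rise seta eta1 eta0) mulr1 in A.
rewrite (Rintegral_fall seta eta1 eta0) mulrN1 in B.
have C : \int[mu]_x (v x * trapezoid eta a b (width n) x) @[n --> \oo] -->
    \int[mu]_x (v x * \1_`[a, b] x).
  have D0' : 0 <= D0 + 1 by rewrite addr_ge0//; apply: le_trans (hD0 0).
  pose r := `|a| + `|b| + 1.
  have ih := rintegrableZ (D0 + 1) (rintegrable_norm (locint_restrict (- r) r lv)).
  apply: (Rintegral_dominated_cvg _ _ ih) => [n|x|n x].
  - by apply: measurable_funM; [exact: locint_meas|exact: measurable_trapezoid].
  - by apply: cvgM; [exact: cvg_cst|exact: cvg_trapezoid].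
  have [hx|hx] := leP `|x| r.
    rewrite patchE ifT; last by rewrite inE/= in_itv/= -ler_norml.
    rewrite normrM mulrC ler_wpM2r// /trapezoid.
    have h t : `|eta t| <= D0 + 1 by apply: (le_trans (hD0 t)); rewrite lerDl.
    case: ifP => // _; case: ifP => // _.
    by rewrite normr1 lerDr; apply: le_trans (hD0 0).
  by rewrite (trapezoid_out eta0 ab (@width_gt0 R n) (@width_le1 R n) hx) mulr0 normr0 mulr_ge0.
have E : \forall n \near \oo,
    \int[mu]_x (u x * ((width n)^-1 * rise eta ((x - a) / width n))) +
    \int[mu]_x (u x * ((width n)^-1 * fall eta ((x - b) / width n))) =
    - \int[mu]_x (v x * trapezoid eta a b (width n) x).
  have : \forall n \near \oo, width n < b - a.
    by apply: (cvgr_lt _ cvg_width); rewrite subr_gt0.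
  apply: filterS => n hn; have w0 := @width_gt0 R n.
  rewrite -(uv _ _ (rsmooth_trapezoid seta eta1 ab w0 hn)
    (fun x => trapezoid_out eta0 ab w0 (@width_le1 R n) (x := x))).
  have ik (k : R -> R) c : measurable_fun setT k -> (forall t, `|k t| <= D1) ->
      (forall t, 1 < `|t| -> k t = 0) ->
      rintegrable (fun x => u x * ((width n)^-1 * k ((x - c) / width n))).
    move=> mk bk zk; apply: (@locint_mul _ u _ (`|c| + width n) ((width n)^-1 * D1)) => //.
    - apply: measurable_funM => //; apply: measurableT_comp => //.
      by apply: measurable_funM => //; exact: measurable_funB.
    - have wi : 0 < (width n)^-1 :> R by rewrite invr_gt0.
      by move=> x; rewrite normrM (gtr0_norm wi) ler_wpM2l// ltW.
    - move=> x hx; rewrite zk ?mulr0// normrM normfV (gtr0_norm w0) ltr_pdivlMr// mul1r.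
      by have := ler_normD (x - c) c; rewrite subrK; lra.
  rewrite -RintegralD//; [|exact: ik|exact: ik].
  by apply: eq_Rintegral => x _; rewrite derive_trapezoid// mulrDr.
pose P n := \int[mu]_x (u x * ((width n)^-1 * rise eta ((x - a) / width n))).
pose Q n := \int[mu]_x (u x * ((width n)^-1 * fall eta ((x - b) / width n))).
have L : (P n + Q n : R) @[n --> \oo] --> (u a - u b : R).
  by apply: cvgD; [exact: A|exact: B].
have Rr : (- \int[mu]_x (v x * trapezoid eta a b (width n) x) : R) @[n --> \oo] -->
    (- \int[mu]_x (v x * \1_`[a, b] x) : R).
  by apply: cvgN; exact: C.
have F : (P n + Q n : R) @[n --> \oo] --> (- \int[mu]_x (v x * \1_`[a, b] x) : R).
  apply: cvg_trans Rr; apply: near_eq_cvg.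
  by apply: filterS E => n hn; rewrite -hn.
have LF : u a - u b = - \int[mu]_x (v x * \1_`[a, b] x) by exact: (cvg_unique _ L F).
rewrite -opprB LF opprK.
rewrite [RHS]Rintegral_mkcond; apply: eq_Rintegral => x _.
by rewrite patchE indicE; case: ifP => _; rewrite ?mulr1 ?mulr0.
Qed.

End bump.

(** The integral from a0 to x with its sign, plus c. *)
Definition prim v (a0 c x : R) : R :=
  c + (if a0 <= x then \int[mu]_(t in `[a0, x]) v t else - \int[mu]_(t in `[x, a0]) v t).

Section primitive.
Variable v : R -> R.
Hypothesis lv : locint v.

Lemma Rintegral_itv_split (a b c : R) : a <= b -> b <= c ->
  \int[mu]_(t in `[a, c]) v t = \int[mu]_(t in `[a, b]) v t + \int[mu]_(t in `[b, c]) v t.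
Proof.
move=> ab bc.
have := @Rintegral_itvB R v (BLeft a) (BRight c) b (locint_itv a c lv).
rewrite !bnd_simp => /(_ ab bc) E.
rewrite -(subrK (\int[mu]_(t in `[a, b]) v t) (\int[mu]_(t in `[a, c]) v t)) E addrC.
congr (_ + _); rewrite Rintegral_itv_obnd_cbnd//.
by apply: integrableS (locint_itv b c lv) => //; exact: subset_itv_oc_cc.
Qed.

Lemma prim_increment a0 c a b : a <= b ->
  prim v a0 c b - prim v a0 c a = \int[mu]_(t in `[a, b]) v t.
Proof.
move=> ab; rewrite /prim opprD addrACA subrr add0r.
have [a0a|aa0] := leP a0 a.
  by rewrite (le_trans a0a ab) (Rintegral_itv_split a0a ab) addrAC subrr add0r.
have [a0b|ba0] := leP a0 b.
  by rewrite opprK (Rintegral_itv_split (ltW aa0) a0b) addrC.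
by rewrite opprK (Rintegral_itv_split ab (ltW ba0)) addrC addrK.
Qed.

Lemma prim_continuous a0 c : continuous (prim v a0 c).
Proof.
move=> x.
have xx : x - 1 <= x + 1 by lra.
have W := parameterized_integral_continuous xx (locint_itv (x - 1) (x + 1) lv).
have xI : x \in `]x - 1, x + 1[%classic by rewrite inE/= in_itv/=; lra.
have C : {for x, continuous (fun y => parameterized_integral mu (x - 1) y v)}.
  have := W; rewrite continuous_within_itvP; last by lra.
  by move=> [h _ _]; apply: h; rewrite in_itv/=; lra.
have near1 : \forall y \near x, prim v a0 c y =
    prim v a0 c (x - 1) + parameterized_integral mu (x - 1) y v.
  have : x - 1 < x by lra.
  move=> /lt_nbhsr; apply: filterS => y hy.
  by rewrite /parameterized_integral -(prim_increment a0 c (ltW hy)); ring.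
have near1x := nbhs_singleton near1.
have L : (prim v a0 c (x - 1) + parameterized_integral mu (x - 1) y v : R) @[y --> x] -->
    (prim v a0 c (x - 1) + parameterized_integral mu (x - 1) x v : R).
  by apply: cvgD; [exact: cvg_cst|exact: C].
rewrite -near1x in L; apply: cvg_trans L.
by apply: near_eq_cvg; apply: filterS near1 => y ->.
Qed.

End primitive.

Lemma ae_exists (P : R -> Prop) : {ae mu, forall x, P x} -> exists x, P x.
Proof.
move=> [A [mA A0 PA]]; apply: contrapT => nP.
have AT : A = setT.
  by apply/seteqP; split => // x _; apply: PA => Px; apply: nP; exists x.
have : (mu `[0%R, 1%R] <= mu A)%E.
  by apply: le_measure; rewrite ?inE//; rewrite AT.
by rewrite A0 lebesgue_measure_itv/= lte_fin ltr01 -EFinB subr0 lee_fin ler10.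
Qed.

(** Almost every point is a Lebesgue point of u.  Take the primitive of v that
    equals u at one of them; by [weak_increment] it equals u at all of them. *)
Lemma weak_derivative_primitive (eta0 : R -> R[i]) u v : cutoff eta0 ->
  locint u -> locint v -> rweak u v -> exists U : R -> R,
  [/\ continuous U,
    forall a b, a <= b -> U b - U a = \int[mu]_(t in `[a, b]) v t &
    {ae mu, forall x, u x = U x}].
Proof.
move=> ce lu lv uv; have [[se _] _ e1] := ce.
have seta : rsmooth (re_fun eta0) by move=> n x; have [] := se n x.
have eta1 t : `|t| <= 1 / 2 -> re_fun eta0 t = 1 by move=> /e1; rewrite /re_fun => ->.
have eta00 t : 3 / 4 < `|t| -> re_fun eta0 t = 0.
  by move=> /(cutoff_out ce); rewrite /re_fun => ->.
have ae := lebesgue_differentiation lu.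
have [a0 pa0] := ae_exists ae.
exists (prim v a0 (u a0)); split.
- exact: prim_continuous.
- by move=> a b ab; exact: prim_increment.
have [A [mA A0 PA]] := ae; exists A; split => // x /= nx; apply: PA => px; apply: nx.
rewrite /prim.
have [xa|ax|->] := ltgtP a0 x.
- by rewrite -(weak_increment seta eta1 eta00 lu lv uv pa0 px xa) addrC subrK.
- by rewrite -(weak_increment seta eta1 eta00 lu lv uv px pa0 ax) opprB addrC subrK.
by rewrite set_itv1 Rintegral_set1 addr0.
Qed.

End WeakIncrement.

(** * Hoelder inequality on intervals and sequence norms of local averages *)

Section Hoelder.
Context {R : realType}.
Notation mu := (@lebesgue_measure R).
Implicit Types (w : R -> R) (A : set R).

(** Hoelder's inequality for the product of w and the indicator function of A. *)
Lemma hoelder_set A (l : R) (r : R) w : measurable A -> mu A = l%:E -> 0 < l ->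
  1 <= r -> measurable_fun setT w -> (forall x, 0 <= w x) ->
  (\int[mu]_(x in A) (w x)%:E <=
   (l `^ (1 - r^-1))%:E * (\int[mu]_(x in A) (w x `^ r)%:E) `^ r^-1)%E.
Proof.
move=> mA muA l0 r1 mw w0.
have [->|rN1] := eqVneq r 1.
  rewrite invr1 subrr powRr0 mul1e poweRe1; last first.
    by apply: integral_ge0 => x _; rewrite lee_fin powR_ge0.
  by under [X in (_ <= X)%E]eq_integral => x _ do rewrite powRr1 ?w0//.
have r1' : 1 < r by rewrite lt_neqAle eq_sym rN1 r1.
have r0 : 0 < r by rewrite (lt_trans _ r1').
have rV1 : r^-1 < 1 by rewrite invf_lt1.
have q0 : 0 < (1 - r^-1)^-1 by rewrite invr_gt0 subr_gt0.
have mwA : measurable_fun setT (w \_ A).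
  by apply/(measurable_restrictT _ _).1 => //; exact: measurable_funTS.
have mA1 : measurable_fun setT (\1_A : R -> R) by exact: measurable_indic.
have := hoelder mu mwA mA1 r0 q0.
rewrite invrK addrC subrK => /(_ erefl).
rewrite Lnorm1; have -> : (\int[mu]_x `|(EFin \o (w \_ A \* \1_A)%R) x|)%E =
    (\int[mu]_(x in A) (w x)%:E)%E.
  rewrite [RHS]integral_mkcond; apply: eq_integral => x _ /=.
  rewrite !patchE indicE; case: ifPn => xA; rewrite ?mulr0 ?normr0 // mulr1.
  by rewrite ger0_norm.
rewrite muleC unlock invrK.
have -> : (\int[mu]_x `|(EFin \o (w \_ A)%R) x| `^ r)%E =
    (\int[mu]_(x in A) (w x `^ r)%:E)%E.
  rewrite [RHS]integral_mkcond; apply: eq_integral => x _ /=.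
  rewrite !patchE; case: ifPn => xA; first by rewrite ger0_norm.
  by rewrite normr0 powR0// gt_eqF.
have -> : (\int[mu]_x `|(EFin \o (\1_A : R -> R)) x| `^ (1 - r^-1)^-1)%E = l%:E.
  rewrite -muA -[in RHS](setIT A) -integral_indic//; apply: eq_integral => x _ /=.
  rewrite indicE; case: (x \in A); rewrite /= ?normr1 ?powR1 //.
  by rewrite normr0 powR0// gt_eqF.
by rewrite poweR_EFin.
Qed.

(** The exponent 1 - fine p^-1 is 1 - 1/p, and 1 for p = +oo, where the
    inequality is the bound by the essential supremum. *)
Lemma hoelder_set_Lnorm A (l : R) (p : \bar R) w : measurable A ->
  mu A = l%:E -> 0 < l -> (1 <= p)%E -> measurable_fun setT w ->
  (forall x, 0 <= w x) ->
  (\int[mu]_(x in A) (w x)%:E <=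
   (l `^ (1 - fine p^-1))%:E * Lnorm mu p (fun x => (w x)%:E))%E.
Proof.
move=> mA muA l0 p1 mw w0; have mTw := measurable_funS measurableT (@subsetT _ A) mw.
case: p p1 => [r| |//]; rewrite ?lee_fin => r1.
  have r0 : 0 < r by rewrite (lt_le_trans _ r1).
  rewrite inver gt_eqF//=; apply: le_trans (hoelder_set mA muA l0 r1 mw w0) _.
  rewrite lee_pmul2l ?lte_fin ?powR_gt0// unlock.
  under [X in (_ <= X `^ _)%E]eq_integral => x _ do rewrite /= ger0_norm//.
  have i0 B : (0 <= \int[mu]_(x in B) (w x `^ r)%:E)%E.
    by apply: integral_ge0 => x _; rewrite lee_fin powR_ge0.
  apply: gt0_ler_poweR; rewrite ?invr_ge0 ?(ltW r0)// ?in_itv/= ?i0 ?leey//.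
  apply: ge0_subset_integral => //; last by move=> x _; rewrite lee_fin powR_ge0.
  apply/measurable_EFinP; exact: (measurableT_comp (measurable_powR r) mw).
rewrite invey /= subr0 powRr1 ?(ltW l0)// muleC -muA.
set M := Lnorm _ _ _; have M0 : (0 <= M)%E by exact: Lnorm_ge0.
have aM : {ae mu, forall x, A x -> (`|(w x)%:E| <= M)%E}.
  have := ess_sup_ge mu (abse \o (fun x => (w x)%:E)).
  move=> [B [mB B0 PB]]; exists B; split => // x /= nx; apply: PB => px; apply: nx => _.
  apply: le_trans px _; rewrite /M unlock ifT//.
  apply: (@lt_le_trans _ _ (mu A)); first by rewrite muA lte_fin.
  by apply: le_measure; rewrite ?inE.
have mwE : measurable_fun A (EFin \o w) by exact/measurable_EFinP.
have := @integral_le_bound _ _ R mu A (EFin \o w) M mA mwE M0 aM.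
by under eq_integral => x _ do rewrite gee0_abs ?lee_fin//.
Qed.

(** For finite p, Hoelder on each I m gives
    (c m)^p <= l^(p-1) int_{I m} w^p, and these integrals add up to at most the
    integral over the line because the I m are disjoint. *)
Lemma lp_norm_local_averages (I : int -> set R) (l : R) (p : \bar R) w (c : int -> R) :
  (forall m, measurable (I m)) -> (forall m, mu (I m) = l%:E) ->
  trivIset setT I -> 0 < l -> (1 <= p)%E -> measurable_fun setT w ->
  (forall x, 0 <= w x) -> (forall m, 0 <= c m) ->
  (forall m, ((c m)%:E <= \int[mu]_(x in I m) (w x)%:E)%E) ->
  (lp_norm p c <= (l `^ (1 - fine p^-1))%:E * Lnorm mu p (fun x => (w x)%:E))%E.
Proof.
move=> mI muI tI l0 p1 mw w0 c0 cI.
case: p p1 => [r| |//] p1; last first.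
  apply: ge_ereal_sup => _ [m _ <-]; rewrite ger0_norm//.
  exact: le_trans (cI m) (hoelder_set_Lnorm (mI m) (muI m) l0 p1 mw w0).
rewrite lee_fin in p1.
have r0 : 0 < r by rewrite (lt_le_trans _ p1).
rewrite inver gt_eqF//= unlock.
under [X in (_ <= _ * X `^ _)%E]eq_integral => x _ do rewrite /= ger0_norm//.
have i0 B : (0 <= \int[mu]_(x in B) (w x `^ r)%:E)%E.
  by apply: integral_ge0 => x _; rewrite lee_fin powR_ge0.
have mwr B : measurable_fun B (fun x => (w x `^ r)%:E).
  apply: (measurable_funS measurableT (@subsetT _ _)).
  apply/measurable_EFinP; exact: (measurableT_comp (measurable_powR r) mw).
have cr m : ((`|c m| `^ r)%:E <=
    (l `^ (r - 1))%:E * \int[mu]_(x in I m) (w x `^ r)%:E)%E.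
  have h := le_trans (cI m) (hoelder_set (mI m) (muI m) l0 p1 mw w0).
  have := gt0_ler_poweR (ltW r0) _ _ h.
  rewrite !in_itv/= lee_fin c0 leey /= mule_ge0 ?lee_fin ?powR_ge0 ?poweR_ge0//=.
  move=> /(_ erefl); rewrite leey => /(_ erefl).
  rewrite poweRM ?lee_fin ?powR_ge0 ?poweR_ge0// !poweR_EFin -powRrM.
  rewrite -poweRrM mulVf ?gt_eqF// poweRe1// mulrBl mul1r mulVf ?gt_eqF//.
  by rewrite ger0_norm.
have S : (\esum_(m in [set: int]) (`|c m| `^ r)%:E <=
    (l `^ (r - 1))%:E * \int[mu]_x (w x `^ r)%:E)%E.
  apply: ge_ereal_sup => _ [D [fD _] <-]; rewrite fsbig_finite//=.
  have us := finmap.fset_uniq (fset_set D); move: us.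
  move: (finmap.enum_fset _) => s us.
  have h := @lee_sum R int _ _ s xpredT (fun m _ => cr m).
  apply: le_trans h _.
  rewrite -ge0_sume_distrr; last by move=> m _; exact: i0.
  rewrite lee_pmul2l ?lte_fin ?powR_gt0//.
  have tIs : trivIset [set` s] I by move=> m n _ _; exact: tI.
  have <- := @ge0_integral_bigsetU _ _ _ mu _ I (fun x => (w x `^ r)%:E) s mI us tIs
    (mwr _) (fun x _ => powR_ge0 (w x) r).
  apply: ge0_subset_integral => //.
  - by apply: bigsetU_measurable => m _; exact: mI.
  - exact: mwr.
  by move=> x _; rewrite lee_fin powR_ge0.
have e0 : (0 <= \esum_(m in [set: int]) (`|c m| `^ r)%:E)%E.
  by apply: esum_ge0 => m _; rewrite lee_fin powR_ge0.
have := gt0_ler_poweR (_ : 0 <= r^-1) _ _ S.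
rewrite invr_ge0 (ltW r0) !in_itv/= e0 !leey/= mule_ge0 ?lee_fin ?powR_ge0//=.
move=> /(_ erefl erefl erefl).
rewrite poweRM ?lee_fin ?powR_ge0// poweR_EFin -powRrM.
by rewrite mulrBl mul1r mulfV ?gt_eqF.
Qed.

End Hoelder.

(** * Haar coefficients and increments *)

Section HaarIncrement.
Context {R : realType}.
Notation mu := (@lebesgue_measure R).
Implicit Types U v w : R -> R.

Lemma locint_le v w : measurable_fun setT v -> locint w ->
  (forall x, `|v x| <= w x) -> locint v.
Proof.
move=> mv [mw oT iw] vw; split=> // K KT cK; apply: le_lt_trans (iw K KT cK).
apply: ge0_le_integral => //; first exact: compact_measurable.
- by apply/measurable_EFinP/measurableT_comp => //; exact: measurable_funTS.
- by apply/measurable_EFinP/measurableT_comp => //; exact: measurable_funTS.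
- by move=> x _; rewrite lee_fin (le_trans (vw x))// ler_norm.
Qed.

Lemma locint_norm v : locint v -> locint (fun x => `|v x|).
Proof.
move=> [mv oT iv]; split=> //; first exact: measurableT_comp.
by move=> K KT cK; under eq_integral => x _ do rewrite normr_id; exact: iv.
Qed.

Lemma locint_continuous U : continuous U -> locint U.
Proof.
move=> cU; split=> //; [exact: continuous_measurable_fun|exact: openT|].
move=> K _ cK.
have /integrableP[_] := @continuous_compact_integrable R U K cK
  (continuous_subspaceT cU).
by [].
Qed.

Lemma Rintegral_sub_itv w (a s t b : R) : locint w -> (forall x, 0 <= w x) ->
  a <= s -> s <= t -> t <= b ->
  \int[mu]_(x in `[s, t]) w x <= \int[mu]_(x in `[a, b]) w x.
Proof.
move=> lw w0 as_ st tb.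
rewrite (Rintegral_itv_split lw as_ (le_trans st tb)) (Rintegral_itv_split lw st tb).
have h1 : 0 <= \int[mu]_(x in `[a, s]) w x by apply: Rintegral_ge0.
have h2 : 0 <= \int[mu]_(x in `[t, b]) w x by apply: Rintegral_ge0.
by rewrite addrCA lerDl addr_ge0.
Qed.

Lemma Rintegral_itv_shift U (a b h : R) : locint U ->
  \int[mu]_(x in `[a + h, b + h]) U x = \int[mu]_(x in `[a, b]) U (x + h).
Proof.
move=> lU; rewrite Rintegral_mkcond [RHS]Rintegral_mkcond.
have [_ H] := rintegrable_affine h ltr01 (locint_restrict (a + h) (b + h) lU).
rewrite invr1 mul1r in H; rewrite -H.
congr Rintegral; apply/funext => x; rewrite mul1r !patchE.
suff -> : (x + h \in `[a + h, b + h]%classic) = (x \in `[a, b]%classic) by [].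
by apply/idP/idP; rewrite !inE/= !in_itv/= !lerD2r.
Qed.

(** After translating the second half onto the first, the integrand is an
    increment of U over a distance h, at most the integral of w over the whole
    interval. *)
Lemma haar_increment U v w (a h : R) : continuous U -> locint v -> locint w ->
  (forall x, `|v x| <= w x) ->
  (forall a b, a <= b -> U b - U a = \int[mu]_(t in `[a, b]) v t) -> 0 < h ->
  `|\int[mu]_(x in `[a, a + h]) U x - \int[mu]_(x in `[a + h, a + h + h]) U x|
   <= h * \int[mu]_(x in `[a, a + h + h]) w x.
Proof.
move=> cU lv lw vw inc h0; set K := \int[mu]_(x in _) w x.
have lU := locint_continuous cU.
have cU' : continuous (fun x => U (x + h)).
  move=> x; apply: continuous_comp; last exact: cU.
  by apply: cvgD; [exact: cvg_id|exact: cvg_cst].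
have lU' := locint_continuous cU'.
rewrite Rintegral_itv_shift// -RintegralB//; last 2 first.
- exact: locint_itv lU.
- exact: locint_itv lU'.
have w0 x : 0 <= w x by rewrite (le_trans _ (vw x)).
have iB : mu.-integrable `[a, a + h] (EFin \o (fun x => U x - U (x + h))).
  apply: locint_itv; apply: locint_continuous => x.
  by apply: cvgB; [exact: cU|exact: cU'].
apply: le_trans (le_normr_Rintegral _ iB) _ => //.
have iN := integrable_norm iB.
have muh : mu `[a, a + h] = h%:E.
  by rewrite lebesgue_measure_itv/= lte_fin ltrDl h0 -EFinB addrAC subrr add0r.
have -> : h * K = \int[mu]_(x in `[a, a + h]) K.
  by rewrite Rintegral_cst//= muh/= mulrC.
apply: le_Rintegral => //.
  apply: locint_itv; apply: locint_continuous; exact: cst_continuous.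
move=> x /=; rewrite in_itv/= => /andP[ax xh].
rewrite distrC inc ?lerDl ?(ltW h0)//.
have ivx := locint_itv x (x + h) lv.
apply: le_trans (le_normr_Rintegral _ ivx) _ => //.
apply: (@le_trans _ _ (\int[mu]_(t in `[x, x + h]) w t)).
  apply: le_Rintegral => //; last exact: locint_itv.
  by apply: locint_itv; exact: locint_norm.
by apply: Rintegral_sub_itv; rewrite ?lerD2r ?lerDl ?(ltW h0).
Qed.

End HaarIncrement.

Section Grid.
Context {R : realType}.
Notation mu := (@lebesgue_measure R).
Variables (N : R) (N0 : 0 < N).

(** For N = 2^j these are the dyadic intervals of length 2^-j. *)
Definition grid_itv (m : int) : set R := `[m%:~R / N, (m%:~R + 1) / N[%classic.

Lemma measurable_grid_itv m : measurable (grid_itv m).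
Proof. exact: measurable_itv. Qed.

Lemma lebesgue_measure_grid_itv m : mu (grid_itv m) = (N^-1)%:E.
Proof.
rewrite /grid_itv lebesgue_measure_itv/= lte_fin ltr_pM2r ?invr_gt0// ltrDl ltr01.
by rewrite -EFinB -mulrBl addrAC subrr add0r mul1r.
Qed.

Lemma trivIset_grid_itv : trivIset setT grid_itv.
Proof.
move=> m n _ _ [x []]; rewrite /grid_itv/= !in_itv/=.
rewrite !ler_pdivrMr// !ltr_pdivlMr// => /andP[mx xm] /andP[nx xn].
have h1 := le_lt_trans mx xn; have h2 := le_lt_trans nx xm.
move: h1 h2; rewrite -[1 : R]/(1%:~R) -!intrD !ltr_int !ltzD1 => h1 h2.
by apply/le_anti; rewrite h1 h2.
Qed.

End Grid.

Section HaarCoefficients.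
Context {R : realType}.
Notation mu := (@lebesgue_measure R).
Variables (eta0 : R -> R[i]) (ce : cutoff eta0).
Variables (F : R -> R[i]) (B : R) (cF : ccontinuous F).
Hypothesis FB : forall x, normc (F x) <= B.
(* T is to be the distribution of a function equal to F almost everywhere. *)
Variable T : schwartz_functional R.
Hypothesis TF : forall psi, ccontinuous psi -> T psi = distr_of F psi.

Lemma locint_normc (g : R -> R[i]) : clocally_integrable g ->
  locint (fun x => normc (g x)).
Proof.
move=> [lr li].
apply: (@locint_le R _ (fun x => `|re_fun g x| + `|im_fun g x|)).
- by apply: measurable_normc; split; exact: locint_meas.
- by apply: locally_integrableD; exact: locint_norm.
- by move=> x; rewrite ger0_norm ?normc_ge0// normc_le.
Qed.

Lemma normc_re_im_le (x y K : R) : `|x| <= K -> `|y| <= K -> normc (x +i* y) <= 2 * K.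
Proof. by move=> xK yK; apply: le_trans (normc_le _) _ => /=; lra. Qed.

Lemma locint_ereal (w : R -> R) (a b : R) : locint w ->
  (\int[mu]_(x in `[a, b]) w x)%:E = (\int[mu]_(x in `[a, b[) (w x)%:E)%E.
Proof.
move=> lw; rewrite integral_itv_bndo_bndc; last first.
  by apply/measurable_EFinP; apply: measurable_funTS; exact: locint_meas.
by rewrite /Rintegral fineK//; apply: integrable_fin_num => //; exact: locint_itv.
Qed.

Lemma cintegral_bndo (a b : R) :
  cintegral (`[a, b[) F = (\int[mu]_(x in `[a, b]) re_fun F x) +i*
    (\int[mu]_(x in `[a, b]) im_fun F x).
Proof.
have [cr ci] := cF; rewrite /cintegral.
by rewrite !Rintegral_itv_bndo_bndc//; apply: integrableS (locint_itv a b (locint_continuous _)) => //;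
  apply: subset_itvl; rewrite bnd_simp.
Qed.

Lemma pair_step2 (c d : R) (I J : interval R) :
  pair_step eta0 T [:: (c, I); (d, J)] =
  c%:C * pair_indic eta0 T I + d%:C * pair_indic eta0 T J.
Proof.
rewrite /pair_step; move: (pair_indic _ _) => P.
by rewrite !big_cons big_nil addr0.
Qed.

(** The interval is cut into halves of length h = 2^-(j+1), and
    [haar_increment] applies to the real and the imaginary part.  The loss of a
    factor 2 in combining them is made up by 2^j * h = 1/2. *)
Lemma haar_coef_le (g : R -> R[i]) (j m : int) : j != -1 ->
  clocally_integrable g ->
  (forall a b, a <= b -> re_fun F b - re_fun F a = \int[mu]_(t in `[a, b]) re_fun g t) ->
  (forall a b, a <= b -> im_fun F b - im_fun F a = \int[mu]_(t in `[a, b]) im_fun g t) ->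
  ((normc ((2 ^ j)%:C * haar_coef eta0 T j m))%:E <=
   \int[mu]_(x in grid_itv (2 ^ j) m) (normc (g x))%:E)%E.
Proof.
move=> j1 lg incr inci; have lw := locint_normc lg.
have j0 : (0 : R) < 2 ^ j by rewrite exprz_gt0.
rewrite /grid_itv -locint_ereal// lee_fin.
have -> : haar_coef eta0 T j m =
    1%:C * pair_indic eta0 T (`[m%:~R / 2 ^ j, (m%:~R + 1 / 2) / 2 ^ j[) +
    (-1)%:C * pair_indic eta0 T (`[(m%:~R + 1 / 2) / 2 ^ j, (m%:~R + 1) / 2 ^ j[).
  by rewrite /haar_coef /haar_step (negPf j1) pair_step2.
rewrite !(pair_indicE ce cF FB TF) !cintegral_bndo.
(* With h half the length, the three endpoints are a, a + h and a + h + h. *)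
set a := m%:~R / 2 ^ j; set h := (1 / 2) / 2 ^ j : R.
have -> : (m%:~R + 1 / 2) / 2 ^ j = a + h by rewrite /a /h mulrDl.
have -> : (m%:~R + 1) / 2 ^ j = a + h + h.
  by rewrite /a /h -addrA -!mulrDl; congr ((_ + _) / _); field.
have h0 : 0 < h by rewrite /h divr_gt0.
have [cr ci] := cF; have [lr li] := lg.
have Hr := haar_increment a cr lr lw (fun x => normr_Re_le (g x)) incr h0.
have Hi := haar_increment a ci li lw (fun x => normr_Im_le (g x)) inci h0.
set K := \int[mu]_(x in _) normc (g x) in Hr Hi *.
rewrite rmorph1 mul1r rmorphN rmorph1 mulN1r.
have H := normc_re_im_le Hr Hi.
rewrite normcM normc_real gtr0_norm//.
have -> : K = 2 ^ j * (2 * (h * K)).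
  by rewrite /h; field; rewrite gt_eqF.
by rewrite ler_pM2l.
Qed.

(** As for the other levels, the factor 2^-1 makes up for treating the real and
    the imaginary part separately. *)
Lemma haar_coef_scaling_le (m : int) :
  ((normc ((2 ^ (-1))%:C * haar_coef eta0 T (-1) m))%:E <=
   \int[mu]_(x in grid_itv 1 m) (normc (F x))%:E)%E.
Proof.
have [cr ci] := cF.
have lF : clocally_integrable F by split; exact: locint_continuous.
have lw := locint_normc lF; have [lr li] := lF.
rewrite /grid_itv !divr1 -locint_ereal// lee_fin.
have -> : haar_coef eta0 T (-1) m =
    1%:C * pair_indic eta0 T (`[m%:~R, m%:~R + 1[).
  by rewrite /haar_coef /pair_step /haar_step eqxx big_seq1.
rewrite (pair_indicE ce cF FB TF) cintegral_bndo.
have le1 (v : R -> R) : locint v -> (forall x, `|v x| <= normc (F x)) ->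
  `|\int[mu]_(x in `[m%:~R, m%:~R + 1]) v x| <=
  \int[mu]_(x in `[m%:~R, m%:~R + 1]) normc (F x).
  move=> lv vF; apply: le_trans (le_normr_Rintegral _ (locint_itv _ _ lv)) _ => //.
  apply: le_Rintegral => //; last exact: locint_itv.
  by apply: locint_itv; exact: locint_norm.
have Hr := le1 _ lr (fun x => normr_Re_le (F x)).
have Hi := le1 _ li (fun x => normr_Im_le (F x)).
rewrite rmorph1 mul1r normcM normc_real.
set K := \int[mu]_(x in _) normc (F x) in Hr Hi *.
have H := normc_re_im_le Hr Hi.
have -> : K = `|(2 : R) ^ (-1)| * (2 * K).
  by rewrite ger0_norm// exprN1 mulKf.
by rewrite ler_pM2l// normr_gt0 exprN1 invr_eq0.
Qed.

End HaarCoefficients.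

(** * Bounded continuous representatives of Sobolev functions *)

Section SobolevRepresentative.
Context {R : realType}.
Notation mu := (@lebesgue_measure R).
Implicit Types (f g F : R -> R[i]) (p : \bar R).

Lemma Lnorm_unit_itv p f (x : R) : (1 <= p)%E -> cmeas f ->
  (\int[mu]_(t in `[x, (x + 1)%R[) (normc (f t))%:E <= cLnorm p f)%E.
Proof.
move=> p1 mf.
have muI : mu `[x, x + 1[ = 1%:E.
  by rewrite lebesgue_measure_itv/= lte_fin ltrDl ltr01 -EFinB addrAC subrr add0r.
have := hoelder_set_Lnorm (measurable_itv `[x, x + 1[) muI ltr01 p1
  (measurable_normc mf) (fun t => normc_ge0 (f t)).
by rewrite powR1 mul1e.
Qed.

(** Hoelder's inequality on an interval that contains the given compact set. *)
Lemma Lp_locally_integrable p f : (1 <= p)%E -> inLp p f -> clocally_integrable f.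
Proof.
move=> p1 [mf fp].
have ln : locint (fun x => normc (f x)).
  split; [exact: measurable_normc|exact: openT|move=> K _ cK].
  have [M [_ KM]] := compact_bounded cK.
  set b : R := `|M| + 1; have b0 : 0 < b by rewrite ltr_wpDl.
  have KI : K `<=` `[- b, b].
    move=> x Kx; rewrite /= in_itv/= -ler_norml; apply: (KM b) => //.
    by rewrite (le_lt_trans (ler_norm M))// ltrDl.
  have mN : measurable_fun setT (EFin \o (fun x => normc (f x))).
    by apply/measurable_EFinP; exact: measurable_normc.
  under eq_integral => x _ do rewrite ger0_norm ?normc_ge0//.
  apply: (@le_lt_trans _ _ (\int[mu]_(x in `[(- b)%R, b]) (normc (f x))%:E)%E).
    apply: ge0_subset_integral => //; first exact: compact_measurable.
    - exact: measurable_funTS.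
    - by move=> x _; rewrite lee_fin normc_ge0.
  have muI : mu `[- b, b] = (2 * b)%:E.
    rewrite lebesgue_measure_itv/= lte_fin gtrN// -EFinB opprK.
    by congr (_%:E); ring.
  have b2 : 0 < 2 * b by rewrite mulr_gt0.
  apply: le_lt_trans (hoelder_set_Lnorm (measurable_itv _) muI b2 p1
    (measurable_normc mf) (fun t => normc_ge0 (f t))) _.
  by rewrite lte_mul_pinfty ?lee_fin ?powR_ge0.
have [mr mi] := mf.
split; first by apply: (locint_le mr ln) => x; exact: normr_Re_le.
by apply: (locint_le mi ln) => x; exact: normr_Im_le.
Qed.

(** If U and V differ at a point they differ on a ball, which has positive
    measure. *)
Lemma continuous_ae_eq (U V : R -> R) : continuous U -> continuous V ->
  {ae mu, forall x, U x = V x} -> U = V.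
Proof.
move=> cU cV [A [mA A0 UA]]; apply/funext => x; apply/eqP; apply: contrapT => /negP UV.
have cD : {for x, continuous (fun y => U y - V y)}.
  by apply: cvgB; [exact: cU|exact: cV].
have D0 : U x - V x != 0 by rewrite subr_eq0.
have : \forall y \near x, U y - V y != 0.
  by apply: (cvgr_neq0 (U x - V x) cD).
move=> /nbhs_ballP[e /= e0 He].
have sub : ball x e `<=` A.
  by move=> y /He /= D; apply: UA => /= E; move: D; rewrite E subrr eqxx.
have : (mu (ball x e) <= mu A)%E.
  by apply: le_measure; rewrite ?inE//; exact: measurable_ball.
rewrite A0 lebesgue_measure_ball ?(ltW e0)// lee_fin.
by rewrite leNgt mulrn_wgt0.
Qed.

(** Integrate |U x| <= |U t| + |U t - U x| over t in [x, x + 1]. *)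
Lemma primitive_le (U v w : R -> R) (x : R) : continuous U -> locint v -> locint w ->
  (forall t, `|v t| <= w t) ->
  (forall a b, a <= b -> U b - U a = \int[mu]_(t in `[a, b]) v t) ->
  `|U x| <= \int[mu]_(t in `[x, x + 1]) `|U t| + \int[mu]_(t in `[x, x + 1]) w t.
Proof.
move=> cU lv lw vw inc; set K := \int[mu]_(t in _) w t.
have w0 t : 0 <= w t by rewrite (le_trans _ (vw t)).
have lN := locint_norm (locint_continuous cU).
have cK c : continuous (fun _ : R => c : R) by move=> ?; exact: cvg_cst.
have muI : mu `[x, x + 1] = 1%:E.
  by rewrite lebesgue_measure_itv/= lte_fin ltrDl ltr01 -EFinB addrAC subrr add0r.
have cst1 (c : R) : \int[mu]_(t in `[x, x + 1]) c = c.
  by rewrite Rintegral_cst//= muI/= mulr1.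
rewrite -(cst1 `|U x|) -[K]cst1 -RintegralD//; last 2 first.
- exact: locint_itv.
- by apply: locint_itv; apply: locint_continuous; exact: cK.
have i1 : mu.-integrable `[x, x + 1] (EFin \o (fun=> `|U x|)).
  by apply: locint_itv; apply: locint_continuous; exact: cK.
have i2 : mu.-integrable `[x, x + 1] (EFin \o (fun t => `|U t| + K)).
  apply: locint_itv; apply: locally_integrableD => //.
  by apply: locint_continuous; exact: cK.
apply: le_Rintegral => // t /=; rewrite in_itv/= => /andP[xt tx].
have -> : U x = U t - (U t - U x) by ring.
apply: le_trans (ler_normB _ _) _; rewrite lerD2l inc//.
have ivt := locint_itv x t lv.
apply: le_trans (le_normr_Rintegral _ ivt) _ => //.
apply: (@le_trans _ _ (\int[mu]_(s in `[x, t]) w s)).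
  apply: le_Rintegral => //; last exact: locint_itv.
  by apply: locint_itv; exact: locint_norm.
exact: Rintegral_sub_itv.
Qed.

Lemma ae_eq_normc_integral f F (D : set R) : measurable D -> cmeas f -> cmeas F ->
  {ae mu, forall x, f x = F x} ->
  (\int[mu]_(x in D) (normc (f x))%:E = \int[mu]_(x in D) (normc (F x))%:E)%E.
Proof.
move=> mD mf mF [A [mA A0 PA]]; apply: ge0_ae_eq_integral => //.
- by apply/measurable_EFinP; apply: measurable_funTS; exact: measurable_normc.
- by apply/measurable_EFinP; apply: measurable_funTS; exact: measurable_normc.
- by move=> x _; rewrite lee_fin normc_ge0.
- by move=> x _; rewrite lee_fin normc_ge0.
by exists A; split => // x /= nx; apply: PA => /= E; apply: nx => _; rewrite E.
Qed.

Lemma ae_eq_cintegral f F : cmeas f -> cmeas F ->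
  {ae mu, forall x, f x = F x} -> cintegral setT f = cintegral setT F.
Proof.
move=> [mr mi] [Mr Mi] [A [mA A0 PA]].
have H (phi : R[i] -> R) : measurable_fun setT (phi \o f) ->
    measurable_fun setT (phi \o F) ->
    \int[mu]_x (phi \o f) x = \int[mu]_x (phi \o F) x.
  move=> m1 m2; congr fine; apply: ae_eq_integral => //.
  - exact/measurable_EFinP.
  - exact/measurable_EFinP.
  by exists A; split => // x /= nx; apply: PA => /= E; apply: nx => _; rewrite E.
by rewrite /cintegral (H (@complex.Re R))// (H (@complex.Im R)).
Qed.

Lemma weak_derivative_representative (eta0 : R -> R[i]) f g : cutoff eta0 ->
  clocally_integrable f -> weak_derivative f g -> exists F,
  [/\ ccontinuous F, {ae mu, forall x, f x = F x},
    forall a b, a <= b -> re_fun F b - re_fun F a = \int[mu]_(t in `[a, b]) re_fun g t &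
    forall a b, a <= b -> im_fun F b - im_fun F a = \int[mu]_(t in `[a, b]) im_fun g t].
Proof.
move=> ce [lr li] fg; have [[gr gi] _] := fg.
have [wr wi] := weak_derivative_real fg.
have [U [cU incU [A [mA A0 PA]]]] := weak_derivative_primitive ce lr gr wr.
have [V [cV incV [A' [mA' A'0 PA']]]] := weak_derivative_primitive ce li gi wi.
exists (fun x => U x +i* V x); split => //.
exists (A `|` A'); split; first exact: measurableU.
  by rewrite measureU0.
move=> x /= nx; apply: contrapT => nA; apply: nx; apply: complex_ext => /=.
  by apply: contrapT => nU; apply: nA; left; exact: PA.
by apply: contrapT => nV; apply: nA; right; exact: PA'.
Qed.

End SobolevRepresentative.

(** * The dyadic norm of a Sobolev function *)

Section DyadicNorm.
Context {R : realType}.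
Notation mu := (@lebesgue_measure R).
Implicit Types (f g F : R -> R[i]) (p : \bar R).

Lemma fine_inver_le1 p : (1 <= p)%E -> 0 <= 1 - fine p^-1.
Proof.
case: p => [r| |//]; rewrite ?lee_fin => r1; last by rewrite invey /= subr0.
have r0 : 0 < r by rewrite (lt_le_trans _ r1).
by rewrite inver gt_eqF//= subr_ge0 invf_le1.
Qed.

Lemma lp_norm_ge0 p (c : int -> R) : (0 <= lp_norm p c)%E.
Proof.
by case: p => [r| |] /=; rewrite ?poweR_ge0//;
  apply: (@le_trans _ _ (`|c 0|)%:E); rewrite ?lee_fin ?normr_ge0//;
  apply: ereal_sup_ubound; exists 0.
Qed.

(** By [primitive_le] and Hoelder's inequality on intervals of length 1. *)
Lemma bounded_representative p f g F : (1 <= p)%E -> inLp p f -> inLp p g ->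
  ccontinuous F -> {ae mu, forall x, f x = F x} ->
  (forall a b, a <= b -> re_fun F b - re_fun F a = \int[mu]_(t in `[a, b]) re_fun g t) ->
  (forall a b, a <= b -> im_fun F b - im_fun F a = \int[mu]_(t in `[a, b]) im_fun g t) ->
  exists B, forall x, normc (F x) <= B.
Proof.
move=> p1 fp gp cF fF incr inci; have [[mf ff] [mg fg]] := (fp, gp).
have lg := Lp_locally_integrable p1 gp; have [gr gi] := lg.
have lw := locint_normc lg; have [cr ci] := cF.
have lF : clocally_integrable F by split; exact: locint_continuous.
have lnF := locint_normc lF.
have fin h : (cLnorm p h < +oo)%E -> cLnorm p h = (fine (cLnorm p h))%:E.
  by move=> hp; rewrite fineK// ge0_fin_numE// Lnorm_ge0.
have leF x : \int[mu]_(t in `[x, x + 1]) normc (F t) <= fine (cLnorm p f).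
  rewrite -lee_fin locint_ereal// -fin//.
  rewrite -(ae_eq_normc_integral _ mf (continuous_cmeas cF) fF)//.
  exact: Lnorm_unit_itv.
have leg x : \int[mu]_(t in `[x, x + 1]) normc (g t) <= fine (cLnorm p g).
  by rewrite -lee_fin locint_ereal// -fin//; exact: Lnorm_unit_itv.
exists (2 * (fine (cLnorm p f) + fine (cLnorm p g))) => x.
have H (U v : R -> R) : continuous U -> locint v -> (forall t, `|v t| <= normc (g t)) ->
    (forall t, `|U t| <= normc (F t)) ->
    (forall a b, a <= b -> U b - U a = \int[mu]_(t in `[a, b]) v t) ->
    `|U x| <= fine (cLnorm p f) + fine (cLnorm p g).
  move=> cU lv vg UF inc; apply: le_trans (primitive_le x cU lv lw vg inc) _.
  apply: lerD; last exact: leg.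
  apply: le_trans (leF x); apply: le_Rintegral => //; last exact: locint_itv.
  by apply: locint_itv; apply: locint_norm; exact: locint_continuous.
have Hr := H _ _ cr gr (fun t => normr_Re_le (g t)) (fun t => normr_Re_le (F t)) incr.
have Hi := H _ _ ci gi (fun t => normr_Im_le (g t)) (fun t => normr_Im_le (F t)) inci.
by have := normc_re_im_le Hr Hi; rewrite /re_fun /im_fun; case: (F x).
Qed.

Lemma distr_of_ae_eq f F psi : cmeas f -> ccontinuous F -> ccontinuous psi ->
  {ae mu, forall x, f x = F x} -> distr_of f psi = distr_of F psi.
Proof.
move=> mf cF cpsi [A [mA A0 PA]]; apply: ae_eq_cintegral.
- by apply: cmeasM => //; exact: continuous_cmeas.
- by apply: cmeasM; exact: continuous_cmeas.
by exists A; split => // x /= nx; apply: PA => /= E; apply: nx; rewrite E.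
Qed.

(** The length 2^-j of the dyadic intervals in [lp_norm_local_averages] cancels
    the weight of the level; for j = -1 the weight is at most 1. *)
Lemma dyad_norm_le (eta0 : R -> R[i]) p f F B g : cutoff eta0 -> (1 <= p)%E ->
  cmeas f -> ccontinuous F -> (forall x, normc (F x) <= B) ->
  {ae mu, forall x, f x = F x} -> clocally_integrable g ->
  (forall a b, a <= b -> re_fun F b - re_fun F a = \int[mu]_(t in `[a, b]) re_fun g t) ->
  (forall a b, a <= b -> im_fun F b - im_fun F a = \int[mu]_(t in `[a, b]) im_fun g t) ->
  (dyad_norm eta0 p (distr_of f) <= cLnorm p f + cLnorm p g)%E.
Proof.
move=> ce p1 mf cF FB fF lg incr inci.
have TF psi : ccontinuous psi -> distr_of f psi = distr_of F psi.
  by move=> cpsi; exact: distr_of_ae_eq.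
have s0 := fine_inver_le1 p1; set s := 1 - fine p^-1 in s0.
have mgn : measurable_fun setT (fun x => normc (g x)).
  by apply: measurable_normc; have [[? _ _] [? _ _]] := lg; split.
apply: ge_ereal_sup => _ [j /= j1 <-]; rewrite /dyad_level_norm.
have [->|jN1] := eqVneq j (-1).
  apply: (@le_trans _ _ (cLnorm p f)); last by rewrite leeDl// Lnorm_ge0.
  have cI m : ((normc ((2 ^ (-1))%:C * haar_coef eta0 (distr_of f) (-1) m))%:E <=
     \int[mu]_(x in grid_itv 1 m) (normc (f x))%:E)%E.
    rewrite (ae_eq_normc_integral (measurable_grid_itv _ _) mf (continuous_cmeas cF) fF).
    exact: (haar_coef_scaling_le ce cF FB TF).
  have muI m : mu (grid_itv 1 m) = 1%:E by rewrite lebesgue_measure_grid_itv// invr1.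
  have := lp_norm_local_averages (measurable_grid_itv 1) muI
    (trivIset_grid_itv ltr01) ltr01 p1 (measurable_normc mf)
    (fun x => normc_ge0 (f x)) (fun m => normc_ge0 _) cI.
  rewrite powR1 mul1e => /(le_trans _); apply.
  rewrite -[leRHS]mul1e; apply: lee_wpmul2r.
    exact: lp_norm_ge0.
  rewrite lee_fin -[leRHS](powRr0 2); apply: ler_powR; rewrite ?ler1n//.
  by rewrite mulN1r oppr_le0.
apply: (@le_trans _ _ (cLnorm p g)); last by rewrite leeDr// Lnorm_ge0.
have N0 : (0 : R) < 2 ^ j by rewrite exprz_gt0.
have l0 : (0 : R) < (2 ^ j)^-1 by rewrite invr_gt0.
have := lp_norm_local_averages (measurable_grid_itv _) (lebesgue_measure_grid_itv N0)
    (trivIset_grid_itv N0) l0 p1 mgn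
    (fun x => normc_ge0 (g x)) (fun m => normc_ge0 _)
    (fun m => haar_coef_le ce cF FB TF m jN1 lg incr inci).
rewrite -/s powRrM powR_intmul// => H.
have a0 : ((0 : \bar R) <= ((2 ^ j) `^ s)%:E)%E by rewrite lee_fin powR_ge0.
apply: le_trans (lee_wpmul2l a0 H) _.
rewrite muleA -EFinM -powRM ?(ltW N0) ?(ltW l0)// mulfV ?gt_eqF// powR1 mul1e.
exact: lexx.
Qed.

(** Two weak derivatives appear because the Sobolev norm is defined with a chosen
    one, while membership in the Sobolev space only says that some weak
    derivative g0 is in L^p.  The bound on the representative comes from g0, the
    estimate from g. *)
Lemma sobolev_dyad (eta0 : R -> R[i]) p f g0 g : cutoff eta0 -> (1 <= p)%E ->
  inLp p f -> inLp p g0 -> weak_derivative f g0 -> weak_derivative f g ->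
  besov eta0 (distr_of f) /\
  (dyad_norm eta0 p (distr_of f) <= cLnorm p f + cLnorm p g)%E.
Proof.
move=> ce p1 fp g0p fg0 fg; have [mf _] := fp.
have lf := Lp_locally_integrable p1 fp.
have [F [cF fF incr inci]] := weak_derivative_representative ce lf fg0.
have [F' [cF' fF' incr' inci']] := weak_derivative_representative ce lf fg.
have [B FB] := bounded_representative p1 fp g0p cF fF incr inci.
have FF' : F = F'.
  have [A [mA A0 PA]] := fF; have [A' [mA' A'0 PA']] := fF'.
  have H (phi : R[i] -> R) : {ae mu, forall x, phi (F x) = phi (F' x)}.
    exists (A `|` A'); split; first exact: measurableU.
      by rewrite measureU0.
    move=> x /= nx; apply: contrapT => nA; apply: nx.
    have E : f x = F x by apply: contrapT => n; apply: nA; left; exact: PA.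
    have E' : f x = F' x by apply: contrapT => n; apply: nA; right; exact: PA'.
    by rewrite -E -E'.
  have [cr ci] := cF; have [cr' ci'] := cF'.
  have Er := continuous_ae_eq cr cr' (H (@complex.Re R)).
  have Ei := continuous_ae_eq ci ci' (H (@complex.Im R)).
  apply/funext => x; apply: complex_ext; [exact: (congr1 (@^~ x) Er)|exact: (congr1 (@^~ x) Ei)].
rewrite -FF' in incr' inci'.
have TF psi : ccontinuous psi -> distr_of f psi = distr_of F psi.
  by move=> cpsi; exact: distr_of_ae_eq.
have tT := tempered_bounded cF FB TF; have bT := besov_norm_bounded ce cF FB TF.
split; first by [].
by have [lg _] := fg; apply: (dyad_norm_le ce p1 mf cF FB fF lg incr' inci').
Qed.

End DyadicNorm.

Theorem corollary1p5 (R : realType) (eta0 : R -> R[i]) (heta0 : cutoff eta0)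
    (p : \bar R) (hp : (1 <= p)%E) :
  (@distr_of R) @` (sobolev p) `<=` besov_dyad eta0 p /\
  exists C : R, forall f : R -> R[i], sobolev p f ->
    (dyad_norm eta0 p (distr_of f) <= C%:E * sobolev_norm p f)%E.
Proof.
split=> [_ [f [fp [g [gp fg]]] <-]|].
  have [bf df] := sobolev_dyad heta0 hp fp gp fg fg.
  split=> //; apply: le_lt_trans df _.
  by have [_ fy] := fp; have [_ gy] := gp; exact: lte_add_pinfty.
exists 1 => f [fp [g [gp fg]]]; rewrite mul1e.
(* Some weak derivative exists, so the chosen one is a weak derivative. *)
have fw : weak_derivative f (wderiv f).
  by apply: (@xgetPex _ (cst 0) (weak_derivative f)); exists g.
by have [_] := sobolev_dyad heta0 hp fp gp fg fw.
Qed.
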